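(* Let $R$ be a commutative ring and let $P_0$ be a finitely generated projective $R$-module of constant rank $2$ with a fixed trivialization $\theta_0: R \xrightarrow{\cong} \det(P_0)$. Let $V: Um(P_0\oplus R)/E(P_0\oplus R)\to\tilde V(R)$ be the generalized Vaserstein symbol associated to $\theta_0$. (1) $V$ is surjective if $Um(P_{2n+1}) = \pi_{2n+1,2n+1}E(P_{2n+1})$ for all $n\geq 2$. (2) $V$ is injective if $\pi_{2n,2n}E(P_{2n}) = \pi_{2n,2n}(E_\infty(P_0)\cap Aut(P_{2n}))$ for all $n\geq 3$ and $E_\infty(P_0)\cap Aut(P_4)=E(P_4)$.
   Context: Modules: for $n\ge3$, $P_n=P_0\oplus Re_3\oplus\dots\oplus Re_n$ with $Re_i$ free of rank $1$ on $e_i$ (so $P_3=P_0\oplus R$, $P_4=P_0\oplus R^2$); $\pi_{k,n}:P_n\to R$ is the projection onto the summand $Re_k\cong R$. $Um(M)$ is the set of surjective $R$-linear maps $M\to R$, with right action of $Aut(M)$ by precomposition; for $a\in Um(M)$ and a subset $H\subset Aut(M)$, $aH=\{a\varphi:\varphi\in H\}$. For $M=\bigoplus_i M_i$, $E(M)\subset Aut(M)$ is generated by the automorphisms $id_M+s$ with $s:M_j\to M_i$ linear, $i\ne j$; $E(P_n)$ is taken with respect to $P_0,Re_3,\dots,Re_n$. Via $\varphi\mapsto\varphi\oplus id$, $Aut(P_n)\subset Aut(P_{n+1})$ and $E(P_n)\subset E(P_{n+1})$; $E_\infty(P_0)=\varinjlim E(P_n)$ inside $Aut_\infty(P_0)=\varinjlim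 Aut(P_n)$, where intersections are taken. Forms: an alternating isomorphism on a finitely generated projective module $P$ is an isomorphism $f: P\to P^\vee$ with $f(p)(p)=0$ for all $p$; it is the same as a non-degenerate alternating form $\chi$ on $P$ via $f(q)=\chi(-,q)$. For a linear map $\alpha$, $\alpha^t\chi\alpha$ denotes $(x,y)\mapsto\chi(\alpha x,\alpha y)$; $\perp$ is the orthogonal sum. $\psi_2$ is the form on $R^2$ with matrix $\begin{pmatrix}0&1\\-1&0\end{pmatrix}$. The group $V(R)$: triples $(P,g,f)$ with $P$ finitely generated projective and $f,g$ alternating isomorphisms on $P$; $(P,f_0,f_1)$, $(P',f_0',f_1')$ are isometric if there is an isomorphism $h:P\to P'$ with $f_i=h^\vee f_i' h$ for $i=0,1$. $V(R)$ is the quotient of the free abelian group on isometry classes $[P,g,f]$ by the relations $[P\oplus P',g\perp g',f\perp f']=[P,g,f]+[P',g',f']$ and $[P,f_0,f_1]+[P,f_1,f_2]=[P,f_0,f_2]$. The same construction with free modules gives $V_{free}(R)$, and $V_{free}(R)\to V(R)$ is an isomorphism; hence there is a unique homomorphism $\overline{Pf}:V(R)\to R^\times$ with $[R^{2n},g,f]\mapsto Pf(f)Pf(g)^{-1}$ (Pfaffians of alternating invertible matrices). $\tilde V(R)=\ker\overline{Pf}$. Generalized Vaserstein symbol: $\chi_0$ is the form $(p,q)\mapsto\theta_0^{-1}(p\wedge q)$ on $P_0$. For $a\in Um(P_0\oplus R)$ with section $s$, let $P(a)=\ker a$, $i:P_0\oplus R\to P(a)\oplus R$, $i(p)=(p-s(a(p)),a(p))$,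 and $\chi_a(p,q)=\theta^{-1}(p\wedge q)$ on $P(a)$, where $\theta$ is $\theta_0$ followed by $\det(P_0)\cong\det(P_0\oplus R)\cong\det(P(a))$ (the first map is $w\mapsto w\wedge e_3$, the second the inverse of $w\mapsto w\wedge s(1)$). Then $V(a)=[P_0\oplus R^2,\chi_0\perp\psi_2,(i\oplus1)^t(\chi_a\perp\psi_2)(i\oplus1)]$; it is independent of $s$, lies in $\tilde V(R)$ and is invariant under $a\mapsto a\varphi$, $\varphi\in E(P_0\oplus R)$. *)

(* Defs.v *)
From HB Require Import structures.
From mathcomp Require Import all_boot all_order all_algebra.
From mathcomp Require Import generic_quotient.
From mathcomp Require Import boolp classical_sets.

Set Implicit Arguments.
Unset Strict Implicit.
Unset Printing Implicit Defensive.

Import GRing.Theory.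
Local Open Scope quotient_scope.
Local Open Scope classical_set_scope.
Local Open Scope ring_scope.

Section Modules.
Variable R : comPzRingType.
Implicit Types M N : lmodType R.

Definition finitely_generated M : Prop :=
  exists (n : nat) (x : 'I_n -> M),
    forall z : M, exists c : 'I_n -> R, z = \sum_i c i *: x i.

Definition projective M : Prop :=
  forall (N N' : lmodType R) (g : {linear N -> N'}) (f : {linear M -> N'}),
    (forall y, exists x, g x = y) ->
    exists h : {linear M -> N}, forall x, g (h x) = f x.

Definition fg_projective M : Prop := finitely_generated M /\ projective M.

Definition prime_ideal (p : set R) : Prop :=
  [/\ p 0,
      forall x y, p x -> p y -> p (x + y),
      forall a x, p x -> p (a * x),
      ~ p 1 &
      forall x y, p (x * y) -> p x \/ p y].

(** The localisation of [M] at [p] is free of rank [n].  A basis of it can be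
    rescaled by units of the local ring so as to consist of images of elements
    [x i] of [M]; the two clauses say, after clearing denominators, that these
    images span the localisation and are linearly independent in it. *)
Definition has_rank_at (p : set R) (n : nat) M : Prop :=
  exists x : 'I_n -> M,
    (forall z : M, exists s, exists c : 'I_n -> R,
        ~ p s /\ s *: z = \sum_i c i *: x i) /\
    (forall c : 'I_n -> R, \sum_i c i *: x i = 0 ->
        exists s, ~ p s /\ forall i, s * c i = 0).

Definition constant_rank (n : nat) M : Prop :=
  forall p : set R, prime_ideal p -> has_rank_at p n M.

End Modules.

Section ExteriorPower.
Variables (R : comPzRingType) (M : lmodType R) (k : nat).

(** The sequence of the pairs [(r, t)] stands for the formal linear combination
    of the symbols [t 0 /\ ... /\ t (k - 1)] with coefficients [r]. *)
Local Notation ext_formal := (seq (R * {ffun 'I_k -> M})).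

Definition upd (t : {ffun 'I_k -> M}) (i : 'I_k) (x : M) : {ffun 'I_k -> M} :=
  [ffun j => if j == i then x else t j].

Inductive ext_rel : ext_formal -> ext_formal -> Prop :=
| ext_refl l : ext_rel l l
| ext_sym l1 l2 : ext_rel l1 l2 -> ext_rel l2 l1
| ext_trans l1 l2 l3 : ext_rel l1 l2 -> ext_rel l2 l3 -> ext_rel l1 l3
| ext_cat l1 l1' l2 l2' :
    ext_rel l1 l1' -> ext_rel l2 l2' -> ext_rel (l1 ++ l2) (l1' ++ l2')
| ext_comm l1 l2 : ext_rel (l1 ++ l2) (l2 ++ l1)
| ext_coef0 t : ext_rel [:: (0, t)] [::]
| ext_coefD r s t : ext_rel [:: (r + s, t)] [:: (r, t); (s, t)]
| ext_argD r t i x y :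
    ext_rel [:: (r, upd t i (x + y))] [:: (r, upd t i x); (r, upd t i y)]
| ext_argZ r t i c x :
    ext_rel [:: (r, upd t i (c *: x))] [:: (r * c, upd t i x)]
| ext_alt r (t : {ffun 'I_k -> M}) i j : i != j -> t i = t j -> ext_rel [:: (r, t)] [::].

Definition ext_relb : rel ext_formal := fun l1 l2 => `[< ext_rel l1 l2 >].

Lemma ext_relb_equiv : equiv_class_of ext_relb.
Proof.
split.
- by move=> l; apply/asboolP; exact: ext_refl.
- by move=> l1 l2; apply/asboolP/asboolP; exact: ext_sym.
- by move=> l2 l1 l3 /asboolP h /asboolP h'; apply/asboolP; exact: ext_trans h h'.
Qed.

Canonical ext_equiv := EquivRelPack ext_relb_equiv.

Definition exterior : Type := {eq_quot ext_equiv}.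
HB.instance Definition _ := Choice.on exterior.
HB.instance Definition _ := EqQuotient.on exterior.

Definition ext_class (l : ext_formal) : exterior := \pi_exterior l.

Lemma ext_classP l1 l2 : ext_class l1 = ext_class l2 <-> ext_rel l1 l2.
Proof.
split; first by move/eqmodP => /asboolP.
by move=> h; apply/eqmodP/asboolP.
Qed.

Lemma ext_classK (w : exterior) : ext_class (repr w) = w.
Proof. exact: reprK. Qed.

Lemma ext_repr l : ext_rel (repr (ext_class l)) l.
Proof. by apply/ext_classP; rewrite ext_classK. Qed.

Definition fscale (c : R) (l : ext_formal) : ext_formal :=
  [seq (c * p.1, p.2) | p <- l].

Lemma fscale_rel c l l' : ext_rel l l' -> ext_rel (fscale c l) (fscale c l').
Proof.
elim=> {l l'}.
- by move=> *; exact: ext_refl.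
- by move=> *; exact: ext_sym.
- by move=> l1 l2 l3 _ h _ h'; exact: ext_trans h h'.
- by move=> l1 l1' l2 l2' _ h _ h'; rewrite /fscale !map_cat; exact: ext_cat.
- by move=> l1 l2; rewrite /fscale !map_cat; exact: ext_comm.
- by move=> t /=; rewrite mulr0; exact: ext_coef0.
- by move=> r s t /=; rewrite mulrDr; exact: ext_coefD.
- by move=> *; exact: ext_argD.
- by move=> r t i d x /=; rewrite mulrA; exact: ext_argZ.
- by move=> r t i j; exact: ext_alt.
Qed.

Definition ext_add (u v : exterior) := ext_class (repr u ++ repr v).
Definition ext_scale (c : R) (u : exterior) := ext_class (fscale c (repr u)).
Definition ext_opp (u : exterior) := ext_scale (-1) u.

Lemma ext_addE l1 l2 :
  ext_add (ext_class l1) (ext_class l2) = ext_class (l1 ++ l2).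
Proof. by apply/ext_classP; apply: ext_cat; exact: ext_repr. Qed.

Lemma ext_scaleE c l : ext_scale c (ext_class l) = ext_class (fscale c l).
Proof. by apply/ext_classP; apply: fscale_rel; exact: ext_repr. Qed.

Lemma ext_ind (P : exterior -> Prop) :
  (forall l, P (ext_class l)) -> forall u, P u.
Proof. by move=> h u; rewrite -(ext_classK u). Qed.

Lemma ext_addA : associative ext_add.
Proof.
by elim/ext_ind=> l1; elim/ext_ind=> l2; elim/ext_ind=> l3; rewrite !ext_addE catA.
Qed.

Lemma ext_addC : commutative ext_add.
Proof.
elim/ext_ind=> l1; elim/ext_ind=> l2; rewrite !ext_addE.
by apply/ext_classP; exact: ext_comm.
Qed.

Lemma ext_add0 : left_id (ext_class [::]) ext_add.
Proof. by elim/ext_ind=> l; rewrite ext_addE. Qed.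

Lemma ext_scaleDl' c d l :
  ext_class (fscale (c + d) l) = ext_class (fscale c l ++ fscale d l).
Proof.
elim: l => [//|[r t] l ih].
have consE e : ext_class (fscale e ((r, t) :: l)) =
    ext_add (ext_class [:: (e * r, t)]) (ext_class (fscale e l)).
  by rewrite ext_addE.
rewrite -ext_addE !consE ih -ext_addE.
have -> : ext_class [:: ((c + d) * r, t)] =
          ext_add (ext_class [:: (c * r, t)]) (ext_class [:: (d * r, t)]).
  by rewrite mulrDl ext_addE; apply/ext_classP; exact: ext_coefD.
rewrite -!ext_addA; congr ext_add.
by rewrite !ext_addA; congr ext_add; exact: ext_addC.
Qed.

Lemma ext_scale0' l : ext_class (fscale 0 l) = ext_class [::].
Proof.
elim: l => [//|[r t] l ih].
have -> : ext_class (fscale 0 ((r, t) :: l)) =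
    ext_add (ext_class [:: (0 * r, t)]) (ext_class (fscale 0 l)).
  by rewrite ext_addE.
by rewrite ih ext_addE cats0 mul0r; apply/ext_classP; exact: ext_coef0.
Qed.

Lemma fscale1 l : fscale 1 l = l.
Proof. by elim: l => [//|[r t] l /= ->]; rewrite mul1r. Qed.

Lemma ext_addN : left_inverse (ext_class [::]) ext_opp ext_add.
Proof.
elim/ext_ind=> l; rewrite /ext_opp ext_scaleE -{2}(fscale1 l) ext_addE.
by rewrite -ext_scaleDl' addNr ext_scale0'.
Qed.

HB.instance Definition _ :=
  GRing.isZmodule.Build exterior ext_addA ext_addC ext_add0 ext_addN.

Lemma ext_scaleA c d u : ext_scale c (ext_scale d u) = ext_scale (c * d) u.
Proof.
elim/ext_ind: u => l; rewrite !ext_scaleE /fscale -map_comp; congr ext_class.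
by apply: eq_map => p /=; rewrite mulrA.
Qed.

Lemma ext_scale1 : left_id 1 ext_scale.
Proof. by elim/ext_ind=> l; rewrite ext_scaleE fscale1. Qed.

Lemma ext_scaleDr : right_distributive ext_scale +%R.
Proof.
move=> c; elim/ext_ind=> l1; elim/ext_ind=> l2.
change (ext_scale c (ext_add (ext_class l1) (ext_class l2)) =
  ext_add (ext_scale c (ext_class l1)) (ext_scale c (ext_class l2))).
by rewrite ext_addE !ext_scaleE ext_addE /fscale map_cat.
Qed.

Lemma ext_scaleDl u : {morph ext_scale^~ u : c d / c + d}.
Proof.
move=> c d; elim/ext_ind: u => l.
change (ext_scale (c + d) (ext_class l) =
  ext_add (ext_scale c (ext_class l)) (ext_scale d (ext_class l))).
by rewrite !ext_scaleE ext_addE ext_scaleDl'.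
Qed.

HB.instance Definition _ := GRing.Zmodule_isLmodule.Build R exterior
  ext_scaleA ext_scale1 ext_scaleDr ext_scaleDl.

Definition wedge (t : 'I_k -> M) : exterior := ext_class [:: (1, [ffun i => t i])].

End ExteriorPower.

Section AlternatingMaps.
Variables (R : comPzRingType) (M N : lmodType R) (k : nat).
Variable f : {ffun 'I_k -> M} -> N.

Definition alternating_map : Prop :=
  [/\ forall t i x y, f (upd t i (x + y)) = f (upd t i x) + f (upd t i y),
      forall t i c x, f (upd t i (c *: x)) = c *: f (upd t i x) &
      forall (t : {ffun 'I_k -> M}) i j, i != j -> t i = t j -> f t = 0].

Definition ext_eval (l : seq (R * {ffun 'I_k -> M})) : N :=
  \sum_(p <- l) p.1 *: f p.2.

Lemma ext_eval_rel l l' :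
  alternating_map -> ext_rel l l' -> ext_eval l = ext_eval l'.
Proof.
case=> fD fZ f0; rewrite /ext_eval; elim=> {l l'} //.
- by move=> l1 l2 l3 _ -> _ ->.
- by move=> l1 l1' l2 l2' _ h _ h'; rewrite !big_cat /= h h'.
- by move=> l1 l2; rewrite !big_cat /= addrC.
- by move=> t; rewrite big_seq1 scale0r big_nil.
- by move=> r s t; rewrite !big_cons big_nil addr0 scalerDl addr0.
- by move=> r t i x y; rewrite !big_cons big_nil !addr0 fD scalerDr.
- by move=> r t i c x; rewrite !big_cons big_nil !addr0 fZ scalerA.
- by move=> r t i j ij tij; rewrite big_seq1 big_nil (f0 _ _ _ ij tij) scaler0.
Qed.

Definition ext_lift of alternating_map :=
  fun w : exterior M k => ext_eval (repr w).

Hypothesis hf : alternating_map.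

Lemma ext_liftE l : ext_lift hf (ext_class l) = ext_eval l.
Proof. by apply: ext_eval_rel => //; exact: ext_repr. Qed.

Lemma ext_lift_linear : linear (ext_lift hf).
Proof.
move=> c; elim/ext_ind=> l1; elim/ext_ind=> l2.
change (ext_lift hf (ext_add (ext_scale c (ext_class l1)) (ext_class l2)) =
  c *: ext_lift hf (ext_class l1) + ext_lift hf (ext_class l2)).
rewrite ext_scaleE ext_addE !ext_liftE /ext_eval big_cat; congr (_ + _).
rewrite /fscale big_map scaler_sumr; apply: eq_bigr => p _ /=.
by rewrite scalerA.
Qed.

HB.instance Definition _ := GRing.isLinear.Build R (exterior M k) N _
  (ext_lift hf) ext_lift_linear.

Lemma ext_lift_wedge (t : {ffun 'I_k -> M}) : ext_lift hf (wedge t) = f t.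
Proof.
rewrite /wedge ext_liftE /ext_eval big_seq1 scale1r; congr f.
by apply/ffunP=> i; rewrite ffunE.
Qed.

End AlternatingMaps.

Section Wedge.
Variables (R : comPzRingType).

Definition wedge2 (M : lmodType R) (x y : M) : exterior M 2 :=
  wedge (fun i => if i == ord0 then x else y).

Variables (M N : lmodType R) (k : nat) (g : {linear M -> N}) (v : N).

Definition wedge_right_fun (t : {ffun 'I_k -> M}) : exterior N k.+1 :=
  wedge (fun i => if unlift ord_max i is Some j then g (t j) else v).

Lemma wedge_right_alt : alternating_map wedge_right_fun.
Proof.
pose T (t : {ffun 'I_k -> M}) : {ffun 'I_k.+1 -> N} :=
  [ffun i => if unlift ord_max i is Some j then g (t j) else v].
have TE t : wedge_right_fun t = ext_class [:: (1, T t)] by [].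
have Tupd t i x : T (upd t i x) = upd (T t) (lift ord_max i) (g x).
  apply/ffunP=> j; rewrite !ffunE; case: unliftP => [j' ->|->].
    by rewrite (inj_eq (@lift_inj _ _)) ffunE; case: eqP.
  by rewrite (negbTE (neq_lift _ _)).
split=> [t i x y|t i c x|t i j ij tij].
- rewrite !TE !Tupd linearD.
  rewrite [RHS](ext_addE [:: _] [:: _]); apply/ext_classP; exact: ext_argD.
- rewrite !TE !Tupd linearZ.
  rewrite [RHS](ext_scaleE _ [:: _]) /= mulr1 -{2}[c]mul1r.
  by apply/ext_classP; exact: ext_argZ.
- rewrite TE; apply/ext_classP.
  apply: (@ext_alt _ _ _ _ _ (lift ord_max i) (lift ord_max j)).
    by rewrite (inj_eq (@lift_inj _ _)).
  by rewrite !ffunE !liftK tij.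
Qed.

(** [m_1 /\ ... /\ m_k |-> g m_1 /\ ... /\ g m_k /\ v] *)
Definition wedge_right : {linear exterior M k -> exterior N k.+1} :=
  ext_lift wedge_right_alt.

End Wedge.

Section DirectSum.
Variables (R : comPzRingType) (M N : lmodType R).

Definition in1 (x : M) : M * N := (x, 0).
Definition in2 (y : N) : M * N := (0, y).

Lemma in1_linear : linear in1.
Proof.
move=> c x y; congr pair.
by change (0 = c *: (0 : N) + 0); rewrite scaler0 addr0.
Qed.

Lemma in2_linear : linear in2.
Proof.
move=> c x y; congr pair.
by change (0 = c *: (0 : M) + 0); rewrite scaler0 addr0.
Qed.

HB.instance Definition _ := GRing.isLinear.Build R M (M * N)%type _ in1 in1_linear.
HB.instance Definition _ := GRing.isLinear.Build R N (M * N)%type _ in2 in2_linear.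

Definition sum_id (phi : M -> M) (u : M * N) : M * N := (phi u.1, u.2).

Lemma sum_id_linear (phi : {linear M -> M}) : linear (sum_id phi).
Proof. by move=> c u v; congr pair; rewrite /= linearP. Qed.

HB.instance Definition _ (phi : {linear M -> M}) :=
  GRing.isLinear.Build R (M * N)%type (M * N)%type _ (sum_id phi) (sum_id_linear phi).

End DirectSum.

Lemma linear_ext (R : comPzRingType) (M N : lmodType R) (f g : {linear M -> N}) :
  f =1 g -> f = g.
Proof.
move=> /funext; case: f g => [f cf] [g cg] /= fg.
case: g / fg cg => cg; congr GRing.Linear.Pack.
case: cf cg => [[c1] [c2]] [[d1] [d2]].
by rewrite (Prop_irrelevance c1 d1) (Prop_irrelevance c2 d2).
Qed.

Section Automorphisms.
Variables (R : comPzRingType) (M : lmodType R).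

Definition Um : set {linear M -> R^o} := [set a | forall r, exists x, a x = r].

Definition AutM : set {linear M -> M} := [set phi | bijective phi].

Definition Um_orbit (a : {linear M -> R^o}) (H : set {linear M -> M}) :
  set {linear M -> R^o} := [set b | exists2 phi, H phi & b = a \o phi].

(** [M] is the direct sum of the modules [S i], with inclusions [inc] and
    projections [prj]. *)
Variables (I : Type) (S : I -> lmodType R).
Variables (inc : forall i, {linear S i -> M}) (prj : forall i, {linear M -> S i}).

Definition elementary_gen (i j : I) (s : {linear S j -> S i}) : {linear M -> M} :=
  idfun \+ (inc i \o s \o prj j).

Inductive Egen : set {linear M -> M} :=
| Egen_gen i j (s : {linear S j -> S i}) : i <> j -> Egen (elementary_gen s)
| Egen_id : Egen idfun
| Egen_comp phi psi : Egen phi -> Egen psi -> Egen (phi \o psi)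
| Egen_inv (phi psi : {linear M -> M}) :
    Egen phi -> cancel phi psi -> cancel psi phi -> Egen psi.

End Automorphisms.

Section Stabilisation.
Variables (R : comPzRingType) (P0 : lmodType R).

Fixpoint stab (k : nat) : lmodType R :=
  if k is k'.+1 then (stab k' * R^o)%type else P0.

Definition P_ (n : nat) : lmodType R := stab (n - 2)%N.

Fixpoint stab_inc0 (k : nat) : {linear P0 -> stab k} :=
  match k with
  | 0 => idfun
  | k'.+1 => @in1 R (stab k') R^o \o stab_inc0 k'
  end.

Fixpoint stab_prj0 (k : nat) : {linear stab k -> P0} :=
  match k with
  | 0 => idfun
  | k'.+1 => stab_prj0 k' \o fst
  end.

(** The summand [j] of [stab k], for [j < k], is [R e_(j + 3)]. *)
Fixpoint stab_inc (k j : nat) : {linear R^o -> stab k} :=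
  match k with
  | 0 => \0
  | k'.+1 => if j == k' as _ return {linear R^o -> stab k'.+1}
             then @in2 R (stab k') R^o else @in1 R (stab k') R^o \o stab_inc k' j
  end.

Fixpoint stab_prj (k j : nat) : {linear stab k -> R^o} :=
  match k with
  | 0 => \0
  | k'.+1 => if j == k' as _ return {linear stab k'.+1 -> R^o}
             then snd else stab_prj k' j \o fst
  end.

Definition pi_ (k n : nat) : {linear P_ n -> R^o} := stab_prj (n - 2)%N (k - 3)%N.

Definition summand (k : nat) (i : option 'I_k) : lmodType R :=
  if i is Some _ then R^o else P0.

Definition summand_inc k (i : option 'I_k) : {linear summand i -> stab k} :=
  match i with
  | Some j => stab_inc k j
  | None => stab_inc0 k
  end.

Definition summand_prj k (i : option 'I_k) : {linear stab k -> summand i} :=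
  match i with
  | Some j => stab_prj k j
  | None => stab_prj0 k
  end.

Definition Estab (k : nat) : set {linear stab k -> stab k} :=
  Egen (@summand_inc k) (@summand_prj k).

Definition E (n : nat) : set {linear P_ n -> P_ n} := @Estab (n - 2)%N.

Fixpoint stab_up (k : nat) (phi : {linear stab k -> stab k}) (j : nat) :
  {linear stab (j + k) -> stab (j + k)} :=
  match j with
  | 0 => phi
  | j'.+1 => @sum_id R (stab (j' + k)) R^o (stab_up phi j')
  end.

(** The elements of [Aut (P_ n)] whose image in the direct limit of the groups
    [Aut (P_ m)] lies in the direct limit of the groups [E m]; the transition
    maps being injective, these are the automorphisms that become elementary
    after finitely many stabilisations. *)
Definition Einfty_cap_Aut (n : nat) : set {linear P_ n -> P_ n} :=
  [set phi | AutM phi /\ exists j, Estab (stab_up phi j)].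

End Stabilisation.

Arguments pi_ {R} P0 k n.
Arguments E {R} P0 n.
Arguments Einfty_cap_Aut {R} P0 n.

Section Forms.
Variable R : comPzRingType.
Implicit Types M N : lmodType R.

(** The last clause says that [q |-> chi (-, q)] is a bijection from [M] onto
    its dual. *)
Definition is_alternating_iso M (chi : M -> M -> R) : Prop :=
  [/\ forall q, linear (fun p => chi p q : R^o),
      forall p, linear (fun q => chi p q : R^o),
      forall p, chi p p = 0 &
      forall l : {linear M -> R^o}, exists! q, forall p, chi p q = l p].

Record alternating_iso M := AlternatingIso {
  form :> M -> M -> R;
  formP : is_alternating_iso form }.

Definition perp M N (chi : M -> M -> R) (psi : N -> N -> R) :
  M * N -> M * N -> R := fun u v => chi u.1 v.1 + psi u.2 v.2.

Lemma fg_projective_sum M N :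
  fg_projective M -> fg_projective N -> fg_projective (M * N)%type.
Proof.
case=> -[m [x hx]] pM [[n [y hy]] pN]; split.
  exists (m + n)%N, (fun i => match split i with
    | inl i => in1 N (x i) | inr j => in2 M (y j) end) => -[u v].
  have [c uE] := hx u; have [d vE] := hy v.
  exists (fun i => match split i with inl i => c i | inr j => d j end).
  rewrite big_split_ord /=.
  under eq_bigr => i _ do rewrite (unsplitK (inl i)) -linearZ.
  under [X in _ + X]eq_bigr => i _ do rewrite (unsplitK (inr i)) -linearZ.
  rewrite -!linear_sum -uE -vE; congr pair => /=.
    by rewrite addr0.
  by rewrite add0r.
move=> Q Q' g f sg.
have [h1 h1E] := pM Q Q' g (f \o @in1 R M N) sg.
have [h2 h2E] := pN Q Q' g (f \o @in2 R M N) sg.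
exists ((h1 \o fst) \+ (h2 \o snd)) => -[u v] /=.
rewrite linearD h1E h2E /= -linearD; congr (f _); congr pair => /=.
  by rewrite addr0.
by rewrite add0r.
Qed.

Lemma perp_alternating M N (chi : alternating_iso M) (psi : alternating_iso N) :
  is_alternating_iso (perp chi psi).
Proof.
case: chi psi => chi [c1 c2 c3 c4] [psi [p1 p2 p3 p4]] /=; split.
- move=> q r x y; rewrite /perp /= c1 p1 scalerDr -!addrA; congr (_ + _).
  by rewrite addrCA.
- move=> q r x y; rewrite /perp /= c2 p2 scalerDr -!addrA; congr (_ + _).
  by rewrite addrCA.
- by move=> q; rewrite /perp c3 p3 addr0.
- move=> l.
  have [u [uE uU]] := c4 (l \o @in1 R M N).
  have [v [vE vU]] := p4 (l \o @in2 R M N).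
  have chi0 x : chi 0 x = 0 by have := c1 x (-1) 0 0; rewrite scaler0 addr0 scaleN1r addNr.
  have psi0 x : psi 0 x = 0 by have := p1 x (-1) 0 0; rewrite scaler0 addr0 scaleN1r addNr.
  exists (u, v); split=> [[x y]|[u' v'] h].
    rewrite /perp /= uE vE /= -linearD; congr (l _); congr pair => /=.
      by rewrite addr0.
    by rewrite add0r.
  congr pair.
    by apply: uU => x /=; rewrite -h /perp /= psi0 addr0.
  by apply: vU => x /=; rewrite -h /perp /= chi0 add0r.
Qed.

Definition perp_iso M N (chi : alternating_iso M) (psi : alternating_iso N) :
  alternating_iso (M * N)%type := AlternatingIso (perp_alternating chi psi).

Record triple := Triple {
  tmod : lmodType R;
  tmodP : fg_projective tmod;
  tg : alternating_iso tmod;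
  tf : alternating_iso tmod }.

Definition isometric (t t' : triple) : Prop :=
  exists h : {linear tmod t -> tmod t'},
    [/\ bijective h,
        forall x y, tg t x y = tg t' (h x) (h y) &
        forall x y, tf t x y = tf t' (h x) (h y)].

Definition triple_sum (t t' : triple) : triple :=
  Triple (fg_projective_sum (tmodP t) (tmodP t'))
    (perp_iso (tg t) (tg t')) (perp_iso (tf t) (tf t')).

(** Expressions for the elements of the abelian group generated by the triples;
    [Vrel] is the congruence that makes them an abelian group and imposes the
    relations of V(R). *)
Inductive formal : Type :=
| Fgen of triple
| Fzero
| Fadd of formal & formal
| Fopp of formal.

Inductive Vrel : formal -> formal -> Prop :=
| Vrel_refl u : Vrel u u
| Vrel_sym u v : Vrel u v -> Vrel v u
| Vrel_trans u v w : Vrel u v -> Vrel v w -> Vrel u w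
| Vrel_add u u' v v' : Vrel u u' -> Vrel v v' -> Vrel (Fadd u v) (Fadd u' v')
| Vrel_opp u u' : Vrel u u' -> Vrel (Fopp u) (Fopp u')
| Vrel_addA u v w : Vrel (Fadd u (Fadd v w)) (Fadd (Fadd u v) w)
| Vrel_addC u v : Vrel (Fadd u v) (Fadd v u)
| Vrel_add0 u : Vrel (Fadd Fzero u) u
| Vrel_addN u : Vrel (Fadd (Fopp u) u) Fzero
| Vrel_isometric t t' : isometric t t' -> Vrel (Fgen t) (Fgen t')
| Vrel_sum t t' : Vrel (Fgen (triple_sum t t')) (Fadd (Fgen t) (Fgen t'))
| Vrel_chain M (hM : fg_projective M) (f0 f1 f2 : alternating_iso M) :
    Vrel (Fadd (Fgen (Triple hM f0 f1)) (Fgen (Triple hM f1 f2)))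
         (Fgen (Triple hM f0 f2)).

(** An element of V(R) is an equivalence class for [Vrel]. *)
Definition V : Type := {A : formal -> Prop | exists u, A = Vrel u}.

Definition Vclass (u : formal) : V := exist _ (Vrel u) (ex_intro _ u erefl).

Lemma VclassP u u' : Vclass u = Vclass u' <-> Vrel u u'.
Proof.
split=> [h|h].
  have : sval (Vclass u') u' by exact: Vrel_refl.
  by rewrite -h.
by apply: eq_exist; apply/funext=> w; apply/propext; split=> h';
  [exact: Vrel_trans (Vrel_sym h) h' | exact: Vrel_trans h h'].
Qed.

Definition Vrepr (x : V) : formal := projT1 (cid (svalP x)).

Lemma Vrepr_class x : Vclass (Vrepr x) = x.
Proof.
rewrite /Vrepr; case: cid => u /= uE; case: x uE => A hA /= AE.
by apply: eq_exist.
Qed.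

Definition Vzero : V := Vclass Fzero.
Definition Vadd (x y : V) : V := Vclass (Fadd (Vrepr x) (Vrepr y)).
Definition Vopp (x : V) : V := Vclass (Fopp (Vrepr x)).

Lemma Vadd_class u v : Vadd (Vclass u) (Vclass v) = Vclass (Fadd u v).
Proof. by apply/VclassP; apply: Vrel_add; apply/VclassP; exact: Vrepr_class. Qed.

Lemma Vopp_class u : Vopp (Vclass u) = Vclass (Fopp u).
Proof. by apply/VclassP; apply: Vrel_opp; apply/VclassP; exact: Vrepr_class. Qed.

Lemma VaddA x y z : Vadd x (Vadd y z) = Vadd (Vadd x y) z.
Proof.
rewrite -(Vrepr_class x) -(Vrepr_class y) -(Vrepr_class z) !Vadd_class.
by apply/VclassP; exact: Vrel_addA.
Qed.

Lemma VaddC x y : Vadd x y = Vadd y x.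
Proof. by apply/VclassP; exact: Vrel_addC. Qed.

Lemma Vadd0 x : Vadd Vzero x = x.
Proof.
by rewrite -(Vrepr_class x) Vadd_class; apply/VclassP; exact: Vrel_add0.
Qed.

Lemma VaddN x : Vadd (Vopp x) x = Vzero.
Proof.
rewrite -(Vrepr_class x) Vopp_class Vadd_class.
by apply/VclassP; exact: Vrel_addN.
Qed.

Definition Vtriple (t : triple) : V := Vclass (Fgen t).

(** The class [[M, g, f]].  The value [Vzero] is a dummy, for data that do not
    consist of alternating isomorphisms on a finitely generated projective
    module. *)
Definition Vtriple_of M (g f : M -> M -> R) : V :=
  match pselect (fg_projective M /\ is_alternating_iso g /\ is_alternating_iso f) with
  | left h =>
      Vtriple (Triple h.1 (AlternatingIso h.2.1) (AlternatingIso h.2.2))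
  | right _ => Vzero
  end.

(** Expansion along the first row; the value is [0] in odd size. *)
Fixpoint pfaffian (n : nat) : 'M[R]_n -> R :=
  match n with
  | 0 => fun _ => 1
  | 1 => fun _ => 0
  | n'.+2 => fun A =>
      \sum_(j < n'.+1) (-1) ^+ j * A ord0 (lift ord0 j) *
        pfaffian (row' j (row' ord0 (col' j (col' ord0 A))))
  end.

Definition gram (n : nat) (chi : 'rV[R]_n -> 'rV[R]_n -> R) : 'M[R]_n :=
  \matrix_(i, j) chi (delta_mx 0 i) (delta_mx 0 j).

(** [h] is the homomorphism from V(R) to the units of [R] (its values are units,
    as V(R) is a group) that maps [[R^2n, g, f]] to [Pf f / Pf g]. *)
Definition is_Pfbar (h : V -> R) : Prop :=
  [/\ h Vzero = 1,
      forall x y, h (Vadd x y) = h x * h y &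
      forall (n : nat) (hn : fg_projective 'rV[R]_(2 * n)%N)
        (g f : alternating_iso 'rV[R]_(2 * n)%N),
        h (Vtriple (Triple hn g f)) * pfaffian (gram g) = pfaffian (gram f)].

(** The kernel of the homomorphism characterised by [is_Pfbar], which exists and
    is unique. *)
Definition Vtilde (v : V) : Prop := exists2 h, is_Pfbar h & h v = 1.

End Forms.

Section Kernel.
Variables (R : comPzRingType) (M : lmodType R) (a : {linear M -> R^o}).

Definition kernel_pred : {pred M} := [pred x | a x == 0].

Lemma kernel_submod_closed : submod_closed kernel_pred.
Proof.
split; first by rewrite inE linear0.
by move=> c x y; rewrite !inE => /eqP hx /eqP hy; rewrite linearP hx hy scaler0 addr0.
Qed.

Record kernel := Kernel { kernel_val :> M; kernel_valP : kernel_val \in kernel_pred }.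
HB.instance Definition _ := [isSub for kernel_val].
HB.instance Definition _ := [Choice of kernel by <:].
HB.instance Definition _ := GRing.SubChoice_isSubLmodule.Build R M kernel_pred
  kernel kernel_submod_closed.

Definition kernel_incl : {linear kernel -> M} := \val.

End Kernel.

Section Vaserstein.
Variables (R : comPzRingType) (P0 : lmodType R).
Variable theta0 : {linear R^o -> exterior P0 2}.

Definition chi0 (p q : P0) : R := xget 0 [set r | theta0 r = wedge2 p q].

Definition psi2 (x y : R^o * R^o) : R := x.1 * y.2 - x.2 * y.1.

Local Notation P3 := (P0 * R^o)%type.

(** [det P0 -> det (P0 + R)], [w |-> w /\ e_3] *)
Definition wedge_e3 : {linear exterior P0 2 -> exterior P3 3} :=
  wedge_right 2 (@in1 R P0 R^o) (0, 1).

Section Unimodular.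
Variables (a : {linear P3 -> R^o}) (s : {linear R^o -> P3}).
Hypothesis hs : forall r, a (s r) = r.

(** [det P(a) -> det (P0 + R)], [w |-> w /\ s(1)] *)
Definition wedge_s : {linear exterior (kernel a) 2 -> exterior P3 3} :=
  wedge_right 2 (kernel_incl a) (s 1).

Definition theta (r : R) : exterior (kernel a) 2 :=
  xget 0 [set w | wedge_s w = wedge_e3 (theta0 r)].

Definition chi_a (p q : kernel a) : R := xget 0 [set r | theta r = wedge2 p q].

Lemma section_proj_subproof (p : P3) : p - s (a p) \in kernel_pred a.
Proof. by rewrite inE linearB /= hs subrr. Qed.

Definition split_iso (p : P3) : kernel a * R^o :=
  (Kernel (section_proj_subproof p), a p).

(** [i + 1], as a map from [P0 + R^2] to [P(a) + R^2] *)
Definition split_iso1 (x : P0 * (R^o * R^o)) : kernel a * (R^o * R^o) :=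
  let y := split_iso (x.1, x.2.1) in (y.1, (y.2, x.2.2)).

Definition vaserstein_section : V R :=
  Vtriple_of (perp chi0 psi2)
    (fun x y : (P0 * (R^o * R^o))%type =>
       perp chi_a psi2 (split_iso1 x) (split_iso1 y)).

End Unimodular.

Lemma section_exists (a : {linear P3 -> R^o}) :
  Um a -> exists s : {linear R^o -> P3}, forall r, a (s r) = r.
Proof.
case/(_ 1) => m am; pose s (r : R^o) := r *: m.
have sl : linear s by move=> c x y; rewrite /s scalerDl scalerA.
pose sL := GRing.isLinear.Build _ _ _ _ s sl.
pose S : {linear R^o -> P3} := HB.pack s sL.
by exists S => r; rewrite /= /s linearZ am [LHS]mulr1.
Qed.

(** The symbol does not depend on the section, which is therefore chosen. *)
Definition vaserstein (a : {linear P3 -> R^o}) (ha : Um a) : V R :=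
  let s := cid (section_exists ha) in vaserstein_section (projT2 s).

End Vaserstein.

(* Main.v *)
(** Write [X] for the form [chi_0].  A form on [P_4] has Pfaffian [1] relative to
    [X + psi_2] exactly when it comes from some [a] in [Um (P_3)], and then [a]
    is its last row; this is the Pluecker relation for the rank two form [X].

    V(R) acts on the alternating isomorphisms on the modules [P_2n], taken up to
    elementary automorphisms and the addition of [psi_2]: the class [[P, g, f]]
    replaces an isometric copy of [(P, g)] by [(P, f)].  The choice of the copy
    does not matter, since two orthogonal copies are exchanged by an elementary
    rotation.  Hence if the symbols of [a] and [b] agree, their forms become
    elementarily equivalent after stabilisation.  The row hypothesis lets one
    make the isometry fix the last coordinate, hence remove one [psi_2] at a
    time; on [P_4] the isometry becomes elementary, and [E (P_4)] moves the last
    row of a form within its [E (P_3)]-orbit.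

    Conversely every class in V(R) is represented by a form on some [P_2n], and
    transitivity of [E (P_(2n-1))] on unimodular rows splits off copies of
    [psi_2] until [P_4] is reached. *)
From HB Require Import structures.
Require Import Defs.
From mathcomp Require Import all_boot all_order all_algebra.
From mathcomp Require Import boolp classical_sets.
From Stdlib Require Import Ring Eqdep_dec.

Set Implicit Arguments.
Unset Strict Implicit.
Unset Printing Implicit Defensive.

Import GRing.Theory.
Local Open Scope ring_scope.

(** * Linear algebra and alternating forms *)

(** An equality in V(R) is only a derivation from the relations, so it supplies no isometry by
    itself. The action does: once every generator permutes the stable classes and these permutations
    commute, each relation can be checked on forms, and acting on [g] recovers [f] from [[P, g, f]]
    up to stable elementary equivalence. As [P] is merely projective, a copy of [(P, g)] is found by
    writing [g] as a finite sum of exterior products of functionals, which maps [P] isometrically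
    into a sum of hyperbolic planes.

    A second obstacle is that the Pfaffian homomorphism is specified on free modules, while [P0]
    need have no basis. In place of a basis with [X e_1 e_2 = 1] there is a finite sum of values of
    [X] equal to [1]. Together with the Pluecker relation it does the work of a basis, and it embeds
    [P_4] isometrically into a standard free module, where the Pfaffian can be computed. *)

Section RingTactic.
Variable R : comPzRingType.
(** These constants hide the structure instances: [ring] matches operations syntactically, while the
    same operation occurs under several convertible instances, for example through [R^o]. *)
Definition radd (x y : R) : R := x + y.
Definition rmul (x y : R) : R := x * y.
Definition rsub (x y : R) : R := x - y.
Definition ropp (x : R) : R := - x.
Definition rzero : R := 0.
Definition rone : R := 1.
Lemma raddE (x y : R) : x + y = radd x y. Proof. by []. Qed.
Lemma rmulE (x y : R) : x * y = rmul x y. Proof. by []. Qed.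
Lemma rscaleE (x : R) (y : R^o) : x *: y = rmul x y. Proof. by []. Qed.
Lemma roppE (x : R) : - x = ropp x. Proof. by []. Qed.
Lemma rzeroE : (0 : R) = rzero. Proof. by []. Qed.
Lemma roneE : (1 : R) = rone. Proof. by []. Qed.
(** Applied backwards, it restates at the type [R] an equation that may be typed in [R^o]. *)
Lemma radd0I (x y : R) : radd rzero x = radd rzero y -> x = y.
Proof. by rewrite /radd /rzero !add0r. Qed.
Lemma rring_theory : ring_theory rzero rone radd rmul rsub ropp eq.
Proof.
split=> *; rewrite /radd /rmul /rsub /ropp /rzero /rone
  ?(add0r, addrA, mul1r, mulrA, mulrDl, subrr) //; [exact: addrC|exact: mulrC].
Qed.
End RingTactic.

(* Linear maps occur with convertible but syntactically different structure
   arguments, which [ring] would take for different atoms. *)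
Definition lapp (R : comPzRingType) (M N : lmodType R) (f : {linear M -> N}) (x : M) : N :=
  f x.
Lemma lappE (R : comPzRingType) (M N : lmodType R) (f : {linear M -> N}) (x : M) :
  f x = lapp f x.
Proof. by []. Qed.

Ltac ring_over R rth :=
  apply: (@radd0I R);
  rewrite ?(@raddE R, @rscaleE R, @rmulE R, @roppE R, @rzeroE R, @roneE R);
  rewrite ?(@lappE R); ring.

Section TrivialExtension.
Variables (R : comPzRingType) (M : lmodType R).

(* The trivial square-zero extension [R + M] is a commutative ring containing
   [M], so [R]-linear identities in [M] are ring identities in it. *)
Definition tadd (x y : R * M) : R * M := (x.1 + y.1, x.2 + y.2).
Definition tmul (x y : R * M) : R * M := (x.1 * y.1, x.1 *: y.2 + y.1 *: x.2).
Definition topp (x : R * M) : R * M := (- x.1, - x.2).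
Definition tsub (x y : R * M) : R * M := tadd x (topp y).
Definition tzero : R * M := (0, 0).
Definition tone : R * M := (1, 0).
Definition tvec (m : M) : R * M := (0, m).
Definition tscal (r : R) : R * M := (r, 0).

Lemma text_ring_theory : ring_theory tzero tone tadd tmul tsub topp eq.
Proof.
split=> //.
- by case=> a m; rewrite /tadd !add0r.
- by case=> a m [b n]; rewrite /tadd addrC [m + _]addrC.
- by case=> a m [b n] [c p]; rewrite /tadd !addrA.
- by case=> a m; rewrite /tmul /= mul1r scale1r scaler0 addr0.
- by case=> a m [b n]; rewrite /tmul mulrC addrC.
- case=> a m [b n] [c p]; rewrite /tmul /= mulrA !scalerDr !scalerA addrA.
  by rewrite [c * a]mulrC [c * b]mulrC.
- case=> a m [b n] [c p]; rewrite /tmul /tadd /= mulrDl scalerDl scalerDr.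
  by congr pair; rewrite -!addrA; congr (_ + _); rewrite addrCA.
- by case=> a m; rewrite /tadd /topp /= !subrr.
Qed.

Lemma tvec_inj : injective tvec. Proof. by move=> x y []. Qed.
Lemma tvecD x y : tvec (x + y) = tadd (tvec x) (tvec y).
Proof. by rewrite /tadd /= addr0. Qed.
Lemma tvecN x : tvec (- x) = topp (tvec x).
Proof. by rewrite /topp /= oppr0. Qed.
Lemma tvec0 : tvec 0 = tzero. Proof. by []. Qed.
Lemma tvecZ c x : tvec (c *: x) = tmul (tscal c) (tvec x).
Proof. by rewrite /tmul /= mulr0 scale0r addr0. Qed.
Lemma tscalD x y : tscal (x + y) = tadd (tscal x) (tscal y).
Proof. by rewrite /tadd /= addr0. Qed.
Lemma tscalN x : tscal (- x) = topp (tscal x).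
Proof. by rewrite /topp /= oppr0. Qed.
Lemma tscalM x y : tscal (x * y) = tmul (tscal x) (tscal y).
Proof. by rewrite /tmul /= !scaler0 addr0. Qed.
Lemma tscal0 : tscal 0 = tzero. Proof. by []. Qed.
Lemma tscal1 : tscal 1 = tone. Proof. by []. Qed.
End TrivialExtension.

Ltac lmod_over R M :=
  apply: (@tvec_inj R M);
  rewrite ?(@tvecD R M, @tvecN R M, @tvec0 R M, @tvecZ R M);
  rewrite ?(@tscalD R M, @tscalN R M, @tscalM R M, @tscal0 R M, @tscal1 R M);
  rewrite ?(@lappE R); ring.

Section LinearAlgebra.
Variable R : comPzRingType.
Implicit Types M N : lmodType R.

Definition Lin M N (f : M -> N) (hf : linear f) : {linear M -> N} :=
  HB.pack f (GRing.isLinear.Build R M N _ f hf).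

Lemma linD M N (f : {linear M -> N}) x y : f (x + y) = f x + f y.
Proof. exact: linearD. Qed.
Lemma linB M N (f : {linear M -> N}) x y : f (x - y) = f x - f y.
Proof. exact: linearB. Qed.
Lemma linN M N (f : {linear M -> N}) x : f (- x) = - f x.
Proof. exact: linearN. Qed.
Lemma lin0 M N (f : {linear M -> N}) : f 0 = 0.
Proof. exact: linear0. Qed.
Lemma linZ M N (f : {linear M -> N}) c x : f (c *: x) = c *: f x.
Proof. exact: linearZ. Qed.
Lemma lfZ M (f : {linear M -> R^o}) c x : (f (c *: x) : R) = c * (f x : R).
Proof. by rewrite linearZ_LR. Qed.

Lemma scale_regular1 (c : R) : c *: (1 : R^o) = c.
Proof. exact: mulr1. Qed.

Lemma linear_inverse M N (f : {linear M -> N}) :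
  bijective f -> exists g : {linear N -> M}, cancel f g /\ cancel g f.
Proof.
case=> g fK gK.
have gl : linear g by move=> c x y; apply: (can_inj fK); rewrite linearP !gK.
by exists (Lin gl).
Qed.

Lemma transvection_linear M (v : M) (l : {linear M -> R^o}) :
  linear (fun x => x + (l x : R) *: v).
Proof.
move=> c x y; rewrite linearP scalerDl scalerDr scalerA.
by rewrite -!addrA; congr (_ + _); rewrite addrCA.
Qed.

Definition transvection M (v : M) (l : {linear M -> R^o}) := Lin (transvection_linear v l).

Lemma transvectionE M (v : M) (l : {linear M -> R^o}) x :
  transvection v l x = x + (l x : R) *: v.
Proof. by []. Qed.

End LinearAlgebra.

Section AlternatingIso.
Variable R : comPzRingType.
Add Ring RR : (rring_theory R).
Ltac rring := ring_over R (rring_theory R).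
Implicit Types M N : lmodType R.

Section Theory.
Variables (M : lmodType R) (chi : alternating_iso M).

Lemma aiPl c x y z : chi (c *: x + y) z = c * chi x z + chi y z.
Proof. by case: (formP chi) => h _ _ _; rewrite h. Qed.
Lemma aiPr c x y z : chi z (c *: x + y) = c * chi z x + chi z y.
Proof. by case: (formP chi) => _ h _ _; rewrite h. Qed.
Lemma aixx x : chi x x = 0. Proof. by case: (formP chi). Qed.
Lemma aiDl x y z : chi (x + y) z = chi x z + chi y z.
Proof. by rewrite -[x]scale1r aiPl mul1r scale1r. Qed.
Lemma aiDr x y z : chi z (x + y) = chi z x + chi z y.
Proof. by rewrite -[x]scale1r aiPr mul1r scale1r. Qed.
Lemma ai0l z : chi 0 z = 0.
Proof. by apply: (addIr (chi 0 z)); rewrite -aiDl !add0r. Qed.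
Lemma ai0r z : chi z 0 = 0.
Proof. by apply: (addIr (chi z 0)); rewrite -aiDr !add0r. Qed.
Lemma aiZl c x z : chi (c *: x) z = c * chi x z.
Proof. by rewrite -[c *: x]addr0 aiPl ai0l addr0. Qed.
Lemma aiZr c x z : chi z (c *: x) = c * chi z x.
Proof. by rewrite -[c *: x]addr0 aiPr ai0r addr0. Qed.
Lemma aiNl x z : chi (- x) z = - chi x z.
Proof. by rewrite -scaleN1r aiZl mulN1r. Qed.
Lemma aiNr x z : chi z (- x) = - chi z x.
Proof. by rewrite -scaleN1r aiZr mulN1r. Qed.
Lemma aiC x y : chi x y = - chi y x.
Proof.
apply/eqP; rewrite -addr_eq0; apply/eqP.
by have := aixx (x + y); rewrite aiDl !aiDr !aixx add0r addr0.
Qed.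
Lemma ai_suml I r (P : pred I) (F : I -> M) z :
  chi (\sum_(i <- r | P i) F i) z = \sum_(i <- r | P i) chi (F i) z.
Proof. by elim/big_rec2: _ => [|i y1 y2 _ <-]; rewrite ?ai0l // aiDl. Qed.
Lemma ai_sumr I r (P : pred I) (F : I -> M) z :
  chi z (\sum_(i <- r | P i) F i) = \sum_(i <- r | P i) chi z (F i).
Proof. by elim/big_rec2: _ => [|i y1 y2 _ <-]; rewrite ?ai0r // aiDr. Qed.

Lemma ai_functional_linear q : linear (fun p => chi p q : R^o).
Proof. by case: (formP chi). Qed.
Definition ai_functional q : {linear M -> R^o} := Lin (ai_functional_linear q).

Lemma ai_repr (l : {linear M -> R^o}) : exists q, forall p, chi p q = l p.
Proof. by case: (formP chi) => _ _ _ /(_ l) [q [h _]]; exists q. Qed.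
Lemma ai_injr q q' : (forall p, chi p q = chi p q') -> q = q'.
Proof.
move=> h; case: (formP chi) => _ _ _ /(_ (ai_functional q')) [q0 [_ u]].
by rewrite -(u q) // (u q').
Qed.
Lemma ai_injl q q' : (forall p, chi q p = chi q' p) -> q = q'.
Proof. by move=> h; apply: ai_injr => p; rewrite aiC h -aiC. Qed.
End Theory.

Lemma alternating_isoI M (f : M -> M -> R) :
  (forall q, linear (fun p => f p q : R^o)) ->
  (forall x, f x x = 0) -> (forall x y, f x y = - f y x) ->
  (forall l : {linear M -> R^o}, exists q, forall p, f p q = l p) ->
  (forall q, (forall p, f p q = 0) -> q = 0) ->
  is_alternating_iso f.
Proof.
move=> fl f0 fC fr fi.
have flr p : linear (fun q => f p q : R^o).
  by move=> c x y; rewrite fC fl opprD -mulrN -!fC.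
split=> // l; have [q qE] := fr l; exists q; split=> // q' q'E.
apply/eqP; rewrite -subr_eq0; apply/eqP/fi => p.
rewrite addrC -scaleN1r flr qE q'E; rring.
Qed.

Lemma ai_eq M (f g : alternating_iso M) : (forall x y, f x y = g x y) -> f = g.
Proof.
case: f g => f hf [g hg] /= fg.
have {}fg : f = g by apply/funext => x; apply/funext => y.
by case: g / fg hg => hg; rewrite (Prop_irrelevance hf hg).
Qed.

Lemma ai_adjoint M N (chi : alternating_iso M) (g : alternating_iso N)
  (j : {linear N -> M}) :
  exists r : {linear M -> N}, forall z v, g z (r v) = chi (j z) v.
Proof.
have hl v : linear (fun z => chi (j z) v : R^o).
  by move=> c x y; rewrite linearP aiPl.
have [r rE] := choice (fun v => ai_repr g (Lin (hl v))).
have rl : linear r.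
  move=> c x y; apply: (@ai_injr _ g) => z.
  by rewrite rE aiPr !rE /= aiPr.
by exists (Lin rl) => z v; rewrite /= rE.
Qed.

Section Pullback.
Variables (M N : lmodType R) (h : {linear M -> N}) (hb : bijective h).
Variable chi : alternating_iso N.

Lemma pullback_is_alternating_iso : is_alternating_iso (fun x y => chi (h x) (h y)).
Proof.
have [k [hK kK]] := linear_inverse hb.
apply: alternating_isoI => [q c x y|x|x y|l|q hq].
- by rewrite linearP aiPl.
- exact: aixx.
- exact: aiC.
- have [q qE] := ai_repr chi (l \o k).
  by exists (k q) => p; rewrite kK qE /= hK.
- apply: (can_inj hK); rewrite linear0; apply: (@ai_injr _ chi) => p.
  by rewrite ai0r -(kK p) hq.
Qed.
Definition pullback : alternating_iso M := AlternatingIso pullback_is_alternating_iso.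
End Pullback.

Section Replacement.
Variables (P M : lmodType R) (g f : alternating_iso P) (chi : alternating_iso M).
Variables (j : {linear P -> M}) (r : {linear M -> P}).
Hypothesis j_isometry : forall x y, chi (j x) (j y) = g x y.
Hypothesis r_adjoint : forall z v, g z (r v) = chi (j z) v.

Lemma adjointK : cancel j r.
Proof. by move=> x; apply: (@ai_injr _ g) => z; rewrite r_adjoint j_isometry. Qed.

Lemma adjoint_sym z v : g (r v) z = chi v (j z).
Proof. by rewrite aiC r_adjoint -aiC. Qed.

(** As [j] is an isometry, [j \o r] is the orthogonal projection onto [j P]. The first two terms are
    [chi] on the orthogonal complement of [j P], and the last one puts [f] on [j P]. *)
Definition replace_form v w := chi v w - g (r v) (r w) + f (r v) (r w).

Lemma replace_is_alternating_iso : is_alternating_iso replace_form.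
Proof.
rewrite /replace_form; apply: alternating_isoI => [q c x y|x|x y|l|q hq].
- by rewrite linearP !aiPl; rring.
- by rewrite !aixx; rring.
- by rewrite [chi x y]aiC [g _ _]aiC [f _ _]aiC; rring.
- have [q1 q1E] := ai_repr chi l; have [y yE] := ai_repr f (l \o j).
  (* The complement part of a representative for [chi], plus the representative for [f] on [j P]. *)
  exists (q1 - j (r q1) + j y) => p.
  rewrite !linearD !linearN !adjointK subrr add0r yE !aiDr aiNr.
  rewrite -!adjoint_sym r_adjoint !q1E /=; rring.
- have rq0 : r q = 0.
    apply: (@ai_injr _ f) => z; rewrite ai0r -(hq (j z)) adjointK -r_adjoint.
    rring.
  apply: (@ai_injr _ chi) => p; rewrite ai0r -(hq p) rq0 !ai0r; rring.
Qed.
Definition replace : alternating_iso M := AlternatingIso replace_is_alternating_iso.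

End Replacement.

Lemma psi2_is_alternating_iso : is_alternating_iso (@psi2 R).
Proof.
rewrite /psi2; apply: alternating_isoI => [q c x y|x|x y|l|q hq] /=.
- rring.
- rring.
- rring.
- exists (- (l (0, 1) : R), l (1, 0)) => -[c d] /=.
  have -> : ((c, d) : (R^o * R^o)%type) = c *: ((1, 0) : (R^o * R^o)%type)
    + d *: ((0, 1) : (R^o * R^o)%type).
    congr pair; rewrite /=; rring.
  rewrite (linD l) !(lfZ l); rring.
- case: q hq => c d hq; have := hq (1, 0); have := hq (0, 1); rewrite /=.
  rewrite !mul0r !mul1r subr0 sub0r => /eqP; rewrite oppr_eq0 => /eqP -> ->.
  by [].
Qed.
Definition psi2_iso : alternating_iso (R^o * R^o)%type :=
  AlternatingIso psi2_is_alternating_iso.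

End AlternatingIso.

(** * Elementary automorphisms *)

Section Elementary.
Variable R : comPzRingType.
Implicit Types M N : lmodType R.

(** One extra coordinate makes a transvection the commutator of a shear out of that coordinate and a
    shear into it. The form [T B A = A B] avoids naming inverses. *)
Lemma transvection_commutator M (u : M) (g : {linear M -> R^o}) (y : M * R^o) : g u = 0 ->
  transvection (in1 R^o u) (g \o fst)
    (transvection (in2 M (1 : R^o)) (g \o fst) (transvection (in1 R^o u) snd y))
  = transvection (in1 R^o u) snd (transvection (in2 M (1 : R^o)) (g \o fst) y).
Proof.
move=> gu; case: y => y c; rewrite /in1 /in2 /=; congr pair; rewrite /=.
  rewrite !scaler0 !addr0 (linD g) (lfZ g) gu mulr0 addr0 -addrA -scalerDl.
  by rewrite scale_regular1.
by rewrite !scaler0 !addr0 (linD g) (lfZ g) gu mulr0 addr0.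
Qed.

Section Module.
Variable P0 : lmodType R.
Notation stab := (stab P0).
Notation Estab := (@Estab R P0 _).

Definition e_top k : stab k.+1 := in2 (stab k) (1 : R^o).

Lemma stab_prjK k i j (c : R^o) : (i < k)%N -> (j < k)%N ->
  stab_prj P0 k i (stab_inc P0 k j c) = if i == j then c else 0.
Proof.
elim: k => // k IH; rewrite !ltnS => ik jk /=.
case: (altP (i =P k)) => [ei|ni]; case: (altP (j =P k)) => [ej|nj] /=.
- by rewrite ei ej eqxx.
- by rewrite ei eq_sym (negbTE nj).
- by rewrite ej (negbTE ni) linear0.
- by rewrite IH // ltn_neqAle ?ni ?nj.
Qed.

Lemma stab_prj_inc0 k i x : stab_prj P0 k i (stab_inc0 P0 k x) = 0.
Proof. by elim: k => //= k IH; case: ifP => _ //=; exact: IH. Qed.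

Lemma stab_prj0_inc k j c : stab_prj0 P0 k (stab_inc P0 k j c) = 0.
Proof. by elim: k => //= k IH; case: ifP => _ //=; rewrite linear0. Qed.

Lemma summand_orthogonal k (i j : option 'I_k) (x : summand P0 j) :
  i <> j -> summand_prj P0 i (summand_inc P0 j x) = 0.
Proof.
case: i j x => [i|] [j|] x //= ij.
- rewrite stab_prjK //; case: ifP => // /eqP e.
  by case: ij; congr Some; apply/val_inj.
- exact: stab_prj_inc0.
- exact: stab_prj0_inc.
Qed.

Lemma stab_decomposition k (x : stab k) :
  x = stab_inc0 P0 k (stab_prj0 P0 k x)
      + \sum_(j < k) stab_inc P0 k j (stab_prj P0 k j x).
Proof.
elim: k x => [x|k IH [x c]] /=; first by rewrite big_ord0 addr0.
rewrite big_ord_recr /= eqxx /=.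
under eq_bigr => j _ do rewrite (ltn_eqF (ltn_ord j)) /=.
have inE (u v : stab k) : (u, 0 : R^o) + (v, 0) = (u + v, 0) :> stab k * R^o.
  by congr pair; rewrite /= addr0.
have -> : \sum_(j < k) in1 R^o (stab_inc P0 k j (stab_prj P0 k j x)) =
  in1 R^o (\sum_(j < k) (stab_inc P0 k j (stab_prj P0 k j x))).
  by rewrite linear_sum.
rewrite addrA [in1 _ _ + in1 _ _]inE -IH.
by congr pair; rewrite /= ?addr0 ?add0r.
Qed.

Lemma Egen_bijective k phi : @Defs.Estab R P0 k phi -> bijective phi.
Proof.
elim=> {phi} [i j s ij||phi psi _ h1 _ h2|phi psi _ _ h1 h2].
- pose s' : {linear _ -> _} := -%R \o s.
  have sN x : summand_inc P0 i (s' x) = - summand_inc P0 i (s x) by rewrite /= linearN.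
  have o := @summand_orthogonal _ j i.
  exists (elementary_gen (@summand_inc R P0 k) (@summand_prj R P0 k) s') => x /=.
    by rewrite linearN !linearD o ?linear0 ?addr0 ?addrK //; exact: nesym.
  rewrite linearN !linearD !linearN o ?oppr0 ?linear0 ?addr0 ?subrK //.
  exact: nesym.
- by exists idfun.
- exact: bij_comp.
- by exists phi.
Qed.

Lemma Estab_inverse k (phi : {linear stab k -> stab k}) : Estab phi ->
  exists psi : {linear stab k -> stab k},
    [/\ Estab psi, cancel phi psi & cancel psi phi].
Proof.
move=> h; have [psi [h1 h2]] := linear_inverse (Egen_bijective h).
by exists psi; split => //; exact: Egen_inv h h1 h2.
Qed.

Lemma Estab_eq k (phi psi : {linear stab k -> stab k}) :
  phi =1 psi -> Estab psi -> Estab phi.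
Proof. by move=> /linear_ext ->. Qed.

Lemma Estab_gen k (i j : option 'I_k) (s : {linear summand P0 j -> summand P0 i})
  (phi : {linear stab k -> stab k}) : i <> j ->
  (forall x, phi x = x + summand_inc P0 i (s (summand_prj P0 j x))) -> Estab phi.
Proof. by move=> ij e; apply: (Estab_eq _ (Egen_gen _ _ s ij)) => x; rewrite e. Qed.

Lemma Estab_comp k (phi psi : {linear stab k -> stab k}) :
  Estab phi -> Estab psi -> Estab (phi \o psi).
Proof. exact: Egen_comp. Qed.

Lemma Estab_sum_id k (phi : {linear stab k -> stab k}) :
  Estab phi -> @Defs.Estab R P0 k.+1 (@sum_id R (stab k) R^o phi).
Proof.
elim=> {phi} [i j s ij||phi psi _ h1 _ h2|phi psi _ h h1 h2].
- pose w (i : option 'I_k) : option 'I_k.+1 := omap (widen_ord (leqnSn k)) i.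
  have incE (l : option 'I_k) : exists t : {linear summand P0 l -> summand P0 (w l)},
      exists t' : {linear summand P0 (w l) -> summand P0 l},
      [/\ forall x, in1 R^o (summand_inc P0 l x) = summand_inc P0 (w l) (t x),
        cancel t' t, cancel t t' &
        forall u, summand_prj P0 (w l) u = t (summand_prj P0 l u.1)].
    case: l => [l|].
      exists idfun, idfun; split=> // x /=.
        by rewrite (ltn_eqF (ltn_ord l)).
      by rewrite (ltn_eqF (ltn_ord l)).
    by exists idfun, idfun; split.
  have [ti [ti' [i1 i2 i2' i3]]] := incE i.
  have [tj [tj' [j1 j2 j2' j3]]] := incE j.
  have wij : w i <> w j.
    move: ij; case: (i) (j) => [i'|] [j'|] // ij [e].
    by case: ij; congr Some; apply/val_inj.
  apply: (Estab_eq _ (Egen_gen _ _ (ti \o s \o tj') wij)) => -[x c].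
  rewrite /= j3 j2' -i1 /sum_id /=.
  by congr pair; rewrite /= addr0.
- apply: (Estab_eq _ (Egen_id _ _)); by case.
- by apply: (Estab_eq _ (Egen_comp h1 h2)).
- by apply: (Egen_inv h) => -[x c]; congr pair; [exact: h1|exact: h2].
Qed.

Lemma Estab_transvection_top k (l : {linear stab k -> R^o}) :
  Estab (transvection (e_top k) (l \o fst)).
Proof.
(* [t m] keeps [P0] and the first [m] coordinates, so the induction on [m] admits one summand of the
   source at a time. *)
pose t m (x : stab k) : stab k := stab_inc0 P0 k (stab_prj0 P0 k x)
      + \sum_(j < k | (j < m)%N) stab_inc P0 k j (stab_prj P0 k j x).
have tl m : linear (t m).
  move=> c x y; rewrite /t !linearP.
  under eq_bigr => j _ do rewrite !linearP.
  rewrite big_split /= -scaler_sumr scalerDr.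
  by rewrite -!addrA; congr (_ + _); rewrite addrCA.
have tD m (x : stab k) (h : (m < k)%N) :
    t m.+1 x = t m x + stab_inc P0 k m (stab_prj P0 k m x).
  rewrite /t -addrA; congr (_ + _); rewrite (bigD1 (Ordinal h)) //= addrC.
  congr (_ + _); apply: eq_bigl => j; rewrite ltnS leq_eqVlt -val_eqE /=.
  by case: ltngtP.
have main m : (m <= k)%N -> Estab (transvection (e_top k) (l \o Lin (tl m) \o fst)).
  have etopZ (c : R) : c *: e_top k = in2 (stab k) (c : R^o).
    by rewrite /e_top -linearZ_LR; congr in2; exact: mulr1.
  elim: m => [_|m IH mk].
    apply: (@Estab_gen _ (Some ord_max) None (l \o stab_inc0 P0 k)) => // x /=.
    by rewrite etopZ /t big_pred0 // addr0 eqxx.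
  pose s := transvection (e_top k) (l \o stab_inc P0 k m \o stab_prj P0 k m \o fst).
  have hs : Estab s.
    apply: (@Estab_gen _ (Some ord_max) (Some (widen_ord (leqnSn k) (Ordinal mk)))
      (l \o stab_inc P0 k m)) => [[e]|x /=]; first by move: mk; rewrite -e ltnn.
    by rewrite etopZ (ltn_eqF mk) eqxx.
  apply: (Estab_eq _ (Estab_comp hs (IH (ltnW mk)))) => x.
  rewrite /= scaler0 addr0 tD // linearD scalerDl addrA.
  by congr (_ + _).
apply: (Estab_eq _ (main k (leqnn k))) => x /=.
congr (_ + (_ : R) *: _); congr (l _); rewrite {1}[x.1]stab_decomposition /t.
by congr (_ + _); apply: eq_bigl => j; rewrite ltn_ord.
Qed.

Lemma Estab_transvection_snd k (w : stab k) :
  @Defs.Estab R P0 k.+1 (transvection (in1 R^o w) (@snd (stab k) R^o)).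
Proof.
rewrite [w]stab_decomposition.
set snd' := (X in transvection _ X).
pose Q (u : stab k) := @Defs.Estab R P0 k.+1 (transvection (in1 R^o u) snd').
have D (u v : stab k) : Q u -> Q v -> Q (u + v).
  move=> hu hv; apply: (Estab_eq _ (Estab_comp hu hv)) => x /=.
  by rewrite scaler0 addr0 linearD scalerDr [in LHS]addrCA addrC -addrA addrC -addrA addrCA addrA.
rewrite -/(Q _).
have inZ (c : R) (u : stab k) : c *: in1 R^o u = in1 R^o (c *: u) by rewrite linearZ_LR.
apply: (D).
  have sl : linear (fun c : R^o => (c : R) *: stab_prj0 P0 k w).
    by move=> c x y; rewrite scalerDl scalerA.
  apply: (@Estab_gen _ None (Some ord_max) (Lin sl)) => // x /=.
  by rewrite eqxx inZ; congr (_ + in1 _ _); rewrite [RHS]linearZ_LR.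
apply: (big_ind Q) => [|u v hu hv|j _]; last 1 first.
- have sl : linear (fun c : R^o => (c * stab_prj P0 k j w : R^o)).
    by move=> c x y; rewrite /= mulrDl -mulrA.
  apply: (@Estab_gen _ (Some (widen_ord (leqnSn k) j)) (Some ord_max) (Lin sl)).
    by case=> e; move: (ltn_ord j); rewrite e ltnn.
  move=> x /=; rewrite eqxx (ltn_eqF (ltn_ord j)) inZ /= -linearZ_LR.
  by [].
- apply: (Estab_eq _ (Egen_id _ _)) => x /=.
  by rewrite (lin0 (@in1 R (stab k) R^o)) scaler0 addr0.
- exact: D.
Qed.

(** Neither [u] nor [g] is tied to a single summand; the extra coordinate turns the transvection
    into a commutator of elementary shears. *)
Lemma Estab_transvection k (u : stab k) (g : {linear stab k -> R^o}) : g u = 0 ->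
  @Defs.Estab R P0 k.+1 (transvection (in1 R^o u) (g \o fst)).
Proof.
move=> gu; have hA := Estab_transvection_snd u; have hB := Estab_transvection_top g.
have [A' [hA' AK A'K]] := Estab_inverse hA.
have [B' [hB' BK B'K]] := Estab_inverse hB.
apply: (Estab_eq _ (Estab_comp hA (Estab_comp hB (Estab_comp hA' hB')))) => x.
by have := transvection_commutator (A' (B' x)) gu; rewrite A'K B'K.
Qed.

Fixpoint up_in n k : {linear stab k -> stab (n + k)} :=
  match n with
  | 0 => idfun
  | n'.+1 => @in1 R (stab (n' + k)) R^o \o up_in n' k
  end.

Fixpoint up_pr n k : {linear stab (n + k) -> stab k} :=
  match n with
  | 0 => idfun
  | n'.+1 => up_pr n' k \o fst
  end.

Lemma up_inK n k : cancel (up_in n k) (up_pr n k).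
Proof. by elim: n. Qed.

(** The hypothesis on [s] puts its range in the [n] new coordinates, so the shear is a product of
    shears into one new coordinate each. *)
Lemma Estab_up_target n k (s : {linear stab k -> stab (n + k)})
  (phi : {linear stab (n + k) -> stab (n + k)}) :
  (forall x, up_pr n k (s x) = 0) -> (forall x, phi x = x + s (up_pr n k x)) ->
  Estab phi.
Proof.
elim: n s phi => [|n IH] s phi hs hphi.
  by apply: (Estab_eq _ (Egen_id _ _)) => x; rewrite hphi [s _]hs addr0.
pose s1 : {linear stab k -> stab (n + k)} := fst \o s.
have h1l : linear (fun x => x + s1 (up_pr n k x)).
  move=> c x y; rewrite !linearP scalerDr.
  by rewrite -!addrA; congr (_ + _); rewrite addrCA.
have h1 : Estab (Lin h1l) by exact: (IH s1).
pose l : {linear stab (n + k) -> R^o} := snd \o s \o up_pr n k.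
apply: (Estab_eq _ (Estab_comp (Estab_sum_id h1) (Estab_transvection_top l))).
case=> x c; rewrite hphi; congr pair.
  by rewrite /= scaler0 addr0.
by rewrite /= scale_regular1.
Qed.

Lemma Estab_up_source n k (s : {linear stab (n + k) -> stab k})
  (phi : {linear stab (n + k) -> stab (n + k)}) :
  (forall x, s (up_in n k x) = 0) -> (forall x, phi x = x + up_in n k (s x)) ->
  Estab phi.
Proof.
elim: n s phi => [|n IH] s phi hs hphi.
  by apply: (Estab_eq _ (Egen_id _ _)) => x; rewrite hphi [s _]hs linear0 addr0.
pose s1 : {linear stab (n + k) -> stab k} := s \o @in1 R (stab (n + k)) R^o.
have h1l : linear (fun x => x + up_in n k (s1 x)).
  move=> c x y; rewrite !linearP scalerDr.
  by rewrite -!addrA; congr (_ + _); rewrite addrCA.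
have h1 : Estab (Lin h1l) by exact: (IH s1).
have h2 := Estab_transvection_snd (up_in n k (s (e_top (n + k)))).
apply: (Estab_eq _ (Estab_comp h2 (Estab_sum_id h1))).
case=> x c; rewrite hphi; congr pair; last by rewrite /= scaler0.
rewrite /= -addrA -[_ *: up_in n k _]linearZ_LR -linearD; congr (_ + up_in n k _).
rewrite -linearZ_LR -linearD; congr (s _); congr pair.
  by rewrite /= scaler0 addr0.
by rewrite /= scale_regular1 add0r.
Qed.

Definition stably_elementary k (phi : {linear stab k -> stab k}) :=
  exists j, @Defs.Estab R P0 _ (stab_up phi j).

Lemma Estab_stab_up k (phi : {linear stab k -> stab k}) i j :
  @Defs.Estab R P0 _ (stab_up phi j) -> @Defs.Estab R P0 _ (stab_up phi (i + j)).
Proof. by move=> h; elim: i => //= i IH; exact: Estab_sum_id. Qed.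

Lemma stab_up_comp k (phi psi : {linear stab k -> stab k}) j :
  stab_up (phi \o psi) j = stab_up phi j \o stab_up psi j :> {linear _ -> _}.
Proof. by elim: j => [|j IH] /=; apply: linear_ext => //= -[x c]; rewrite IH. Qed.

Lemma Estab_stably_elementary k (phi : {linear stab k -> stab k}) :
  Estab phi -> stably_elementary phi.
Proof. by exists 0%N. Qed.

Lemma stably_elementary_comp k (phi psi : {linear stab k -> stab k}) :
  stably_elementary phi -> stably_elementary psi -> stably_elementary (phi \o psi).
Proof.
move=> [i hi] [j hj]; exists (i + j)%N; rewrite stab_up_comp.
apply: Estab_comp; last exact: Estab_stab_up.
by rewrite (addnC i j); exact: Estab_stab_up.
Qed.

(* [stab (j + k.+1)] and [stab (j.+1 + k)] are not convertible, so the two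
   stabilisations are compared as elements of a sigma type. *)
Lemma stab_up_sum_id k (phi : {linear stab k -> stab k}) j :
  existT (fun n => {linear stab n -> stab n}) _ (@stab_up R P0 k.+1 (sum_id phi) j)
  = existT _ _ (stab_up phi j.+1).
Proof.
elim: j => // j IH.
pose up (x : {n & {linear stab n -> stab n}}) :=
  existT (fun n => {linear stab n -> stab n}) (projT1 x).+1
    (@sum_id R (stab (projT1 x)) R^o (projT2 x) : {linear stab _.+1 -> stab _.+1}).
exact: (congr1 up IH).
Qed.

Lemma stably_elementary_sum_id k (phi : {linear stab k -> stab k}) :
  @stably_elementary k.+1 (sum_id phi) -> stably_elementary phi.
Proof.
case=> j h; exists j.+1.
by have := congr1 (fun x => @Defs.Estab R P0 _ (projT2 x)) (stab_up_sum_id phi j) => /= <-.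
Qed.

End Module.
End Elementary.

(** * The group V(R) *)

Section VGroup.
Variable R : comPzRingType.
Add Ring RR : (rring_theory R).
Ltac rring := ring_over R (rring_theory R).
Implicit Types M N : lmodType R.

Lemma Vadd0r (x : V R) : Vadd x (Vzero R) = x.
Proof. by rewrite VaddC Vadd0. Qed.

Lemma VaddI (x y z : V R) : Vadd x y = Vadd x z -> y = z.
Proof.
move=> h; rewrite -[y]Vadd0 -[z]Vadd0 -(VaddN x) -!VaddA.
by rewrite h.
Qed.

Definition cl M (hM : fg_projective M) (g f : alternating_iso M) : V R :=
  Vtriple (Triple hM g f).

Lemma cl_chain M (hM : fg_projective M) (f0 f1 f2 : alternating_iso M) :
  Vadd (cl hM f0 f1) (cl hM f1 f2) = cl hM f0 f2.
Proof. by rewrite [LHS]Vadd_class; apply/VclassP; exact: Vrel_chain. Qed.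

Lemma cl_self M (hM : fg_projective M) f : cl hM f f = Vzero R.
Proof. by apply: (@VaddI (cl hM f f)); rewrite cl_chain Vadd0r. Qed.

Lemma cl_opp M (hM : fg_projective M) g f : Vopp (cl hM g f) = cl hM f g.
Proof. by apply: (@VaddI (cl hM g f)); rewrite VaddC VaddN cl_chain cl_self. Qed.

Lemma cl_sum M N (hM : fg_projective M) (hN : fg_projective N) g f g' f' :
  cl (fg_projective_sum hM hN) (perp_iso g g') (perp_iso f f')
  = Vadd (cl hM g f) (cl hN g' f').
Proof.
rewrite [RHS]Vadd_class; apply/VclassP.
exact: (Vrel_sum (Triple hM g f) (Triple hN g' f')).
Qed.

Lemma cl_isometry M N (hM : fg_projective M) (hN : fg_projective N)
  (h : {linear M -> N}) (g f : alternating_iso M) (g' f' : alternating_iso N) : bijective h ->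
  (forall x y, g x y = g' (h x) (h y)) -> (forall x y, f x y = f' (h x) (h y)) ->
  cl hM g f = cl hN g' f'.
Proof. by move=> hb hg hf; apply/VclassP/Vrel_isometric; exists h. Qed.

(** Orthogonal sums realise addition, and by the chain relation exchanging the two forms realises
    the opposite, so formal differences collapse to one triple. *)
Lemma Vtriple_cl u : exists t : triple R, Vclass u = Vtriple t.
Proof.
elim: u => [t||u [[M hM g f] IHu] v [[N hN g' f'] IHv]|u [[M hM g f] IHu]].
- by exists t.
- have h0 : fg_projective 'rV[R]_0.
    split; first by exists 0%N, (fun=> 0) => z; exists (fun=> 0); rewrite big_ord0 thinmx0.
    by move=> N N' g f sg; exists \0 => x /=; rewrite linear0 thinmx0 linear0.
  have a0 : is_alternating_iso (fun _ _ : 'rV[R]_0 => 0 : R).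
    apply: alternating_isoI => [q c x y|x|x y|l|q hq] //.
    - by rewrite scaler0 addr0.
    - by rewrite oppr0.
    - by exists 0 => p; rewrite thinmx0 linear0.
    - exact: thinmx0.
  exists (Triple h0 (AlternatingIso a0) (AlternatingIso a0)).
  exact: esym (cl_self _ _).
- exists (triple_sum (Triple hM g f) (Triple hN g' f')).
  by rewrite -Vadd_class IHu IHv; exact: esym (cl_sum _ _ _ _ _ _).
- exists (Triple hM f g); rewrite -Vopp_class IHu; exact: cl_opp.
Qed.

Section Swap.
Variables (P M : lmodType R) (j : {linear P -> M}) (r : {linear M -> P}).
Add Ring TM : (text_ring_theory M).

(** When [r] is a left inverse of [j], this exchanges the outer [P] with [j P] and fixes the kernel
    of [r]. *)
Definition swap (x : P * M) : P * M := (r x.2, x.2 - j (r x.2) + j x.1).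

Lemma swap_linear : linear swap.
Proof.
move=> c [x v] [y w]; congr pair; rewrite /= !(linD, linZ) //.
by lmod_over R M.
Qed.

Lemma swapK : cancel j r -> involutive swap.
Proof.
move=> rj [x v]; congr pair; rewrite /= !(linD, linN) !rj subrr add0r //.
by lmod_over R M.
Qed.
End Swap.

(** On [P * M] with the form [g] perp [chi] there are two copies of [(P, g)], the outer one and
    [j P]. Putting [f] on the one or on the other gives the two sides, and [swap] is an isometry
    between them. *)
Lemma cl_replace (P M : lmodType R) (hP : fg_projective P) (hM : fg_projective M)
  (g f : alternating_iso P) (chi : alternating_iso M)
  (j : {linear P -> M}) (r : {linear M -> P})
  (hj : forall x y, chi (j x) (j y) = g x y)
  (hr : forall z v, g z (r v) = chi (j z) v) :
  cl hP g f = cl hM chi (replace f hj hr).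
Proof.
have rj := adjointK hj hr; have rs := adjoint_sym hr.
have sb : bijective (Lin (swap_linear j r)) by exists (swap j r); exact: swapK.
transitivity (cl (fg_projective_sum hP hM) (perp_iso g chi) (perp_iso f chi)).
  by rewrite cl_sum cl_self Vadd0r.
transitivity (cl (fg_projective_sum hP hM) (perp_iso g chi) (perp_iso g (replace f hj hr))).
  apply/esym/(cl_isometry _ _ sb) => -[x v] [y w].
    rewrite /= /perp /swap /= !aiDl !aiDr !aiNl !aiNr !hj -!hr -!rs.
    rring.
  rewrite /= /replace_form /perp /swap /= !aiDl !aiDr !aiNl !aiNr !hj -!hr -!rs.
  rring.
by rewrite cl_sum cl_self Vadd0.
Qed.

Section Automorphisms.
Variables (M : lmodType R) (hM : fg_projective M).

Lemma cl_pullback (phi : {linear M -> M}) (hphi : bijective phi) (f g : alternating_iso M) :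
  cl hM (pullback hphi f) (pullback hphi g) = cl hM f g.
Proof. exact: (cl_isometry _ _ hphi). Qed.

(** By the chain relation the sides differ by [[g, f]] and its pullback, which are equal by isometry
    and cancel in an abelian group. *)
Lemma cl_pullback_indep (phi : {linear M -> M}) (hphi : bijective phi)
  (f g : alternating_iso M) :
  cl hM f (pullback hphi f) = cl hM g (pullback hphi g).
Proof.
apply: (@VaddI (cl hM g f)); rewrite cl_chain -(cl_chain hM g (pullback hphi g)).
by rewrite cl_pullback VaddC.
Qed.

Lemma cl_pullback_inverse (phi psi : {linear M -> M}) (hphi : bijective phi)
  (hpsi : bijective psi) (f : alternating_iso M) : cancel psi phi ->
  Vadd (cl hM f (pullback hphi f)) (cl hM f (pullback hpsi f)) = Vzero R.
Proof.
move=> K; rewrite (cl_pullback_indep hpsi f (pullback hphi f)) cl_chain.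
rewrite (_ : pullback hpsi (pullback hphi f) = f) ?cl_self //.
by apply: ai_eq => x y /=; rewrite !K.
Qed.

(* [phi |-> [M, f, f phi]] is a homomorphism to an abelian group. *)
Lemma cl_commutator (A A' B B' : {linear M -> M}) (f g : alternating_iso M) :
  cancel A A' -> cancel A' A -> cancel B B' -> cancel B' B ->
  (forall x y, g x y = f (A (B (A' (B' x)))) (A (B (A' (B' y))))) ->
  cl hM f g = Vzero R.
Proof.
move=> AK A'K BK B'K gE.
have hA : bijective A by exists A'.
have hB : bijective B by exists B'.
have hA' : bijective A' by exists A.
have hB' : bijective B' by exists B.
pose f1 := pullback hA f; pose f2 := pullback hB f1; pose f3 := pullback hA' f2.
have -> : g = pullback hB' f3 by apply: ai_eq => x y; rewrite gE.
rewrite -(cl_chain hM f f1) -(cl_chain hM f1 f2) -(cl_chain hM f2 f3).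
rewrite /f1 /f2 /f3 (cl_pullback_indep hB _ f) (cl_pullback_indep hA' _ f).
rewrite (cl_pullback_indep hB' _ f) (VaddC (cl hM f (pullback hA' f))) !VaddA.
rewrite -(VaddA (cl hM f (pullback hA f))) cl_pullback_inverse // Vadd0r.
exact: cl_pullback_inverse.
Qed.
End Automorphisms.

Section Hyperbolic.
Variable M : lmodType R.

Definition assoc_sum (x : (M * R^o) * R^o) : M * (R^o * R^o) := (x.1.1, (x.1.2, x.2)).
Lemma assoc_sum_linear : linear assoc_sum. Proof. by []. Qed.
Lemma assoc_sum_bijective : bijective (Lin assoc_sum_linear).
Proof. by exists (fun x => ((x.1, x.2.1), x.2.2)); [move=> [[x c] d]|move=> [x [c d]]]. Qed.

(** The sum with [psi_2], bracketed so that on [stab k] it is a form on [stab k.+2] by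
    conversion. *)
Definition stf (chi : alternating_iso M) : alternating_iso ((M * R^o) * R^o)%type :=
  pullback assoc_sum_bijective (perp_iso chi (psi2_iso R)).

Lemma stfE chi x y :
  stf chi x y = chi x.1.1 y.1.1 + ((x.1.2 : R) * y.2 - (x.2 : R) * y.1.2).
Proof. by []. Qed.
End Hyperbolic.

Lemma fg_projective_regular : fg_projective (R^o : lmodType R).
Proof.
split.
  by exists 1%N, (fun=> 1) => z; exists (fun=> z); rewrite big_ord1 scale_regular1.
move=> N N' g f sg; have [x xE] := sg (f 1).
have hl : linear (fun c : R^o => (c : R) *: x).
  by move=> c u v; rewrite scalerDl scalerA.
exists (Lin hl) => c; rewrite /= linZ xE -linZ scale_regular1.
by [].
Qed.

Lemma cl_stf M (hM : fg_projective M) hM2 g f :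
  cl hM g f = cl hM2 (stf g) (stf f).
Proof.
transitivity (cl (fg_projective_sum hM
  (fg_projective_sum fg_projective_regular fg_projective_regular))
  (perp_iso g (psi2_iso R)) (perp_iso f (psi2_iso R))).
  by rewrite cl_sum cl_self Vadd0r.
by apply/esym; apply: (cl_isometry _ _ (assoc_sum_bijective M)).
Qed.

(** Stabilising by [psi_2] makes room for [transvection_commutator]: the transvection becomes a
    commutator, which is invisible in the abelian group V(R). *)
Lemma cl_transvection M (hM : fg_projective M) (u : M) (l : {linear M -> R^o})
  (f g : alternating_iso M) : l u = 0 ->
  (forall x y, g x y = f (transvection u l x) (transvection u l y)) ->
  cl hM f g = Vzero R.
Proof.
move=> lu gE.
have hR := fg_projective_regular.
rewrite (cl_stf hM (fg_projective_sum (fg_projective_sum hM hR) hR)).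
pose T (v : M * R^o) (k : {linear (M * R^o)%type -> R^o}) : {linear _ -> _} :=
  @sum_id R (M * R^o)%type R^o (transvection v k).
have TK v (k : {linear (M * R^o)%type -> R^o}) : k v = 0 -> cancel (T v k) (T (- v) k).
  move=> kv [x c]; rewrite /T /sum_id /=; congr pair.
  by rewrite linD linZ kv scaler0 addr0 scalerN addrK.
have TK' v (k : {linear (M * R^o)%type -> R^o}) : k v = 0 -> cancel (T (- v) k) (T v k).
  by move=> kv; rewrite -{2}[v]opprK; apply: TK; rewrite linN kv oppr0.
have a0 : (@snd M R^o : {linear _ -> _}) (in1 R^o u) = 0 by [].
have b0 : (l \o fst) (in2 M (1 : R^o)) = 0 by exact: lin0.
apply: (cl_commutator _ (TK _ _ a0) (TK' _ _ a0) (TK _ _ b0) (TK' _ _ b0)) => x y.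
have e z : T (in1 R^o u) snd (T (in2 M (1 : R^o)) (l \o fst)
    (T (- in1 R^o u) snd (T (- in2 M (1 : R^o)) (l \o fst) z)))
   = ((transvection u l z.1.1, z.1.2), z.2).
  set z' := T (- in1 R^o u) _ _.
  have zE : z = T (in2 M (1 : R^o)) (l \o fst) (T (in1 R^o u) snd z').
    by rewrite /z' (TK' _ _ a0) (TK' _ _ b0).
  rewrite [in RHS]zE; have := transvection_commutator z'.1 lu.
  rewrite /T /sum_id [transvection (in1 R^o u) (l \o fst) _]/= => e.
  congr pair; rewrite -e; congr pair => /=.
  by rewrite !scaler0 !addr0.
by rewrite stfE gE (e x) (e y).
Qed.

Section Elementary.
Variable P0 : lmodType R.
Hypothesis hP0 : fg_projective P0.

Lemma fg_projective_stab k : fg_projective (stab P0 k).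
Proof. by elim: k => //= k IH; apply: fg_projective_sum => //; exact: fg_projective_regular. Qed.

(** As [i] and [j] differ, at least one of the two summands is [R], so [s] has the shape of a
    functional times a vector. *)
Lemma elementary_gen_transvection k (i j : option 'I_k)
  (s : {linear summand P0 j -> summand P0 i}) : i <> j ->
  exists (u : stab P0 k) (l : {linear stab P0 k -> R^o}), l u = 0 /\
    forall x, elementary_gen (@summand_inc R P0 k) (@summand_prj R P0 k) s x
      = transvection u l x.
Proof.
case: i j s => [i|] [j|] s ij //.
- exists (summand_inc P0 (Some i) (s 1)), (summand_prj P0 (Some j)); split.
    exact: (@summand_orthogonal R P0 k (Some j) (Some i) (s 1) (nesym ij)).
  by move=> x /=; rewrite -linZ -linZ scale_regular1.
- exists (summand_inc P0 (Some i) 1), (s \o summand_prj P0 None); split.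
    by rewrite /= stab_prj0_inc lin0.
  by move=> x /=; rewrite -linZ scale_regular1.
- exists (summand_inc P0 None (s 1)), (summand_prj P0 (Some j)); split.
    exact: (@summand_orthogonal R P0 k (Some j) None (s 1) (nesym ij)).
  by move=> x /=; rewrite -linZ -linZ scale_regular1.
Qed.

Lemma cl_Estab k (hk : fg_projective (stab P0 k)) (phi : {linear stab P0 k -> stab P0 k})
  (f g : alternating_iso (stab P0 k)) : Estab phi ->
  (forall x y, g x y = f (phi x) (phi y)) -> cl hk f g = Vzero R.
Proof.
move=> h; elim: h f g => {phi} [i j s ij||phi psi h1 IH1 h2 IH2|phi psi h1 IH h2 h3] f g gE.
- have [u [l [lu e]]] := elementary_gen_transvection s ij.
  by apply: (cl_transvection hk lu) => x y; rewrite gE !e.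
- rewrite (_ : g = f) ?cl_self //; exact: ai_eq.
- have b1 := Egen_bijective h1.
  rewrite -(cl_chain hk f (pullback b1 f)) (IH1 f) // (IH2 (pullback b1 f)) //.
  exact: Vadd0.
- rewrite -cl_opp (IH g) => [|x y]; last by rewrite gE !h2.
  by rewrite -(cl_self hk f) cl_opp.
Qed.
End Elementary.
End VGroup.

(** * Stable elementary classes of alternating forms *)

Section HyperbolicEmbedding.
Variable R : comPzRingType.
Add Ring RR : (rring_theory R).
Ltac rring := ring_over R (rring_theory R).

Lemma addr_shuffle (a b c d : R) : a - b + c + d = a + d - b + c.
Proof. rring. Qed.

Implicit Types M N P : lmodType R.

Definition functionals P : Type := seq ({linear P -> R^o} * {linear P -> R^o}).

Definition hsum P (s : functionals P) (x y : P) : R :=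
  \sum_(p <- s) ((p.1 x : R) * p.2 y - (p.2 x : R) * p.1 y).

Lemma dual_basis P : fg_projective P ->
  exists (n : nat) (x : 'I_n -> P) (c : 'I_n -> {linear P -> R^o}),
    forall z, z = \sum_i (c i z : R) *: x i.
Proof.
case=> -[n [x xgen]] pP.
pose comb (v : 'rV[R]_n) : P := \sum_i v 0 i *: x i.
have combl : linear comb.
  move=> c u v; rewrite /comb scaler_sumr -big_split; apply: eq_bigr => i _.
  by rewrite !mxE scalerDl scalerA.
have [|h hE] := pP _ _ (Lin combl) idfun.
  move=> y; have [c ->] := xgen y; exists (\row_i c i) => /=.
  by rewrite /comb; apply: eq_bigr => i _; rewrite mxE.
have cl i : linear (fun z => h z 0 i : R^o).
  by move=> c u v; rewrite linearP !mxE.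
by exists n, x, (fun i => Lin (cl i)) => z; rewrite -[LHS]hE.
Qed.

Lemma sum_alternating n (F : 'I_n -> 'I_n -> R) : (forall i, F i i = 0) ->
  \sum_i \sum_l F i l = \sum_(i < n) \sum_(l < n | (i < l)%N) (F i l + F l i).
Proof.
move=> F0; under [RHS]eq_bigr => i _ do rewrite big_split.
rewrite big_split /= [X in _ = _ + X](exchange_big_dep predT) //= -big_split.
apply: eq_bigr => i _; rewrite /= (bigID (fun l : 'I_n => (i < l)%N)) /=.
congr (_ + _); rewrite [LHS](bigD1 i) ?ltnn //= F0 add0r.
by apply: eq_bigl => l; rewrite -leqNgt ltn_neqAle andbC.
Qed.

(** For a dual basis [x i], [c i], the form is the sum over [i < l] of [g (x i) (x l)] times the
    exterior product of [c i] and [c l]; alternation removes the diagonal, so nothing is divided by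
    two. Collecting the terms with the same [i] leaves one pair of functionals for each
    generator. *)
Lemma alternating_hsum P (g : alternating_iso P) : fg_projective P ->
  exists s : functionals P, forall x y, g x y = hsum s x y.
Proof.
case/dual_basis => n [x [c cE]].
have bl (i : 'I_n) : linear (fun z => \sum_(l < n | (i < l)%N) (g (x i) (x l) * c l z) : R^o).
  move=> a u v; rewrite scaler_sumr -big_split; apply: eq_bigr => l _.
  by rewrite linearP /=; rring.
exists [seq (c i, Lin (bl i)) | i <- enum 'I_n] => u v.
rewrite /hsum big_map big_enum /=.
have -> : g u v = \sum_i \sum_l g ((c i u : R) *: x i) ((c l v : R) *: x l).
  by rewrite {1}[u]cE ai_suml; apply: eq_bigr => i _; rewrite {1}[v]cE ai_sumr.
rewrite (@sum_alternating _ (fun i l => g ((c i u : R) *: x i) ((c l v : R) *: x l))).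
  apply: eq_bigr => i _; rewrite mulr_sumr mulr_suml -sumrB; apply: eq_bigr => l _.
  rewrite !aiZl !aiZr [g (x l) _]aiC; rring.
by move=> i; rewrite aiZl aiZr aixx; rring.
Qed.

Section Rotation.
Variables (P M : lmodType R) (g : alternating_iso P) (chi : alternating_iso M).
Variables (j j' : {linear P -> M}) (r r' : {linear M -> P}).
Hypotheses (hj : forall x y, chi (j x) (j y) = g x y)
  (hr : forall z v, g z (r v) = chi (j z) v)
  (hj' : forall x y, chi (j' x) (j' y) = g x y)
  (hr' : forall z v, g z (r' v) = chi (j' z) v)
  (rj' : forall x, r (j' x) = 0).
Add Ring TM : (text_ring_theory M).
Add Ring TP : (text_ring_theory P).

Lemma add_comp_linear (k : {linear P -> M}) (q : {linear M -> P}) :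
  linear (fun v => v + k (q v)).
Proof. by move=> c v w; rewrite !(linD, linZ); lmod_over R M. Qed.

Lemma sub_comp_linear (k : {linear P -> M}) (q : {linear M -> P}) :
  linear (fun v => v - k (q v)).
Proof. by move=> c v w; rewrite !(linD, linZ); lmod_over R M. Qed.

(* The rotation by a right angle in the plane spanned by the orthogonal copies
   [j P] and [j' P] of [(P, g)], as a product of three shears. *)
Definition rotation : {linear M -> M} :=
  Lin (add_comp_linear j' r) \o Lin (sub_comp_linear j r') \o Lin (add_comp_linear j' r).

Lemma r'j x : r' (j x) = 0.
Proof.
apply: (@ai_injr _ _ g) => z; rewrite hr' ai0r aiC -hr rj' ai0r.
exact: oppr0.
Qed.

Lemma rotationE v : rotation v = v + j' (r v - r' v) - j (r' v + r v).
Proof.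
rewrite /= !(linD, linN) !rj' !(adjointK hj hr) !(adjointK hj' hr').
rewrite ?(linD, linN, lin0); lmod_over R M.
Qed.

(** With [rotation_isometry], this shows that the rotation pulls the replacement at [j'] back to the
    replacement at [j]. *)
Lemma r'_rotation v : r' (rotation v) = r v.
Proof.
rewrite rotationE !(linD, linN) !r'j (adjointK hj' hr') (adjointK hj' hr').
lmod_over R P.
Qed.

Lemma rotation_isometry v w : chi (rotation v) (rotation w) = chi v w.
Proof.
have rs := adjoint_sym hr; have rs' := adjoint_sym hr'.
rewrite !rotationE !(aiDl, aiDr, aiNl, aiNr) !hj !hj' -!hr -!hr' -!rs -!rs'.
rewrite ?(linD, linN, adjointK hj hr, adjointK hj' hr', rj', r'j).
rewrite ?(aiDl, aiDr, aiNl, aiNr, ai0l, ai0r); rring.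
Qed.
End Rotation.

Section Stab.
Variable P0 : lmodType R.
Notation stab := (stab P0).

Fixpoint sform n k (chi : alternating_iso (stab k)) : alternating_iso (stab (n.*2 + k)) :=
  match n with
  | 0 => chi
  | n'.+1 => stf (sform n' chi)
  end.

Lemma sformS n k (chi : alternating_iso (stab k)) v w :
  sform n.+1 chi v w
  = sform n chi v.1.1 w.1.1 + ((v.1.2 : R) * w.2 - (v.2 : R) * w.1.2).
Proof. by []. Qed.

Lemma sform_up_in n k (chi : alternating_iso (stab k)) v w :
  sform n chi (up_in P0 n.*2 k v) w = chi v (up_pr P0 n.*2 k w).
Proof.
elim: n w => [//|n IH] w.
by rewrite sformS /= IH !mul0r subr0 addr0.
Qed.

Lemma pairing_linear P k (e : {linear P -> stab k}) (a b : {linear P -> R^o}) :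
  linear (fun x => ((e x, a x), b x) : stab k.+2).
Proof. by move=> c x y; rewrite !linearP. Qed.

Fixpoint hemb P k (s : functionals P) : {linear P -> stab ((size s).*2 + k)} :=
  match s with
  | [::] => \0
  | p :: s' => Lin (pairing_linear (hemb k s') p.1 p.2)
  end.

Lemma up_pr_hemb P k (s : functionals P) x : up_pr P0 (size s).*2 k (hemb k s x) = 0.
Proof. by elim: s. Qed.

Lemma sform_hemb P k (chi : alternating_iso (stab k)) (s : functionals P) x y :
  sform (size s) chi (hemb k s x) (hemb k s y) = hsum s x y.
Proof.
rewrite /hsum; elim: s => [|p s IH]; first by rewrite big_nil /= ai0l.
by rewrite big_cons -IH [LHS]sformS addrC.
Qed.

(** Forms of all ranks in a single type, so that stabilisation is an endomap that can be
    iterated. *)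
Definition sobj := {k & alternating_iso (stab k)}.
Definition mk k (chi : alternating_iso (stab k)) : sobj := existT _ k chi.
Definition st (x : sobj) : sobj := @mk (projT1 x).+2 (stf (projT2 x)).

Lemma iter_st n k (chi : alternating_iso (stab k)) : iter n st (mk chi) = mk (sform n chi).
Proof. by elim: n => //= n ->. Qed.

Definition Eeq (x y : sobj) : Prop :=
  exists (phi : {linear stab (projT1 x) -> stab (projT1 x)})
    (chi : alternating_iso (stab (projT1 x))),
    [/\ Estab phi, forall v w, chi v w = projT2 x (phi v) (phi w) & y = mk chi].

Lemma Eeq_refl x : Eeq x x.
Proof. by case: x => k chi; exists idfun, chi; split => //; exact: Egen_id. Qed.

Lemma Eeq_sym x y : Eeq x y -> Eeq y x.
Proof.
case: x => k chi [phi [chi' [h e ->]]].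
have [psi [hpsi K K']] := Estab_inverse h.
by exists psi, chi; split=> // v w /=; rewrite e !K'.
Qed.

Lemma Eeq_trans x y z : Eeq x y -> Eeq y z -> Eeq x z.
Proof.
case: x => k chi [phi [chi' [h e ->]]] [psi [chi'' [h' e' ->]]].
exists (phi \o psi), chi''; split=> //; first exact: Estab_comp.
by move=> v w; rewrite e' /= e.
Qed.

Lemma Eeq_st x y : Eeq x y -> Eeq (st x) (st y).
Proof.
case: x => k chi [phi [chi' [h e ->]]].
exists (@sum_id R (stab k.+1) R^o (@sum_id R (stab k) R^o phi)), (stf chi').
split=> //; first by apply/Estab_sum_id/Estab_sum_id.
by move=> v w; rewrite !stfE /= e.
Qed.

Lemma Eeq_iter_st n x y : Eeq x y -> Eeq (iter n st x) (iter n st y).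
Proof. by move=> h; elim: n => //= n; exact: Eeq_st. Qed.

Definition seq_equiv (x y : sobj) : Prop := exists n m, Eeq (iter n st x) (iter m st y).
Local Notation "x ~~ y" := (seq_equiv x y) (at level 70).

Lemma seq_equiv_refl x : x ~~ x.
Proof. by exists 0%N, 0%N; exact: Eeq_refl. Qed.

Lemma seq_equiv_sym x y : x ~~ y -> y ~~ x.
Proof. by case=> n [m h]; exists m, n; exact: Eeq_sym. Qed.

Lemma seq_equiv_trans x y z : x ~~ y -> y ~~ z -> x ~~ z.
Proof.
move=> [n [m h]] [n' [m' h']]; exists (n' + n)%N, (m + m')%N; rewrite !iterD.
apply: Eeq_trans (Eeq_iter_st n' h) _.
by rewrite -iterD addnC iterD; exact: Eeq_iter_st.
Qed.

Lemma seq_equiv_iter n x : x ~~ iter n st x.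
Proof. by exists n, 0%N; exact: Eeq_refl. Qed.

Lemma Eeq_equiv x y : Eeq x y -> x ~~ y.
Proof. by exists 0%N, 0%N. Qed.

(** A relation rather than a function: before stabilisation a form need not contain a copy of
    [(P, g)], and it may contain several. *)
Definition strict (t : triple R) (x y : sobj) : Prop :=
  exists (j : {linear tmod t -> stab (projT1 x)}) (r : {linear stab (projT1 x) -> tmod t})
    (hj : forall u v, projT2 x (j u) (j v) = tg t u v)
    (hr : forall u v, tg t u (r v) = projT2 x (j u) v),
    y = mk (replace (tf t) hj hr).

Lemma strictI (t : triple R) k (chi chi' : alternating_iso (stab k))
  (j : {linear tmod t -> stab k}) (r : {linear stab k -> tmod t}) :
  (forall u v, chi (j u) (j v) = tg t u v) ->
  (forall u v, tg t u (r v) = chi (j u) v) ->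
  (forall v w, chi' v w = chi v w - tg t (r v) (r w) + tf t (r v) (r w)) ->
  strict t (mk chi) (mk chi').
Proof.
move=> hj hr e; exists j, r, hj, hr; congr mk; apply: ai_eq => v w; exact: e.
Qed.

Lemma strictE (t : triple R) k (chi : alternating_iso (stab k)) y :
  strict t (mk chi) y -> exists (j : {linear tmod t -> stab k})
    (r : {linear stab k -> tmod t}) (chi' : alternating_iso (stab k)),
    [/\ y = mk chi', forall u v, chi (j u) (j v) = tg t u v,
        forall u v, tg t u (r v) = chi (j u) v &
        forall v w, chi' v w = chi v w - tg t (r v) (r w) + tf t (r v) (r w)].
Proof. by case=> j [r [hj [hr ->]]]; exists j, r, (replace (tf t) hj hr). Qed.

Lemma strict_st t x y : strict t x y -> strict t (st x) (st y).
Proof.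
case: x => k chi /strictE [j [r [chi' [-> hj hr e]]]].
apply: (@strictI _ k.+2 _ _ (@in1 R (stab k.+1) R^o \o (@in1 R (stab k) R^o \o j))
  (r \o (fst \o fst))) => u v.
- by rewrite stfE /= hj; rring.
- by rewrite stfE /= !mul0r subr0 addr0.
- rewrite !stfE e; exact: addr_shuffle.
Qed.

Lemma strict_iter_st n t x y : strict t x y -> strict t (iter n st x) (iter n st y).
Proof. by move=> h; elim: n => //= n; exact: strict_st. Qed.

Lemma strict_Eeq t x y x' : strict t x y -> Eeq x x' ->
  exists2 y', strict t x' y' & Eeq y y'.
Proof.
case: x => k chi /strictE [j [r [chi' [-> hj hr e]]]] [phi [chi1 [hphi e1 ->]]].
have b := Egen_bijective hphi; have [psi [_ K K']] := Estab_inverse hphi.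
exists (mk (pullback b chi')).
  apply: (@strictI _ _ _ _ (psi \o j) (r \o phi)) => u v /=.
  - by rewrite e1 /= !K' hj.
  - by rewrite e1 /= K' hr.
  - by rewrite e1 e.
by exists phi, (pullback b chi').
Qed.

(** The same [j] and [r] serve: after the replacement [j] is an isometry for [f], with adjoint
    [r]. *)
Lemma strict_opp P (hP : fg_projective P) f g x y :
  strict (Triple hP g f) x y -> strict (Triple hP f g) y x.
Proof.
case: x => k chi /strictE [j [r [chi' [-> hj hr e]]]] /=.
have rj := adjointK hj hr.
apply: (@strictI (Triple hP f g) _ _ _ j r) => u v /=.
- by rewrite e hj !rj /=; rring.
- by rewrite e -hr rj /=; rring.
- by rewrite e /=; rring.
Qed.

Lemma strict_isometric t t' x y : isometric t t' -> strict t' x y -> strict t x y.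
Proof.
case=> h [hb hg hf]; have [k [K K']] := linear_inverse hb.
case: x => n chi /strictE [j [r [chi' [-> hj hr e]]]].
apply: (@strictI t _ _ _ (j \o h) (k \o r)) => u v /=.
- by rewrite hj hg.
- by rewrite hg K' hr.
- by rewrite e hg hf !K'.
Qed.

(** A copy of the sum is a pair of orthogonal copies, and replacing one leaves the other intact.
    Having both orders is what makes the action commutative. *)
Lemma strict_sum t t' x y : strict (triple_sum t t') x y ->
  (exists2 z, strict t x z & strict t' z y) /\ (exists2 z, strict t' x z & strict t z y).
Proof.
case: x => k chi /strictE [j [r [chi' [-> hj hr e]]]].
pose j1 : {linear tmod t -> stab k} := j \o @in1 R (tmod t) (tmod t').
pose j2 : {linear tmod t' -> stab k} := j \o @in2 R (tmod t) (tmod t').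
pose r1 : {linear stab k -> tmod t} := fst \o r.
pose r2 : {linear stab k -> tmod t'} := snd \o r.
have h1 u v : chi (j1 u) (j1 v) = tg t u v by rewrite hj /= /perp /= ai0l addr0.
have h2 u v : chi (j2 u) (j2 v) = tg t' u v by rewrite hj /= /perp /= ai0l add0r.
have a1 u v : tg t u (r1 v) = chi (j1 u) v by rewrite -hr /= /perp /= ai0l addr0.
have a2 u v : tg t' u (r2 v) = chi (j2 u) v by rewrite -hr /= /perp /= ai0l add0r.
have o u v : chi (j1 u) (j2 v) = 0 by rewrite hj /= /perp /= ai0l ai0r addr0.
have o' u v : chi (j2 u) (j1 v) = 0 by rewrite aiC o oppr0.
have r12 u : r1 (j2 u) = 0 by apply: (@ai_injr _ _ (tg t)) => v; rewrite a1 o ai0r.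
have r21 u : r2 (j1 u) = 0 by apply: (@ai_injr _ _ (tg t')) => v; rewrite a2 o' ai0r.
split.
  exists (mk (replace (tf t) h1 a1)).
    exact: (@strictI _ _ _ _ j1 r1).
  apply: (@strictI _ _ _ _ j2 r2) => u v; rewrite /= /replace_form.
  - by rewrite r12 !ai0l h2 subr0 addr0.
  - by rewrite r12 !ai0l a2 subr0 addr0.
  - by rewrite e /= /perp; rring.
exists (mk (replace (tf t') h2 a2)).
  exact: (@strictI _ _ _ _ j2 r2).
apply: (@strictI _ _ _ _ j1 r1) => u v; rewrite /= /replace_form.
- by rewrite r21 !ai0l h1 subr0 addr0.
- by rewrite r21 !ai0l a1 subr0 addr0.
- by rewrite e /= /perp; rring.
Qed.

Lemma strict_chain P (hP : fg_projective P) f0 f1 f2 x y :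
  strict (Triple hP f0 f2) x y ->
  exists2 z, strict (Triple hP f0 f1) x z & strict (Triple hP f1 f2) z y.
Proof.
case: x => k chi /strictE [j [r [chi' [-> hj hr e]]]] /=.
have rj := adjointK hj hr.
exists (mk (replace f1 hj hr)); first exact: (@strictI (Triple hP f0 f1) _ _ _ j r).
apply: (@strictI (Triple hP f1 f2) _ _ _ j r) => u v; rewrite /= /replace_form.
- by rewrite hj !rj /=; rring.
- by rewrite -hr rj /=; rring.
- by rewrite e /=; rring.
Qed.

(** The added hyperbolic planes contain a copy [j3] orthogonal to every copy that was already in
    [chi]. A rotation carries any of the latter to [j3], so all replacements are compared with the
    one at [j3]. *)
Lemma strict_hemb t k (chi : alternating_iso (stab k)) (s : functionals (tmod t)) :
  (forall x y, tg t x y = hsum s x y) ->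
  exists2 y, strict t (iter (size s) st (mk chi)) y &
    forall x, strict t (mk chi) x -> Eeq y (iter (size s) st x).
Proof.
move=> gE; rewrite iter_st.
pose j3 := hemb k s; pose X := sform (size s) chi.
have h3 u v : X (j3 u) (j3 v) = tg t u v by rewrite gE; exact: sform_hemb.
have [r3 a3] := ai_adjoint X (tg t) j3.
exists (mk (replace (tf t) h3 a3)); first exact: (@strictI _ _ _ _ j3 r3).
move=> x /strictE [j [r [chi' [-> hj hr e]]]]; rewrite iter_st.
pose ui := up_in P0 (size s).*2 k; pose up := up_pr P0 (size s).*2 k.
have XE v w : X (ui v) w = chi v (up w) by exact: sform_up_in.
have pj3 u : up (j3 u) = 0 by exact: up_pr_hemb.
have r3i v : r3 (ui v) = 0.
  by apply: (@ai_injr _ _ (tg t)) => u; rewrite a3 aiC XE pj3 !ai0r oppr0.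
have piK v : up (ui v) = v by exact: up_inK.
have rj := adjointK hj hr.
pose j1 : {linear tmod t -> _} := ui \o j; pose r1 : {linear _ -> tmod t} := r \o up.
have hj1 u v : X (j1 u) (j1 v) = tg t u v by rewrite /= XE piK hj.
have hr1 u v : tg t u (r1 v) = X (j1 u) v by rewrite /= XE hr.
have rj3 u : r1 (j3 u) = 0 by rewrite /= pj3 lin0.
have sfE v w : sform (size s) chi' v w = X v w - tg t (r1 v) (r1 w) + tf t (r1 v) (r1 w).
  rewrite /r1 /X /up; elim: (size s) v w => [|n IH] v w; first exact: e.
  by rewrite !sformS IH; exact: addr_shuffle.
exists (rotation j1 j3 r1 r3), (sform (size s) chi'); split=> //.
  (* [j3] takes its values in the new coordinates and [r3] vanishes on [stab k], so each factor of
     the rotation is a shear between these two blocks. *)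
  have hA : Estab (Lin (add_comp_linear j3 r1)).
    by apply: (@Estab_up_target _ _ _ _ (j3 \o r)) => v //=; exact: pj3.
  have hB : Estab (Lin (sub_comp_linear j1 r3)).
    apply: (@Estab_up_source _ _ _ _ (-%R \o j \o r3)) => v /=.
      by rewrite r3i (lin0 j) oppr0.
    by rewrite (linN ui).
  by apply: Estab_comp => //; exact: Estab_comp.
move=> v w; rewrite sfE /= /replace_form.
rewrite (rotation_isometry hj1 hr1 h3 a3 rj3).
by rewrite !(r'_rotation hj1 hr1 h3 a3 rj3).
Qed.

End Stab.
End HyperbolicEmbedding.

(** * The action of V(R) on stable classes *)

Section Action.
Variables (R : comPzRingType) (P0 : lmodType R).
Implicit Types x y z : sobj P0.
Local Notation "x ~~ y" := (seq_equiv x y) (at level 70).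

(** Permutations of the stable classes are encoded as relations on representatives that respect
    [~~], so no quotient is formed. *)
Definition saturated (A : sobj P0 -> sobj P0 -> Prop) :=
  forall x x' y y', x ~~ x' -> A x' y' -> y' ~~ y -> A x y.
Definition total (A : sobj P0 -> sobj P0 -> Prop) := forall x, exists y, A x y.
Definition functional (A : sobj P0 -> sobj P0 -> Prop) :=
  forall x y y', A x y -> A x y' -> y ~~ y'.
Definition converse (A : sobj P0 -> sobj P0 -> Prop) x y := A y x.
Definition composite (A B : sobj P0 -> sobj P0 -> Prop) x y := exists2 z, A x z & B z y.

Definition permutation A := [/\ saturated A, total A, functional A,
  total (converse A) & functional (converse A)].

Definition commute A B := forall x y, composite A B x y -> composite B A x y.

Lemma permutation_converse A : permutation A -> permutation (converse A).
Proof.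
case=> sA tA fA tA' fA'; split=> // x x' y y' xx' h yy'.
exact: sA (seq_equiv_sym yy') h (seq_equiv_sym xx').
Qed.

Lemma permutation_composite A B : permutation A -> permutation B ->
  permutation (composite A B).
Proof.
move=> [sA tA fA tA' fA'] [sB tB fB tB' fB']; split.
- move=> x x' y y' xx' [z h1 h2] yy'; exists z.
    exact: sA xx' h1 (seq_equiv_refl z).
  exact: sB (seq_equiv_refl z) h2 yy'.
- by move=> x; have [z h1] := tA x; have [y h2] := tB z; exists y, z.
- move=> x y y' [z h1 h2] [z' h1' h2']; have e := fA _ _ _ h1 h1'.
  exact: fB h2 (sB _ _ _ _ e h2' (seq_equiv_refl _)).
- by move=> x; have [z h1] := tB' x; have [y h2] := tA' z; exists y, z.
- move=> x y y' [z h1 h2] [z' h1' h2']; have e := fB' _ _ _ h2 h2'.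
  exact: fA' h1 (sA _ _ _ _ (seq_equiv_refl _) h1' (seq_equiv_sym e)).
Qed.

Lemma permutation_equiv : permutation (@seq_equiv R P0).
Proof.
split.
- by move=> x x' y y' h1 h2 h3; apply: seq_equiv_trans h1 (seq_equiv_trans h2 h3).
- by move=> x; exists x; exact: seq_equiv_refl.
- by move=> x y y' h1 h2; apply: seq_equiv_trans (seq_equiv_sym h1) h2.
- by move=> x; exists x; exact: seq_equiv_refl.
- by move=> x y y' h1 h2; apply: seq_equiv_trans h1 (seq_equiv_sym h2).
Qed.

Lemma commute_sym A B : permutation A -> permutation B -> commute A B -> commute B A.
Proof.
move=> pA pB h x y hBA.
have [_ tAB _ _ _] := permutation_composite pA pB; have [y' h'] := tAB x.
have [_ _ fBA _ _] := permutation_composite pB pA.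
have [sAB _ _ _ _] := permutation_composite pA pB.
exact: sAB (seq_equiv_refl x) h' (fBA _ _ _ (h _ _ h') hBA).
Qed.

Lemma commute_composite A B C : commute A C -> commute B C -> commute (composite A B) C.
Proof.
move=> hA hB x y [z [w h1 h2] h3].
have [w' h4 h5] : composite C B w y by apply: hB; exists z.
have [z' h6 h7] : composite C A x w' by apply: hA; exists w.
by exists z' => //; exists w'.
Qed.

Lemma commute_converse A B : permutation A -> permutation B ->
  commute A B -> commute (converse A) B.
Proof.
move=> [sA tA fA tA' fA'] [sB tB fB tB' fB'] h x y [z h1 h2].
have [w h3] := tB x.
have [y' h4 h5] : composite B A z w by apply: h; exists x.
exists w => //; apply: sA (fB _ _ _ h2 h4) h5 (seq_equiv_refl w).
Qed.

Definition act_triple (t : triple R) x y :=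
  exists x' y', [/\ x ~~ x', strict t x' y' & y' ~~ y].

Lemma strict_total t x : exists n y, strict t (iter n (@st R P0) x) y.
Proof.
have [s hs] := alternating_hsum (tg t) (tmodP t).
case: x => k chi; have [y h _] := strict_hemb chi hs.
by exists (size s), y.
Qed.

Lemma strict_functional t x y y' : strict t x y -> strict t x y' -> y ~~ y'.
Proof.
have [s hs] := alternating_hsum (tg t) (tmodP t).
case: x => k chi h h'; have [z _ u] := strict_hemb chi hs.
exists (size s), (size s).
exact: Eeq_trans (Eeq_sym (u _ h)) (u _ h').
Qed.

Lemma act_triple_functional t : functional (act_triple t).
Proof.
move=> x y y' [x1 [y1 [h1 h2 h3]]] [x2 [y2 [h4 h5 h6]]].
have [n [m e]] := seq_equiv_trans (seq_equiv_sym h1) h4.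
have [y3 h7 e7] := strict_Eeq (strict_iter_st n h2) e.
have h8 := strict_functional h7 (strict_iter_st m h5).
apply: seq_equiv_trans (seq_equiv_sym h3) _.
apply: seq_equiv_trans (seq_equiv_iter n y1) _.
apply: seq_equiv_trans (Eeq_equiv e7) _.
apply: seq_equiv_trans h8 _.
exact: seq_equiv_trans (seq_equiv_sym (seq_equiv_iter m y2)) h6.
Qed.

Lemma act_triple_total t : total (act_triple t).
Proof.
move=> x; have [n [y h]] := strict_total t x.
exists y, (iter n (@st R P0) x), y; split=> //; last exact: seq_equiv_refl.
exact: seq_equiv_iter.
Qed.

Lemma act_triple_opp M (hM : fg_projective M) g f x y :
  act_triple (Triple hM g f) x y -> act_triple (Triple hM f g) y x.
Proof.
move=> [x' [y' [h1 h2 h3]]]; exists y', x'.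
by split; [exact: seq_equiv_sym|exact: strict_opp|exact: seq_equiv_sym].
Qed.

Lemma permutation_act_triple t : permutation (act_triple t).
Proof.
have f := act_triple_functional; have tt := act_triple_total.
split=> //.
- move=> x x' y y' xx' [x1 [y1 [h1 h2 h3]]] yy'; exists x1, y1; split=> //.
    exact: seq_equiv_trans xx' h1.
  exact: seq_equiv_trans h3 yy'.
- case: t => M hM g f' x; have [y h] := tt (Triple hM f' g) x.
  by exists y; exact: act_triple_opp.
- by case: t => M hM g f' x y y' /act_triple_opp h /act_triple_opp; exact: f h.
Qed.

Lemma act_triple_sum t t' x y : act_triple (triple_sum t t') x y ->
  composite (act_triple t) (act_triple t') x y /\
  composite (act_triple t') (act_triple t) x y.
Proof.
move=> [x1 [y1 [h1 /strict_sum[[z h2 h3] [z' h2' h3']] h4]]].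
split; [exists z; [exists x1, z|exists z, y1]|exists z'; [exists x1, z'|exists z', y1]];
  by split=> //; exact: seq_equiv_refl.
Qed.

(** Totality of [A] and functionality of [B] give the converse inclusion; hence a relation between
    triples can be checked in one direction only. *)
Lemma permutation_eq A B : permutation A -> permutation B ->
  (forall x y, A x y -> B x y) -> forall x y, A x y <-> B x y.
Proof.
move=> [sA tA _ _ _] [_ _ fB _ _] h x y; split; first exact: h.
move=> hB; have [y' hA] := tA x.
exact: sA (seq_equiv_refl x) hA (fB _ _ _ (h _ _ hA) hB).
Qed.

(** Both composites are the action of [triple_sum t t'], whose two summands may be replaced in
    either order. *)
Lemma commute_act_triple t t' : commute (act_triple t) (act_triple t').
Proof.
have p := permutation_act_triple; move=> x y h.
apply: (act_triple_sum _).2.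
apply/(permutation_eq (p (triple_sum t t')) (permutation_composite (p t) (p t'))) => //.
by move=> u v /act_triple_sum [].
Qed.

(* V(R) acts on the stable elementary classes of forms on the modules
   [stab P0 k]: a triple [(P, g, f)] replaces an isometric copy of [(P, g)] by
   [(P, f)]. *)
Fixpoint act (u : formal R) : sobj P0 -> sobj P0 -> Prop :=
  match u with
  | Fgen t => act_triple t
  | Fzero => @seq_equiv R P0
  | Fadd u v => composite (act u) (act v)
  | Fopp u => converse (act u)
  end.

Lemma permutation_act u : permutation (act u).
Proof.
elim: u => [t||u hu v hv|u hu] /=.
- exact: permutation_act_triple.
- exact: permutation_equiv.
- exact: permutation_composite.
- exact: permutation_converse.
Qed.

Lemma commute_equiv A : permutation A -> commute (@seq_equiv R P0) A.
Proof.
move=> [sA _ _ _ _] x y [z h1 h2]; exists y; last exact: seq_equiv_refl.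
exact: sA h1 h2 (seq_equiv_refl y).
Qed.

Lemma commute_act u v : commute (act u) (act v).
Proof.
have p := permutation_act.
elim: u => [t||u hu u' hu'|u hu] /=; last 1 first.
- exact: commute_converse.
- elim: v => [t'||v hv v' hv'|v hv] /=.
  + exact: commute_act_triple.
  + apply: commute_sym; [exact: permutation_equiv|exact: permutation_act_triple|].
    by apply: commute_equiv; exact: permutation_act_triple.
  + apply: commute_sym; [|exact: permutation_act_triple|].
      by apply: permutation_composite.
    by apply: commute_composite; apply: commute_sym => //; exact: permutation_act_triple.
  + apply: commute_sym; [|exact: permutation_act_triple|].
      exact: permutation_converse.
    apply: commute_converse => //; first exact: permutation_act_triple.
    by apply: commute_sym => //; exact: permutation_act_triple.
- exact: commute_equiv.
- exact: commute_composite.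
Qed.

Lemma act_Vrel u v : Vrel u v -> forall x y, act u x y <-> act v x y.
Proof.
have p := permutation_act.
elim=> {u v} //=.
- by move=> u v _ h x y; rewrite h.
- by move=> u v w _ h _ h' x y; rewrite h h'.
- by move=> u u' v v' _ h _ h' x y; split=> -[z /h h1 /h' h2]; exists z.
- by move=> u u' _ h x y; exact: h.
- move=> u v w x y; split=> [[z h1 [z' h2 h3]]|[z [z' h1 h2] h3]].
    by exists z' => //; exists z.
  by exists z' => //; exists z.
- by move=> u v x y; split; exact: commute_act.
- move=> u x y; have [s _ _ _ _] := p u; split=> [[z h1 h2]|h].
    exact: s h1 h2 (seq_equiv_refl y).
  by exists x => //; exact: seq_equiv_refl.
- move=> u x y; have [s t f t' f'] := p u; split=> [[z h1 h2]|h].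
    exact: f h1 h2.
  have [z hz] := t' x; exists z => //.
  exact: s (seq_equiv_refl z) hz h.
- move=> t t' tt'; apply: permutation_eq => [||x y].
  + exact: permutation_act_triple.
  + exact: permutation_act_triple.
  move=> [x' [y' [h1 h2 h3]]]; exists x', y'; split=> //.
  apply: strict_isometric h2; case: tt' => h [hb hg hf].
  have [k [K K']] := linear_inverse hb.
  by exists k; split; [exists h|move=> u v; rewrite hg !K'|move=> u v; rewrite hf !K'].
- move=> t t'; apply: permutation_eq.
  + exact: permutation_act_triple.
  + by apply: permutation_composite; exact: permutation_act_triple.
  by move=> x y /act_triple_sum [].
- move=> M hM f0 f1 f2 x y; apply: iff_sym; move: x y; apply: permutation_eq.
  + exact: permutation_act_triple.
  + by apply: permutation_composite; exact: permutation_act_triple.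
  move=> x y [x' [y' [h1 /strict_chain h2 h3]]].
  have [z h4 h5] := h2 f1; exists z; [exists x', z|exists z, y'];
    by split=> //; exact: seq_equiv_refl.
Qed.

(** Let the class act on the form [g]: with the identity as the copy, the triple
    [(stab P0 k, g, f1)] takes [g] to [f1], and equal classes act alike. *)
Lemma cl_eq_equiv k (hk : fg_projective (stab P0 k)) (g f f' : alternating_iso (stab P0 k)) :
  cl hk g f = cl hk g f' -> mk f ~~ mk f'.
Proof.
move/VclassP => /act_Vrel e.
have h f1 : act (Fgen (Triple hk g f1)) (mk g) (mk f1).
  exists (mk g), (mk f1); split; [exact: seq_equiv_refl| |exact: seq_equiv_refl].
  by apply: (@strictI _ _ (Triple hk g f1) _ _ _ idfun idfun) => //= v w; rewrite subrr add0r.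
apply: (act_triple_functional (t := Triple hk g f')) (h f').
by apply/e; exact: h.
Qed.

End Action.

(** * Descent to [P_4] and orbits on [P_3] *)

Section Descent.
Variables (R : comPzRingType) (P0 : lmodType R).
Add Ring RR : (rring_theory R).
Ltac rring := ring_over R (rring_theory R).
Notation stab := (stab P0).

(** Only generators adding [l x] times the top vector [e] need work. They change [chi] by
    [l y * chi x e - l x * chi y e]. If [v] represents [l], subtracting [chi x e] times [v] changes
    [chi] by the same amount, and adding [chi x e * v.2] times [e] has no further effect on the form
    while it restores the last coordinate. Composites are treated through pullbacks, hence the
    quantification over [chi]. *)
Lemma fix_last_coordinate k (eps : {linear stab k.+1 -> stab k.+1})
  (chi : alternating_iso (stab k.+1)) : Estab eps ->
  exists delta : {linear stab k.+1 -> stab k.+1},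
    [/\ Estab delta, forall x, (delta x).2 = x.2 &
        forall x y, chi (eps x) (eps y) = chi (delta x) (delta y)].
Proof.
move=> h; elim: h chi => {eps} [i j s ij||f g hf IHf hg IHg|f f' hf IH K K'] chi.
- case: (pselect (i = Some ord_max)) => [ei|ni]; last first.
    exists (elementary_gen (@summand_inc R P0 k.+1) (@summand_prj R P0 k.+1) s).
    split=> // [|x]; first exact: Egen_gen.
    case: i s ij ni => [i|] s ij ni /=; last by rewrite addr0.
    rewrite (negbTE (_ : val i != k)) /= ?addr0 //.
    by apply: contra_notN ni => /eqP e; congr Some; apply/val_inj.
  move: s ij; rewrite ei => s ij.
  pose l : {linear stab k.+1 -> R^o} := s \o summand_prj P0 j.
  pose e := e_top P0 k.
  have le : l e = 0.
    have -> : l e = s (summand_prj P0 j (summand_inc P0 (Some ord_max) (1 : R^o))).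
      by rewrite /= eqxx.
    by rewrite (summand_orthogonal _ (nesym ij)) lin0.
  have epsE x : elementary_gen (@summand_inc R P0 k.+1) (@summand_prj R P0 k.+1) s x
      = x + (l x : R) *: e.
    by rewrite /e /e_top -linZ scale_regular1 /= eqxx.
  have [v vE] := ai_repr chi l.
  pose g : {linear stab k -> R^o} := ai_functional chi e \o @in1 R (stab k) R^o.
  have xE (x : stab k.+1) : x = in1 R^o x.1 + (x.2 : R) *: e.
    by case: x => x c; rewrite /e /e_top -linZ scale_regular1; congr pair; rewrite /= ?addr0 ?add0r.
  have gE (x : stab k.+1) : chi x e = g x.1.
    by rewrite {1}(xE x) aiDl aiZl aixx mulr0 addr0.
  have gv : g (- v.1) = 0.
    by rewrite linN -gE aiC vE le !oppr0.
  exists (transvection (in1 R^o (- v.1)) (g \o fst)); split.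
  + exact: Estab_transvection.
  + by case=> x c; rewrite /= scaler0 addr0.
  move=> x y; rewrite !epsE !transvectionE.
  have -> : in1 R^o (- v.1) = (v.2 : R) *: e - v.
    by apply/eqP; rewrite eq_sym subr_eq [X in _ + X](xE v) addrA -linD addNr lin0 add0r.
  rewrite !(aiDl, aiDr, aiZl, aiZr, aiNl, aiNr) !vE !aixx.
  rewrite (aiC _ e y) (aiC _ v y) (aiC _ v e) !vE !gE le /=.
  have -> : s (summand_prj P0 j v) = 0 by rewrite -(aixx chi v) vE.
  rring.
- exists idfun; split=> //; exact: Egen_id.
- have [d1 [h1 p1 e1]] := IHf chi.
  have [d2 [h2 p2 e2]] := IHg (pullback (Egen_bijective h1) chi).
  exists (d1 \o d2); split=> [|x|x y]; first exact: Estab_comp.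
    by rewrite /= p1 p2.
  by rewrite /= e1; exact: e2.
- have b : bijective f' by exists f.
  have [d [h p e]] := IH (pullback b chi).
  have [d' [h' dK d'K]] := Estab_inverse h.
  exists d'; split=> // [x|x y]; first by rewrite -{2}(d'K x) p.
  have := e (d' x) (d' y); rewrite /= !K !d'K => ->.
  by [].
Qed.

Lemma stab_coordinates k (x : stab k.+1) : x = in1 R^o x.1 + (x.2 : R) *: e_top P0 k.
Proof.
by case: x => x c; rewrite -linZ scale_regular1; congr pair; rewrite /= ?addr0 ?add0r.
Qed.

Section Step.
Variables (k : nat) (chi chi' : alternating_iso (stab k)).
Variable phi : {linear stab k.+2 -> stab k.+2}.
Hypotheses (phi_stable : stably_elementary phi) (phi_bij : bijective phi).
Hypothesis phi_isometry : forall x y, stf chi' x y = stf chi (phi x) (phi y).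
Hypothesis elementary_row :
  exists2 eps : {linear stab k.+2 -> stab k.+2}, Estab eps & forall x, (phi x).2 = (eps x).2.

(** With [d] from [fix_last_coordinate] for the inverse of [eps], the composite [d \o eps] is an
    elementary isometry of [stf chi']. Precomposing [phi] with its inverse [e] keeps the isometry
    and, as [d] fixes the last coordinate, makes the last row trivial. *)
Lemma normalise_last_coordinate : exists phi1 : {linear stab k.+2 -> stab k.+2},
  [/\ stably_elementary phi1, bijective phi1, forall x, (phi1 x).2 = x.2 &
      forall x y, stf chi' x y = stf chi (phi1 x) (phi1 y)].
Proof.
have [eps heps epsE] := elementary_row.
have [eps' [heps' K K']] := Estab_inverse heps.
have [d [hd pd dE]] := fix_last_coordinate (stf chi' : alternating_iso (stab k.+2)) heps'.
have [e [he eK eK']] := Estab_inverse (Estab_comp hd heps).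
exists (phi \o e); split.
- by apply: stably_elementary_comp => //; exact: Estab_stably_elementary.
- by apply: bij_comp => //; exact: Egen_bijective he.
- by move=> x; rewrite /= epsE -pd -[in RHS](eK' x).
move=> x y; rewrite -[RHS]/(stf chi (phi (e x)) (phi (e y))) -phi_isometry.
rewrite -{1}(eK' x) -{1}(eK' y); have := dE (eps (e x)) (eps (e y)).
by rewrite !K => ->.
Qed.

(** The vector [e] represents the last coordinate for both forms, so the normalised isometry [f]
    fixes it as well. Then [f] is block triangular with [alpha] as its block on [stab k]; the other
    factors are elementary shears, and cancelling them shows [alpha] stably elementary. *)
Lemma descent_step : exists alpha : {linear stab k -> stab k},
  [/\ stably_elementary alpha, bijective alpha &
      forall x y, chi' x y = chi (alpha x) (alpha y)].
Proof.
have [f [hf fb f2 fE]] := normalise_last_coordinate.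
have [f' [fK f'K]] := linear_inverse fb.
have f'2 x : (f' x).2 = x.2 by rewrite -{2}(f'K x) f2.
pose i1 := @in1 R (stab k.+1) R^o \o @in1 R (stab k) R^o.
pose e : stab k.+2 := in1 R^o (e_top P0 k).
have eE x : stf chi e x = x.2 by rewrite stfE /= ai0l mul0r; rring.
have eE' x : stf chi' e x = x.2 by rewrite stfE /= ai0l mul0r; rring.
have fe : f e = e.
  apply: (@ai_injl _ _ (stf chi)) => x.
  by rewrite -(f'K x) -fE eE eE' f2.
pose alpha : {linear stab k -> stab k} := fst \o (fst \o (f \o i1)).
pose beta : {linear stab k -> stab k} := fst \o (fst \o (f' \o i1)).
pose l : {linear stab k -> R^o} := snd \o (fst \o (f \o i1)).
have pairE (z : stab k.+2) : z = ((z.1.1, z.1.2), z.2) by case: z => [[]].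
have fi x : f (i1 x) = ((alpha x, l x), 0 : R^o) by rewrite [LHS]pairE f2.
have f'i x : f' (i1 x) = ((beta x, (f' (i1 x)).1.2), 0 : R^o) by rewrite [LHS]pairE f'2.
have i1E x c d : ((x, c), d) = i1 x + (c : R) *: e + (d : R) *: e_top P0 k.+1 :> stab k.+2.
  rewrite /e /e_top /i1 -!linZ !scale_regular1; congr pair; last by rewrite /= !add0r.
  by congr pair; rewrite /= ?addr0 ?add0r.
have alphaE x y : chi' x y = chi (alpha x) (alpha y).
  have := fE (i1 x) (i1 y); rewrite !stfE !fi /= !mul0r !mulr0 !subr0 !addr0.
  by [].
have alphaK y : alpha (beta y) = y.
  have h : f (f' (i1 y)) = i1 y by [].
  move: h; rewrite f'i i1E scale0r addr0 linD linZ fe fi => h.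
  by have := congr1 (fun z : stab k.+2 => z.1.1) h; rewrite /= scaler0 addr0.
have betaK x : beta (alpha x) = x.
  by apply: (@ai_injl _ _ chi') => y; rewrite !alphaE alphaK.
have alpha_bij : bijective alpha by exists beta.
pose F := f (e_top P0 k.+1).
have FE : F = ((F.1.1, F.1.2), 1 : R^o) by rewrite [LHS]pairE /F f2.
pose eta1 := transvection (in1 R^o ((beta F.1.1, F.1.2) : stab k.+1)) (@snd (stab k.+1) R^o).
pose eta2 := @sum_id R (stab k.+1) R^o (transvection (e_top P0 k) (l \o fst)).
have eta_el : Estab (eta1 \o eta2 : {linear stab k.+2 -> stab k.+2}).
  apply: Estab_comp; first exact: Estab_transvection_snd.
  by apply: Estab_sum_id; exact: Estab_transvection_top.
have [eta [heta etaK eta'K]] := Estab_inverse eta_el.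
have fdec z : f z = @sum_id R (stab k.+1) R^o (@sum_id R (stab k) R^o alpha) (eta1 (eta2 z)).
  case: z => [[x c] d]; rewrite {1}i1E !(linD f) !(linZ f) fe fi -/F FE.
  have hA : alpha x + (d : R) *: F.1.1 = alpha (x + (d : R) *: beta F.1.1).
    by rewrite linD linZ alphaK.
  apply: injective_projections; last first.
    by rewrite /= !scaler0 !addr0 add0r scale_regular1.
  apply: injective_projections.
    by rewrite /= !scaler0 !addr0; exact: hA.
  rewrite /= !scale_regular1 -addrA [RHS]addrAC [RHS]addrC.
  by congr (_ + _); rewrite addrC.
exists alpha; split=> //.
apply: stably_elementary_sum_id; apply: stably_elementary_sum_id.
have -> : @sum_id R (stab k.+1) R^o (@sum_id R (stab k) R^o alpha) = f \o eta :> {linear _ -> _}.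
  apply: linear_ext => z; rewrite [RHS]fdec.
  by have := eta'K z => /= ->.
by apply: stably_elementary_comp => //; exact: Estab_stably_elementary.
Qed.
End Step.

Lemma descent n (chi chi' : alternating_iso (stab 2)) phi :
  (forall k (f : {linear stab k.+2 -> stab k.+2}), (exists m, k = m.*2 + 2)%N ->
     bijective f -> stably_elementary f ->
     exists2 eps : {linear stab k.+2 -> stab k.+2}, Estab eps & forall x, (f x).2 = (eps x).2) ->
  stably_elementary phi -> bijective phi ->
  (forall x y, sform n chi' x y = sform n chi (phi x) (phi y)) ->
  exists alpha : {linear stab 2 -> stab 2},
  [/\ stably_elementary alpha, bijective alpha &
      forall x y, chi' x y = chi (alpha x) (alpha y)].
Proof.
move=> row; elim: n phi => [|n IH] phi hphi bphi phiE; first by exists phi.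
have [|a [ha ba aE]] := @descent_step (n.*2 + 2) (sform n chi) (sform n chi') phi hphi bphi phiE.
  by apply: row => //; exists n.
exact: IH ha ba aE.
Qed.

(** * Last rows of forms on [P_4] *)

Section Orbit.
Definition e3 : stab 2 := in1 R^o (e_top P0 0).
Definition e4 : stab 2 := e_top P0 1.

(** Compares the last row of the form pulled back along [eps] with that of [chi]. All forms are
    quantified over, and [eps] is bijective, because composites are treated by pulling forms
    back. *)
Definition orbit_invariant (eps : {linear stab 2 -> stab 2}) :=
  bijective eps /\ forall chi : alternating_iso (stab 2),
  exists2 delta : {linear stab 1 -> stab 1}, Estab delta &
    forall x, chi (eps (in1 R^o x)) (eps e4) = chi (in1 R^o (delta x)) e4.

Lemma orbit_invariant_comp (f g : {linear stab 2 -> stab 2}) :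
  orbit_invariant f -> orbit_invariant g -> orbit_invariant (f \o g).
Proof.
move=> [bf hf] [bg hg]; split; first exact: bij_comp.
move=> chi; have [d1 h1 e1] := hf chi; have [d2 h2 e2] := hg (pullback bf chi).
exists (d1 \o d2) => [|x]; first exact: Estab_comp.
by rewrite [RHS]/= -e1; exact: e2.
Qed.

Lemma orbit_invariant_inverse (f g : {linear stab 2 -> stab 2}) :
  orbit_invariant f -> cancel f g -> cancel g f ->
  orbit_invariant g.
Proof.
move=> [bf hf] K K'; have bg : bijective g by exists f.
split=> // chi; have [d h e] := hf (pullback bg chi).
have [d' [h' dK d'K]] := Estab_inverse h; exists d' => // x.
by have := e (d' x); rewrite /= !K d'K => ->.
Qed.

Lemma orbit_invariant_restrict (eps : {linear stab 2 -> stab 2}) (delta : {linear stab 1 -> stab 1}) :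
  bijective eps -> Estab delta -> (forall x, eps (in1 R^o x) = in1 R^o (delta x)) ->
  eps e4 = e4 -> orbit_invariant eps.
Proof. by move=> b h e e'; split=> // chi; exists delta => // x; rewrite e e'. Qed.

(** The vector [w] representing the last coordinate has last coordinate [chi w w = 0], so it lies in
    [stab k]. Up to sign it is a section of the last row, orthogonal to [stab k]. *)
Lemma alternating_kernel k (chi : alternating_iso (stab k.+1)) :
  exists w : stab k, (forall x, chi (in1 R^o x) (in1 R^o w) = 0)
    /\ chi (in1 R^o w) (e_top P0 k) = 1.
Proof.
have [w wE] := ai_repr chi (@snd (stab k) R^o).
have w2 : w.2 = 0 by rewrite -wE aixx.
have {}w2 : w = in1 R^o w.1 by rewrite {1}(stab_coordinates w) w2 scale0r addr0.
have inN : in1 R^o (- w.1) = - w by rewrite [in RHS]w2 (linN (@in1 R (stab k) R^o)).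
exists (- w.1); split=> [x|]; first by rewrite inN aiNr wE oppr0.
by rewrite inN aiNl aiC opprK wE.
Qed.

(** The row changes by [chi x (c *: e3)], which depends on the [P0] part [x.1] alone. Since the row
    takes the value [1] at [w], adding [g0 x.1] times [w] to [x] has the same effect. That map is
    elementary: a transvection along [w.1], which [g0] kills, and a shear into [e3]. *)
Lemma orbit_invariant_e4_e3 (c : R) :
  orbit_invariant (transvection (c *: e3) (@snd (stab 1) R^o)).
Proof.
have hel : Estab (transvection (c *: e3) (@snd (stab 1) R^o) : {linear stab 2 -> stab 2}).
  by rewrite /e3 -linZ; exact: Estab_transvection_snd.
split; first exact: Egen_bijective hel.
move=> chi; have [w [w0]] := alternating_kernel chi; rewrite -/e4 => w1.
pose g0 : {linear stab 0 -> R^o} := ai_functional chi (c *: e3) \o @in1 R (stab 1) R^o \o @in1 R (stab 0) R^o.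
have gE (x : stab 1) : chi (in1 R^o x) (c *: e3) = g0 x.1.
  rewrite {1}(stab_coordinates x) linD linZ aiDl aiZl !aiZr -/e3 aixx !mulr0 addr0.
  by rewrite /= aiZr.
have gw : g0 w.1 = 0 by rewrite -gE aiZr aiC w0 oppr0 mulr0.
have l2l : linear (fun y => (w.2 : R) * g0 y : R^o).
  by move=> a x y; rewrite linD linZ mulrDr mulrCA.
pose d1 := transvection (in1 R^o w.1) (g0 \o fst).
pose d2 := transvection (e_top P0 0) (Lin l2l \o fst).
exists (d1 \o d2 : {linear stab 1 -> stab 1}).
  apply: Estab_comp; first exact: Estab_transvection.
  exact: Estab_transvection_top.
move=> x; transitivity (chi (in1 R^o (x + (g0 x.1 : R) *: w)) e4); last first.
  congr (chi (in1 R^o _) e4).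
  rewrite [in LHS](stab_coordinates w) /d1 /d2 /= scaler0 addr0 scalerDr scalerA.
  by rewrite mulrC -addrA; congr (_ + _); rewrite addrC.
rewrite (linD (@in1 R (stab 1) R^o)) (linZ (@in1 R (stab 1) R^o)) [RHS]aiDl [X in _ = _ + X]aiZl w1 mulr1 -gE.
by rewrite !transvectionE /= scale0r addr0 scale1r aiDr.
Qed.

Definition gen2 (i j : option 'I_2) (s : {linear summand P0 j -> summand P0 i}) :
  {linear stab 2 -> stab 2} := elementary_gen (@summand_inc R P0 2) (@summand_prj R P0 2) s.

Lemma gen2_bijective (i j : option 'I_2) (s : {linear summand P0 j -> summand P0 i}) :
  i <> j -> bijective (gen2 s).
Proof. by move=> h; apply: Egen_bijective; exact: Egen_gen. Qed.

Lemma orbit_invariant_low (i j : option 'I_2) (s : {linear summand P0 j -> summand P0 i}) :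
  i <> j -> i <> Some ord_max -> j <> Some ord_max -> orbit_invariant (gen2 s).
Proof.
have inP (l : option 'I_2) : l <> Some ord_max -> l = None \/ l = Some ord0.
  case: l => [[[|[|//]] h]|] nl; [right|case: nl|by left]; by congr Some; apply/val_inj.
move=> ij /inP; case=> ei; move: s ij; rewrite {}ei => s ij /inP; case=> ej;
  move: s ij; rewrite {}ej => s ij //.
- pose d : {linear stab 1 -> stab 1} := @elementary_gen R (stab 1) _ _
    (@summand_inc R P0 1) (@summand_prj R P0 1) None (Some ord0) s.
  apply: (@orbit_invariant_restrict _ d) => //.
  + exact: gen2_bijective.
  + exact: Egen_gen.
  + by move=> x; rewrite /gen2 /d /= (linD (@in1 R (stab 1) R^o)).
  + by rewrite /gen2 /= !lin0 addr0.
- pose d : {linear stab 1 -> stab 1} := @elementary_gen R (stab 1) _ _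
    (@summand_inc R P0 1) (@summand_prj R P0 1) (Some ord0) None s.
  apply: (@orbit_invariant_restrict _ d) => //.
  + exact: gen2_bijective.
  + exact: Egen_gen.
  + by move=> x; rewrite /gen2 /d /= (linD (@in1 R (stab 1) R^o)).
  + by rewrite /gen2 /= !lin0 addr0.
Qed.

(** Adding multiples of [e4] changes no pairing with [e4], and the generator fixes [e4] because [j]
    is another summand. *)
Lemma orbit_invariant_high (j : option 'I_2) 
  (s : {linear summand P0 j -> summand P0 (Some ord_max)}) : Some ord_max <> j ->
  orbit_invariant (gen2 s).
Proof.
move=> ij; split; first exact: gen2_bijective.
move=> chi; exists idfun => [|x]; first exact: Egen_id.
have genE y : gen2 s y = y + (s (summand_prj P0 j y) : R) *: e4.
  by rewrite /gen2 /e4 /e_top -linZ scale_regular1 /=.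
have e40 : summand_prj P0 j e4 = 0.
  have -> : e4 = summand_inc P0 (Some ord_max) (1 : R^o) by [].
  exact: summand_orthogonal (nesym ij).
by rewrite !genE e40 lin0 scale0r addr0 aiDl aiZl aixx mulr0 addr0.
Qed.

(* [e4 |-> e4 + p] is the commutator of [e3 |-> e3 + p] and [e4 |-> e4 + e3]. *)
Lemma orbit_invariant_e4_P0 (s : {linear R^o -> P0}) :
  orbit_invariant (@gen2 None (Some ord_max) s).
Proof.
pose A := @gen2 None (Some ord0) s.
pose B : {linear stab 2 -> stab 2} := transvection (1 *: e3) (@snd (stab 1) R^o).
have hA : orbit_invariant A by exact: orbit_invariant_low.
have hB : orbit_invariant B by exact: orbit_invariant_e4_e3.
have [A' [AK A'K]] := linear_inverse hA.1.
have [B' [BK B'K]] := linear_inverse hB.1.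
have hA' := orbit_invariant_inverse hA AK A'K.
have hB' := orbit_invariant_inverse hB BK B'K.
have -> : @gen2 None (Some ord_max) s = A \o (B \o (A' \o B')) :> {linear _ -> _}.
  apply: linear_ext => x.
  suff e y : @gen2 None (Some ord_max) s (B (A y)) = A (B y).
    by have := e (A' (B' x)); rewrite A'K B'K.
  case: y => [[p c] d]; apply: injective_projections; last first.
    by rewrite /gen2 /= !(scaler0, addr0).
  apply: injective_projections; rewrite /gen2 /= !(scaler0, addr0, scale1r, scale_regular1) //.
  by rewrite (linD s) addrA.
apply: orbit_invariant_comp => //; apply: orbit_invariant_comp => //.
exact: orbit_invariant_comp.
Qed.

Lemma orbit_invariant_gen (i j : option 'I_2) (s : {linear summand P0 j -> summand P0 i}) :
  i <> j -> orbit_invariant (gen2 s).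
Proof.
move=> ij.
have inP (l : option 'I_2) : [\/ l = None, l = Some ord0 | l = Some ord_max].
  case: l => [[[|[|//]] h]|]; [constructor 2|constructor 3|by constructor 1];
    by congr Some; apply/val_inj.
case: (inP i) s ij => -> s ij; case: (inP j) s ij => -> s ij //.
- exact: orbit_invariant_low.
- exact: orbit_invariant_e4_P0.
- exact: orbit_invariant_low.
- have sE : gen2 s
      =1 transvection ((s 1 : R) *: e3) (@snd (stab 1) R^o).
    move=> x; rewrite transvectionE /gen2 /= -[x.2 in LHS]scale_regular1 (linZ s).
    congr (x + _); apply: injective_projections; last by rewrite /= !scaler0.
    apply: injective_projections; first by rewrite /= !scaler0.
    by rewrite /= scale_regular1.
  by rewrite (linear_ext sE); exact: orbit_invariant_e4_e3.
- exact: orbit_invariant_high.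
- exact: orbit_invariant_high.
Qed.

Lemma Estab_orbit_invariant (eps : {linear stab 2 -> stab 2}) :
  Estab eps -> orbit_invariant eps.
Proof.
elim=> {eps} [i j s ij||f g _ hf _ hg|f g _ h K K'].
- exact: orbit_invariant_gen.
- split; first by exists idfun.
  by move=> chi; exists idfun => //; exact: Egen_id.
- exact: orbit_invariant_comp.
- exact: orbit_invariant_inverse h K K'.
Qed.

End Orbit.
End Descent.

(** * Multilinear algebra in rank two *)

Section Local.
Variable R : comPzRingType.
Add Ring RR : (rring_theory R).
Ltac rring := ring_over R (rring_theory R).

Definition ideal (I : set R) : Prop :=
  [/\ I 0, forall x y, I x -> I y -> I (x + y) & forall a x, I x -> I (a * x)].

Lemma exists_prime (I : set R) : ideal I -> ~ I 1 ->
  exists2 p, prime_ideal p & forall x, I x -> p x.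
Proof.
move=> idI I1.
(* [Zorn_bigcup] applies to the union of the empty chain too, hence [set0]. *)
pose P (X : set R) := X = set0 \/ [/\ ideal X, forall x, I x -> X x & ~ X 1].
have mem X x : P X -> X x -> [/\ ideal X, forall x, I x -> X x & ~ X 1].
  by case=> // ->.
have [|A [PA Amax]] := @Zorn_bigcup R P.
  move=> F FP Ftot; case: (pselect (exists X x, F X /\ X x)) => [[X0 [x0 [FX0 x0X]]]|no].
    right; have [[X00 XD XM] IX X1] := mem _ _ (FP _ FX0) x0X; split.
    - split; first by exists X0.
        move=> x y [X FX Xx] [Y FY Yy].
        have [XY|YX] := Ftot _ _ FX FY.
          by exists Y => //; have [[_ h _] _ _] := mem _ _ (FP _ FY) Yy; apply: h => //; exact: XY.
        by exists X => //; have [[_ h _] _ _] := mem _ _ (FP _ FX) Xx; apply: h => //; exact: YX.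
      move=> a x [X FX Xx]; exists X => //.
      by have [[_ _ h] _ _] := mem _ _ (FP _ FX) Xx; exact: h.
    - by move=> x Ix; exists X0 => //; exact: IX.
    - by case=> X FX X1'; have [_ _] := mem _ _ (FP _ FX) X1'.
  left; apply/seteqP; split=> // x [X FX Xx]; case: no; by exists X, x.
have [A0|[[A0 AD AM] IA A1]] := PA.
  case: (Amax I); last by right.
  rewrite A0; split=> // h; have [I0 _ _] := idI; exact: (h 0 I0).
exists A => //; split=> // x y Axy; apply: contrapT => /not_orP [nx ny].
have key z : ~ A z -> exists a r, A a /\ 1 = a + r * z.
  move=> nz; pose B : set R := [set b | exists a r, A a /\ b = a + r * z]%classic.
  have AB : forall b, A b -> B b by move=> b Ab; exists b, 0; split=> //; rring.
  apply: contrapT => B1; apply: (Amax B).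
    by split=> // h; apply: nz; apply: h; exists 0, 1; split=> //; rring.
  right; split=> //; last by move=> b /IA /AB.
  split; first exact: AB.
    move=> _ _ [b [r [Ab ->]]] [c [t [Ac ->]]]; exists (b + c), (r + t).
    by split; [exact: AD|rring].
  move=> d _ [b [r [Ab ->]]]; exists (d * b), (d * r).
  by split; [exact: AM|rring].
have [a [r [Aa e1]]] := key _ nx; have [b [t [Ab e2]]] := key _ ny.
apply: A1; have -> : 1 = (b + t * y) * a + (r * x * b + r * t * (x * y)) :> R.
  transitivity ((a + r * x) * (b + t * y)); last by rring.
  by rewrite -e1 -e2 mulr1.
by apply: (AD); [exact: AM|apply: (AD); exact: AM].
Qed.

Lemma local_zero (M : lmodType R) (m : M) :
  (forall p : set R, prime_ideal p -> exists s, ~ p s /\ s *: m = 0) -> m = 0.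
Proof.
move=> h; rewrite -[m]scale1r; apply: contrapT => m0.
have idI : ideal [set s | s *: m = 0]%classic.
  split=> [|x y /= hx hy|a x /= hx] /=; first by rewrite scale0r.
    by rewrite scalerDl hx hy addr0.
  by rewrite -scalerA hx scaler0.
have [p hp Ip] := exists_prime idI m0.
by have [s [ps sm]] := h p hp; apply: ps; exact: Ip.
Qed.
End Local.

Section Trilinear.
Variables (R : comPzRingType) (M N : lmodType R).

Definition trilinear_alternating (T : M -> M -> M -> N) : Prop :=
  [/\ forall c x x' y z, T (c *: x + x') y z = c *: T x y z + T x' y z,
      forall c x y y' z, T x (c *: y + y') z = c *: T x y z + T x y' z,
      forall c x y z z', T x y (c *: z + z') = c *: T x y z + T x y z',
      forall x y, T x x y = 0 & (forall x y, T x y y = 0) /\ forall x y, T x y x = 0].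

Definition bilinear_alternating (B : M -> M -> N) : Prop :=
  [/\ forall c x x' y, B (c *: x + x') y = c *: B x y + B x' y,
      forall c x y y', B x (c *: y + y') = c *: B x y + B x y' &
      forall x, B x x = 0].

Section Theory.
Variable T : M -> M -> M -> N.
Hypothesis hT : trilinear_alternating T.

Lemma tri_D1 x x' y z : T (x + x') y z = T x y z + T x' y z.
Proof. by case: hT => h _ _ _ _; have := h 1 x x' y z; rewrite !scale1r. Qed.
Lemma tri_D2 x y y' z : T x (y + y') z = T x y z + T x y' z.
Proof. by case: hT => _ h _ _ _; have := h 1 x y y' z; rewrite !scale1r. Qed.
Lemma tri_D3 x y z z' : T x y (z + z') = T x y z + T x y z'.
Proof. by case: hT => _ _ h _ _; have := h 1 x y z z'; rewrite !scale1r. Qed.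
Lemma tri_01 y z : T 0 y z = 0.
Proof. by apply: (addIr (T 0 y z)); rewrite -tri_D1 !add0r. Qed.
Lemma tri_02 y z : T y 0 z = 0.
Proof. by apply: (addIr (T y 0 z)); rewrite -tri_D2 !add0r. Qed.
Lemma tri_03 y z : T y z 0 = 0.
Proof. by apply: (addIr (T y z 0)); rewrite -tri_D3 !add0r. Qed.
Lemma tri_Z1 c x y z : T (c *: x) y z = c *: T x y z.
Proof. by case: hT => h _ _ _ _; have := h c x 0 y z; rewrite tri_01 !addr0. Qed.
Lemma tri_Z2 c x y z : T x (c *: y) z = c *: T x y z.
Proof. by case: hT => _ h _ _ _; have := h c x y 0 z; rewrite tri_02 !addr0. Qed.
Lemma tri_Z3 c x y z : T x y (c *: z) = c *: T x y z.
Proof. by case: hT => _ _ h _ _; have := h c x y z 0; rewrite tri_03 !addr0. Qed.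
Lemma tri_xxy x y : T x x y = 0. Proof. by case: hT. Qed.
Lemma tri_xyy x y : T x y y = 0. Proof. by case: hT => _ _ _ _ []. Qed.
Lemma tri_xyx x y : T x y x = 0. Proof. by case: hT => _ _ _ _ []. Qed.
Lemma tri_swap12 x y z : T x y z = - T y x z.
Proof.
apply/eqP; rewrite -addr_eq0; apply/eqP.
by have := tri_xxy (x + y) z; rewrite tri_D1 !tri_D2 !tri_xxy add0r addr0.
Qed.
Lemma tri_swap23 x y z : T x y z = - T x z y.
Proof.
apply/eqP; rewrite -addr_eq0; apply/eqP.
by have := tri_xyy x (y + z); rewrite tri_D2 !tri_D3 !tri_xyy add0r addr0.
Qed.

(** At each prime, multipliers outside it make the three vectors combinations of the same two
    elements, where every term repeats an argument. *)
Lemma tri_vanish : constant_rank 2 M -> forall x y z, T x y z = 0.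
Proof.
move=> rk x y z; apply: local_zero => p hp; have [b [bspan _]] := rk p hp.
have [s [c [ps sE]]] := bspan x; have [t [d [pt tE]]] := bspan y.
have [u [e [pu uE]]] := bspan z.
exists (u * (t * s)); split.
  by case: hp => _ _ _ _ hp /hp[//|/hp[]].
rewrite -!scalerA -tri_Z1 -tri_Z2 -tri_Z3 sE tE uE !big_ord_recl !big_ord0 !addr0.
rewrite !(tri_D1, tri_D2, tri_D3, tri_Z1, tri_Z2, tri_Z3, tri_xxy, tri_xyy, tri_xyx).
by rewrite !scaler0 !addr0.
Qed.
End Theory.
End Trilinear.

(** * Exterior powers in degrees two and three *)

Section Exterior.
Variable R : comPzRingType.
Implicit Types M N : lmodType R.

Lemma wedge_alternating M k : alternating_map (fun t : {ffun 'I_k -> M} => wedge t).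
Proof.
have wE (t : {ffun 'I_k -> M}) : wedge t = ext_class [:: (1, t)].
  by rewrite /wedge; congr (ext_class [:: (1, _)]); apply/ffunP => i; rewrite ffunE.
split=> [t i x y|t i c x|t i j ij tij]; rewrite !wE.
- rewrite [RHS](ext_addE [:: _] [:: _]); apply/ext_classP; exact: ext_argD.
- rewrite [RHS](ext_scaleE _ [:: _]) /= mulr1 -{2}[c]mul1r.
  by apply/ext_classP; exact: ext_argZ.
- by apply/ext_classP; exact: ext_alt ij tij.
Qed.

Lemma eq_wedge M k (f g : 'I_k -> M) : f =1 g -> wedge f = wedge g.
Proof.
by move=> fg; rewrite /wedge; congr (ext_class [:: (1, _)]); apply/ffunP => i; rewrite !ffunE.
Qed.

Lemma ext_span M k (P : exterior M k -> Prop) :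
  P 0 -> (forall u v, P u -> P v -> P (u + v)) -> (forall c t, P (c *: wedge t)) ->
  forall w, P w.
Proof.
move=> P0 PD PZ w; elim/ext_ind: w; elim=> [//|[r t] l IH].
have -> : ext_class ((r, t) :: l) = r *: wedge t + ext_class l.
  rewrite [r *: _](ext_scaleE _ [:: _]) [RHS](ext_addE [:: _]) /= mulr1.
  by congr (ext_class ((r, _) :: l)); apply/ffunP => i; rewrite ffunE.
exact: PD.
Qed.

Lemma wedge2_bilinear M : bilinear_alternating (@wedge2 R M).
Proof.
have [wD wZ w0] := wedge_alternating M 2.
have e1 (x y : M) : wedge2 x y = wedge (upd [ffun i => if i == ord0 then 0 else y] ord0 x).
  by apply: eq_wedge => i; rewrite !ffunE; case: eqP.
have e2 (x y : M) : wedge2 x y = wedge (upd [ffun i => if i == ord0 then x else 0] ord_max y).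
  by apply: eq_wedge => -[[|[|//]] h]; rewrite !ffunE.
split=> [c x x' y|c x y y'|x].
- by rewrite !e1 wD wZ.
- by rewrite !e2 wD wZ.
- rewrite /wedge2 -(w0 [ffun=> x] ord0 ord_max) //; last by rewrite !ffunE.
  by apply: eq_wedge => i; rewrite ffunE; case: ifP.
Qed.

(** Indexed through [unlift ord_max] as in [wedge_right_fun], so that the two are compared entry by
    entry. *)
Definition wedge3 M (x y z : M) : exterior M 3 :=
  wedge (fun i : 'I_3 => if unlift ord_max i is Some j then (if j == ord0 then x else y) else z).

Lemma wedge3E M (x y z : M) :
  wedge3 x y z = wedge (fun i : 'I_3 => nth 0 [:: x; y; z] i).
Proof.
apply: eq_wedge => i; case: unliftP => [j ->|-> //].
by case: j => [[|[|//]] h].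
Qed.

Lemma wedge3_trilinear M : trilinear_alternating (@wedge3 M).
Proof.
have [wD wZ w0] := wedge_alternating M 3.
pose i0 : 'I_3 := Ordinal (isT : 0 < 3)%N.
pose i1 : 'I_3 := Ordinal (isT : 1 < 3)%N.
pose i2 : 'I_3 := Ordinal (isT : 2 < 3)%N.
have e1 (x y z : M) : wedge3 x y z = wedge (upd [ffun i : 'I_3 => nth 0 [:: 0; y; z] i] i0 x).
  by rewrite wedge3E; apply: eq_wedge => -[[|[|[|//]]] h]; rewrite !ffunE.
have e2 (x y z : M) : wedge3 x y z = wedge (upd [ffun i : 'I_3 => nth 0 [:: x; 0; z] i] i1 y).
  by rewrite wedge3E; apply: eq_wedge => -[[|[|[|//]]] h]; rewrite !ffunE.
have e3 (x y z : M) : wedge3 x y z = wedge (upd [ffun i : 'I_3 => nth 0 [:: x; y; 0] i] i2 z).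
  by rewrite wedge3E; apply: eq_wedge => -[[|[|[|//]]] h]; rewrite !ffunE.
have w0' (x y z : M) (i j : 'I_3) : i != j ->
    nth 0 [:: x; y; z] i = nth 0 [:: x; y; z] j -> wedge3 x y z = 0.
  move=> ij e; rewrite wedge3E -(w0 [ffun l : 'I_3 => nth 0 [:: x; y; z] l] i j) //.
    by apply: eq_wedge => l; rewrite ffunE.
  by rewrite !ffunE.
split=> [c x x' y z|c x y y' z|c x y z z'|x y|].
- by rewrite !e1 wD wZ.
- by rewrite !e2 wD wZ.
- by rewrite !e3 wD wZ.
- exact: (w0' _ _ _ i0 i1).
- by split=> x y; [exact: (w0' _ _ _ i1 i2)|exact: (w0' _ _ _ i0 i2)].
Qed.

Lemma wedge_right_wedge2 M N (g : {linear M -> N}) v x y :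
  wedge_right 2 g v (wedge2 x y) = wedge3 (g x) (g y) v.
Proof.
pose t : {ffun 'I_2 -> M} := [ffun i => if i == ord0 then x else y].
have -> : wedge2 x y = wedge t by apply: eq_wedge => i; rewrite ffunE.
rewrite [LHS]ext_lift_wedge; apply: eq_wedge => i.
by case: unliftP => // j _; rewrite ffunE; case: ifP.
Qed.

Lemma bilinear_lift M N (B : M -> M -> N) : bilinear_alternating B ->
  exists f : {linear exterior M 2 -> N}, forall x y, f (wedge2 x y) = B x y.
Proof.
move=> [B1 B2 B0].
have BZ1 c x y : B (c *: x) y = c *: B x y.
  have B0y : B 0 y = 0.
    by apply: (addIr (B 0 y)); have := B1 1 0 0 y; rewrite !scale1r !add0r.
  by have := B1 c x 0 y; rewrite B0y !addr0.
have BZ2 c x y : B x (c *: y) = c *: B x y.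
  have B0x : B x 0 = 0.
    by apply: (addIr (B x 0)); have := B2 1 x 0 0; rewrite !scale1r !add0r.
  by have := B2 c x y 0; rewrite B0x !addr0.
have alt : alternating_map (fun t : {ffun 'I_2 -> M} => B (t ord0) (t ord_max)).
  split=> [t [[|[|//]] h] x y|t [[|[|//]] h] c x|t i j ij tij]; rewrite ?ffunE //=.
  - by have := B1 1 x y (t ord_max); rewrite !scale1r.
  - by have := B2 1 (t ord0) x y; rewrite !scale1r.
  - have iE (l : 'I_2) : l = ord0 \/ l = ord_max.
      by case: l => [[|[|//]] h]; [left|right]; apply/val_inj.
    by move: ij tij; case: (iE i) => ->; case: (iE j) => -> // _ e; rewrite e.
exists (ext_lift alt) => x y.
pose t : {ffun 'I_2 -> M} := [ffun i => if i == ord0 then x else y].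
have -> : wedge2 x y = wedge t by apply: eq_wedge => i; rewrite ffunE.
by rewrite [LHS]ext_lift_wedge !ffunE.
Qed.

Lemma trilinear_lift M N (T : M -> M -> M -> N) : trilinear_alternating T ->
  exists f : {linear exterior M 3 -> N}, forall x y z, f (wedge3 x y z) = T x y z.
Proof.
move=> hT.
pose i0 : 'I_3 := Ordinal (isT : 0 < 3)%N.
pose i1 : 'I_3 := Ordinal (isT : 1 < 3)%N.
pose i2 : 'I_3 := Ordinal (isT : 2 < 3)%N.
have alt : alternating_map (fun t : {ffun 'I_3 -> M} => T (t i0) (t i1) (t i2)).
  split=> [t [[|[|[|//]]] h] x y|t [[|[|[|//]]] h] c x|t i j ij tij]; rewrite ?ffunE //=.
  - exact: tri_D1.
  - exact: tri_D2.
  - exact: tri_D3.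
  - exact: tri_Z1.
  - exact: tri_Z2.
  - exact: tri_Z3.
  - wlog ltij : i j ij tij / (i < j)%N.
      move=> w; case: (ltngtP i j) => [|ji|e]; first exact: w.
        by apply: w ji => //; rewrite eq_sym.
      by move: ij; rewrite (val_inj e) eqxx.
    have iE (l : 'I_3) : [\/ l = i0, l = i1 | l = i2].
      by case: l => [[|[|[|//]]] h]; [constructor 1|constructor 2|constructor 3]; apply/val_inj.
    move: ij tij ltij; case: (iE i) => ->; case: (iE j) => -> // _ e _; rewrite e.
    + exact: tri_xxy.
    + exact: tri_xyx.
    + exact: tri_xyy.
exists (ext_lift alt) => x y z.
pose t : {ffun 'I_3 -> M} := [ffun i : 'I_3 => nth 0 [:: x; y; z] i].
have -> : wedge3 x y z = wedge t by rewrite wedge3E; apply: eq_wedge => i; rewrite ffunE.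
by rewrite [LHS]ext_lift_wedge !ffunE.
Qed.
End Exterior.

Section Contraction.
Variables (R : comPzRingType) (M N : lmodType R) (l : {linear M -> R^o}).
Variable B : M -> M -> N.
Add Ring TN : (text_ring_theory N).
Hypothesis hB : bilinear_alternating B.

Lemma contraction_trilinear : trilinear_alternating
  (fun x y z => (l z : R) *: B x y + (l x : R) *: B y z + (l y : R) *: B z x).
Proof.
case: hB => B1 B2 B0.
have BC x y : B x y = - B y x.
  have := B0 (1 *: x + y); rewrite B1 !B2 !B0 => h.
  apply/eqP; rewrite -addr_eq0; apply/eqP; rewrite -h; lmod_over R N.
split=> [c u u' v w|c u v v' w|c u v w w'|u v|].
- by rewrite linD lfZ B1 B2; lmod_over R N.
- by rewrite linD lfZ B1 B2; lmod_over R N.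
- by rewrite linD lfZ B1 B2; lmod_over R N.
- by rewrite B0 (BC v u); lmod_over R N.
- by split=> u v; rewrite B0 (BC v u); lmod_over R N.
Qed.
End Contraction.

(** * The volume form of [P0 + R] and the form on a kernel *)

Section RankTwo.
Variables (R : comPzRingType) (P0 : lmodType R).
Add Ring RR : (rring_theory R).
Ltac rring := ring_over R (rring_theory R).
Add Ring TP0 : (text_ring_theory P0).
Hypothesis hrk : constant_rank 2 P0.
Variables (theta0 : {linear R^o -> exterior P0 2}).
Hypothesis htheta0 : bijective theta0.
Local Notation X := (chi0 theta0).
Implicit Types N : lmodType R.
Local Notation P3 := (P0 * R^o)%type.

Lemma theta0_chi0 p q : theta0 (X p q) = wedge2 p q.
Proof.
have [t _ tK] := htheta0.
apply: (@xgetPex _ 0 [set r | theta0 r = wedge2 p q]%classic); exists (t (wedge2 p q)).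
exact: tK.
Qed.

Lemma chi0_bilinear : bilinear_alternating (X : P0 -> P0 -> R^o).
Proof.
have [t tK _] := htheta0; have inj := can_inj tK; have [w1 w2 w0] := wedge2_bilinear P0.
by split=> *; apply: inj; rewrite ?linD ?linZ ?lin0 !theta0_chi0.
Qed.

Lemma bilinear_chi0 N (B : P0 -> P0 -> N) : bilinear_alternating B ->
  exists n, forall p q, B p q = X p q *: n.
Proof.
move=> /bilinear_lift[f fE]; exists (f (theta0 1)) => p q.
by rewrite -fE -theta0_chi0 -[X p q in LHS]scale_regular1 !linZ.
Qed.

(** Stands in for a basis of [P0]: the generator [theta0 1] of the determinant is a finite sum of
    wedges, the coefficients being absorbed in the first argument. *)
Lemma chi0_unit : exists s : seq (P0 * P0), \sum_(p <- s) X p.1 p.2 = 1.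
Proof.
have [w1 w2 w0] := wedge2_bilinear P0.
have key (w : exterior P0 2) : exists s : seq (P0 * P0), w = \sum_(p <- s) wedge2 p.1 p.2.
  elim/ext_span: w => [|u v [s ->] [t ->]|c t].
  - by exists [::]; rewrite big_nil.
  - by exists (s ++ t); rewrite big_cat.
  exists [:: (c *: t ord0, t ord_max)]; rewrite big_seq1 /=.
  have := w1 c (t ord0) 0 (t ord_max).
  have -> : wedge2 0 (t ord_max) = 0.
    by apply: (addIr (wedge2 0 (t ord_max))); have := w1 1 0 0 (t ord_max); rewrite !scale1r !add0r.
  rewrite !addr0 => ->; congr (_ *: _); apply: eq_wedge => -[[|[|//]] h] /=.
    by congr (t _); apply/val_inj.
  by congr (t _); apply/val_inj.
have [t tK _] := htheta0; have [s sE] := key (theta0 1).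
exists s; apply: (can_inj tK); rewrite sE linear_sum.
by apply: eq_bigr => p _; exact: theta0_chi0.
Qed.

Lemma chi0Pl c x x' y : X (c *: x + x') y = c * X x y + X x' y.
Proof. by case: chi0_bilinear => h _ _; exact: h. Qed.

Lemma chi0Pr c x y y' : X x (c *: y + y') = c * X x y + X x y'.
Proof. by case: chi0_bilinear => _ h _; exact: h. Qed.

Lemma chi0xx x : X x x = 0. Proof. by case: chi0_bilinear. Qed.

Lemma chi0C x y : X x y = - X y x.
Proof.
have := chi0xx (1 *: x + y); rewrite chi0Pl !chi0Pr !chi0xx => h.
apply/eqP; rewrite -addr_eq0; apply/eqP; rewrite -h; rring.
Qed.

(** The cyclic sum is trilinear and alternating on a module of rank two. *)
Lemma plucker (x y z : P0) : X x y *: z + X y z *: x + X z x *: y = 0.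
Proof.
suff h : trilinear_alternating (fun x y z => X x y *: z + X y z *: x + X z x *: y).
  exact: tri_vanish h hrk x y z.
split=> [c u u' v w|c u v v' w|c u v w w'|u v|].
- by rewrite chi0Pl chi0Pr; lmod_over R P0.
- by rewrite chi0Pl chi0Pr; lmod_over R P0.
- by rewrite chi0Pl chi0Pr; lmod_over R P0.
- by rewrite chi0xx (chi0C v u); lmod_over R P0.
- split=> u v; rewrite chi0xx (chi0C v u); lmod_over R P0.
Qed.

Lemma plucker_functional (l : {linear P0 -> R^o}) x y z :
  X x y * l z + X y z * l x + X z x * l y = 0.
Proof. by have := congr1 l (plucker x y z); rewrite !linD !linZ lin0. Qed.

Lemma chi0_is_alternating_iso : is_alternating_iso X.
Proof.
have [s sE] := chi0_unit.
(* The Pluecker relation, summed over [s], yields a dual basis expressed through [X]. *)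
have dec z : z = \sum_(p <- s) (X z p.2 *: p.1 + X p.1 z *: p.2).
  rewrite -[LHS]scale1r -sE scaler_suml; apply: eq_bigr => p _.
  have := plucker p.1 p.2 z => h.
  transitivity (X p.1 p.2 *: z - (X p.1 p.2 *: z + X p.2 z *: p.1 + X z p.1 *: p.2)).
    by rewrite h subr0.
  rewrite (chi0C p.1 z) (chi0C p.2 z); lmod_over R P0.
have Xl q : linear (fun p => X p q : R^o) by move=> c x y; exact: chi0Pl.
have Xr q : linear (fun p => X q p : R^o) by move=> c x y; exact: chi0Pr.
apply: alternating_isoI => //.
- exact: chi0xx.
- exact: chi0C.
- move=> l; exists (\sum_(p <- s) ((l p.1 : R) *: p.2 - (l p.2 : R) *: p.1)) => z.
  rewrite {2}(dec z) linear_sum -[LHS]/(Lin (Xr z) _) linear_sum.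
  apply: eq_bigr => p _; rewrite linD linN !linZ /= (linD l) !(lfZ l) (chi0C z p.1).
  rring.
- move=> q hq; rewrite (dec q) big1 // => p _.
  by rewrite hq (chi0C q) hq oppr0 !scale0r addr0.
Qed.
Definition chi0_iso : alternating_iso P0 := AlternatingIso chi0_is_alternating_iso.

(* [x /\ y /\ z = theta0 (tau x y z) /\ e_3] *)
Definition tau (x y z : P3) : R :=
  (x.2 : R) * X y.1 z.1 + (y.2 : R) * X z.1 x.1 + (z.2 : R) * X x.1 y.1.

Lemma tau_trilinear : trilinear_alternating (tau : P3 -> P3 -> P3 -> R^o).
Proof.
rewrite /tau; split=> [c u u' v w|c u v v' w|c u v w w'|u v|] /=.
- by rewrite chi0Pl chi0Pr; rring.
- by rewrite chi0Pl chi0Pr; rring.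
- by rewrite chi0Pl chi0Pr; rring.
- by rewrite chi0xx (chi0C v.1 u.1); rring.
- by split=> u v; rewrite chi0xx (chi0C v.1 u.1); rring.
Qed.

Lemma tau_cyclic x y z : tau x y z = tau y z x.
Proof. by rewrite /tau; rring. Qed.

(* Both sides are the expansion of [a] along a vanishing [4 * 4] determinant. *)
Lemma tau_expansion (a : {linear P3 -> R^o}) x y z w :
  (a w : R) * tau x y z = (a x : R) * tau w y z + (a y : R) * tau x w z + (a z : R) * tau x y w.
Proof.
pose l : {linear P0 -> R^o} := a \o @in1 R P0 R^o.
pose a3 : R := a (0, 1 : R^o).
have aE (v : P3) : a v = (l v.1 : R) + (v.2 : R) * a3.
  rewrite /l /a3 /= -[_ * a _](linZ a) -(linD a); congr (a _).
  by case: v => v c; congr pair; rewrite /= ?scaler0 ?addr0 // scale_regular1 add0r.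
have p := plucker_functional l.
rewrite !aE /tau.
have h1 := p y.1 z.1 w.1; have h2 := p z.1 x.1 w.1; have h3 := p x.1 y.1 w.1.
have h4 := p x.1 y.1 z.1.
transitivity ((l x.1 + x.2 * a3) * (w.2 * X y.1 z.1 + y.2 * X z.1 w.1 + z.2 * X w.1 y.1) +
(l y.1 + y.2 * a3) * (x.2 * X w.1 z.1 + w.2 * X z.1 x.1 + z.2 * X x.1 w.1) +
(l z.1 + z.2 * a3) * (x.2 * X y.1 w.1 + y.2 * X w.1 x.1 + w.2 * X x.1 y.1)
  + x.2 * (X y.1 z.1 * l w.1 + X z.1 w.1 * l y.1 + X w.1 y.1 * l z.1)
  + y.2 * (X z.1 x.1 * l w.1 + X x.1 w.1 * l z.1 + X w.1 z.1 * l x.1)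
  + z.2 * (X x.1 y.1 * l w.1 + X y.1 w.1 * l x.1 + X w.1 x.1 * l y.1)
  - w.2 * (X x.1 y.1 * l z.1 + X y.1 z.1 * l x.1 + X z.1 x.1 * l y.1) : R).
  rewrite (chi0C w.1 z.1) (chi0C w.1 y.1) (chi0C w.1 x.1); rring.
by rewrite h1 h2 h3 h4 !mulr0 subr0 !addr0.
Qed.

Definition e_3 : P3 := (0, 1 : R^o).

(** On [P0] alone the map vanishes by rank two, so it is determined by its values with [e_3] as one
    argument; these are alternating bilinear on [P0], hence a multiple of [chi0]. *)
Lemma trilinear_tau N (T : P3 -> P3 -> P3 -> N) : trilinear_alternating T ->
  exists n, forall x y z, T x y z = tau x y z *: n.
Proof.
move=> hT.
pose i1 : {linear P0 -> P3} := @in1 R P0 R^o.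
have T0 x y z : T (i1 x) (i1 y) (i1 z) = 0.
  apply: (@tri_vanish R P0 N (fun x y z => T (i1 x) (i1 y) (i1 z))) => //.
  split=> [c u u' v w|c u v v' w|c u v w w'|u v|].
  - by rewrite /= (linD i1) (linZ i1) (tri_D1 hT) (tri_Z1 hT).
  - by rewrite /= (linD i1) (linZ i1) (tri_D2 hT) (tri_Z2 hT).
  - by rewrite /= (linD i1) (linZ i1) (tri_D3 hT) (tri_Z3 hT).
  - exact: tri_xxy.
  - by split=> u v; [exact: tri_xyy|exact: tri_xyx].
have [|n nE] := @bilinear_chi0 N (fun x y => T (i1 x) (i1 y) e_3).
  split=> [c u u' v|c u v v'|u].
  - by rewrite /= (linD i1) (linZ i1) (tri_D1 hT) (tri_Z1 hT).
  - by rewrite /= (linD i1) (linZ i1) (tri_D2 hT) (tri_Z2 hT).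
  - exact: tri_xxy.
exists n => x y z.
have dec (v : P3) : v = i1 v.1 + (v.2 : R) *: e_3.
  by case: v => v c; congr pair; rewrite /= ?scaler0 ?addr0 // scale_regular1 add0r.
have T2 (u v : P0) : T (i1 u) e_3 (i1 v) = (- X u v) *: n.
  by rewrite (tri_swap23 hT) nE scaleNr.
have T1 (u v : P0) : T e_3 (i1 u) (i1 v) = X u v *: n.
  by rewrite (tri_swap12 hT) T2 scaleNr opprK.
rewrite (dec x) (dec y) (dec z) !(tri_D1 hT, tri_D2 hT, tri_D3 hT).
rewrite !(tri_Z1 hT, tri_Z2 hT, tri_Z3 hT) !(tri_xxy hT, tri_xyy hT, tri_xyx hT) T0 nE T1 T2.
rewrite -(dec x) -(dec y) -(dec z) !scaler0 !addr0 add0r !scalerA -!scalerDl /tau.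
congr (_ *: _); rewrite (chi0C z.1 x.1); rring.
Qed.

Section Unimodular.
Variables (a : {linear P3 -> R^o}) (s : {linear R^o -> P3}).
Hypothesis hs : forall r, a (s r) = r.
Let sigma : P3 := s 1.

Lemma section_scale r : s r = (r : R) *: sigma.
Proof. by rewrite -linZ scale_regular1. Qed.

Definition proj (x : P3) : kernel a := Kernel (section_proj_subproof hs x).
Lemma proj_linear : linear proj.
Proof.
by move=> c x y; apply/val_inj; exact: (sub_comp_linear s a c x y).
Qed.
Definition projL : {linear P3 -> kernel a} := Lin proj_linear.

Lemma kernel_eq0 (p : kernel a) : a (kernel_val p) = 0.
Proof. by apply/eqP; have := kernel_valP p; rewrite inE. Qed.

Lemma projK (p : kernel a) : proj (kernel_val p) = p.
Proof. by apply/val_inj; rewrite /= kernel_eq0 lin0 subr0. Qed.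

Lemma tau_proj x y : tau (kernel_val (proj x)) (kernel_val (proj y)) sigma = tau x y sigma.
Proof.
have h := tau_trilinear.
rewrite /= !section_scale -!scaleNr (tri_D1 h) !(tri_D2 h) !(tri_Z1 h) !(tri_Z2 h).
by rewrite !(tri_xxy h, tri_xyy h, tri_xyx h) !scaler0 !addr0.
Qed.

Let E : exterior P3 3 := wedge_e3 P0 (theta0 1).

Lemma wedge3_tau x y z : wedge3 x y z = tau x y z *: E.
Proof.
have [n nE] := trilinear_tau (wedge3_trilinear P3); rewrite nE; congr (_ *: _).
have [l lE] := chi0_unit; rewrite /E.
have -> : theta0 1 = \sum_(p <- l) wedge2 p.1 p.2.
  rewrite -lE linear_sum; apply: eq_bigr => p _; exact: theta0_chi0.
rewrite /wedge_e3 linear_sum -[n in LHS]scale1r -[X in X *: n]lE scaler_suml; apply: eq_bigr => p _.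
rewrite wedge_right_wedge2 nE /tau /=; congr (_ *: _); rring.
Qed.

(** [tau] factors through the third exterior power, and the induced functional takes [E] to [1]. *)
Lemma E_scale_inj c d : c *: E = d *: E -> c = d.
Proof.
have [f fE] := trilinear_lift tau_trilinear; have [l lE] := chi0_unit.
have f1 : f E = 1.
  have {1}-> : E = \sum_(p <- l) wedge3 (in1 R^o p.1) (in1 R^o p.2) e_3.
    rewrite -[LHS]scale1r -lE scaler_suml; apply: eq_bigr => p _.
    rewrite wedge3_tau /tau /=; congr (_ *: _); rring.
  rewrite linear_sum -lE; apply: eq_bigr => p _; rewrite fE /tau /=; rring.
by move/(congr1 f); rewrite !(linZ f) f1 !scale_regular1.
Qed.

(** Projecting to the kernel, wedging there and multiplying by [a] gives an alternating trilinear
    map on [P3], hence [tau] times some [n]. This [n] generates the second exterior power of the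
    kernel and [wedge_s] carries it to [E], so [theta d] is [d *: n]. *)
Lemma chi_aE (p q : kernel a) : chi_a theta0 s p q = tau (kernel_val p) (kernel_val q) sigma.
Proof.
have [w1 w2 w0] := wedge2_bilinear (kernel a).
have hB : bilinear_alternating (fun x y => wedge2 (projL x) (projL y)).
  by split=> [c x x' y|c x y y'|x]; rewrite ?linD ?linZ ?w1 ?w2 ?w0.
have hT := contraction_trilinear a hB.
have [n nE] := trilinear_tau hT.
have w2n u v : wedge2 u v = tau (kernel_val u) (kernel_val v) sigma *: n.
  rewrite -nE /= !kernel_eq0 !scale0r !addr0 [a sigma]hs scale1r.
  by rewrite !projK.
have wsE u v : @wedge_s R P0 a s (wedge2 u v) = tau (kernel_val u) (kernel_val v) sigma *: E.
  by rewrite wedge_right_wedge2 wedge3_tau.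
have wsn : @wedge_s R P0 a s n = E.
  have [l lE] := chi0_unit.
  have nsum : n = \sum_(p <- l) (tau (in1 R^o p.1) (in1 R^o p.2) e_3 *: n).
    rewrite -scaler_suml -[LHS]scale1r -lE; congr (_ *: _); apply: eq_bigr => r _.
    rewrite /tau /=; rring.
  rewrite nsum linear_sum -[RHS]scale1r -lE scaler_suml; apply: eq_bigr => r _.
  rewrite -nE !linD !linZ !wsE !tau_proj !scalerA -!scalerDl; congr (_ *: _).
  transitivity (tau (in1 R^o r.1) (in1 R^o r.2) e_3); last by rewrite /tau /=; rring.
  have := tau_expansion a (in1 R^o r.1) (in1 R^o r.2) e_3 sigma; rewrite [a sigma]hs mul1r => ->.
  rewrite (tau_cyclic sigma) (tau_cyclic e_3 _ sigma); rring.
have span w : exists c : R, w = c *: n.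
  elim/ext_span: w => [|u v [c ->] [d ->]|c t].
  - by exists 0; rewrite scale0r.
  - by exists (c + d); rewrite scalerDl.
  have -> : wedge t = wedge2 (t ord0) (t ord_max).
    by apply: eq_wedge => -[[|[|//]] h] /=; congr (t _); apply/val_inj.
  by rewrite w2n scalerA; eexists.
have thetaE d : @theta R P0 theta0 a s d = d *: n.
  apply: xget_unique => [|w] /=.
    rewrite linZ wsn /E -linZ -linZ; congr (wedge_e3 _ (theta0 _)); exact: mulr1.
  have [c ->] := span w; rewrite linZ wsn /E -[d]scale_regular1 linZ linZ => /E_scale_inj ->.
  by rewrite scale_regular1.
apply: xget_unique => [|r] /=; first by rewrite thetaE w2n.
rewrite thetaE w2n => /(congr1 (@wedge_s R P0 a s)); rewrite !linZ wsn.
exact: E_scale_inj.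
Qed.

End Unimodular.
End RankTwo.

(** * The forms of the symbol *)

Section VasersteinForm.
Variables (R : comPzRingType) (P0 : lmodType R).
Add Ring RR : (rring_theory R).
Ltac rring := ring_over R (rring_theory R).
Add Ring TP0 : (text_ring_theory P0).
Hypotheses (hP0 : fg_projective P0) (hrk : constant_rank 2 P0).
Variables (theta0 : {linear R^o -> exterior P0 2}).
Hypothesis htheta0 : bijective theta0.
Local Notation P3 := (stab P0 1).
Local Notation P4 := (stab P0 2).
Local Notation X := (chi0_iso hrk htheta0).
Local Notation tau := (tau theta0).
Local Notation e3 := (e_top P0 0).
Local Notation e4 := (e_top P0 1).

Lemma tauE x y z : tau x y z =
  (x.2 : R) * X y.1 z.1 + (y.2 : R) * X z.1 x.1 + (z.2 : R) * X x.1 y.1.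
Proof. by []. Qed.

Lemma plucker_form x y z w : X x y * X w z + X y z * X w x + X z x * X w y = 0.
Proof.
have := congr1 (X w) (plucker hrk htheta0 x y z).
by rewrite ai0r !aiDr !aiZr.
Qed.

(* For a section [s] of [a], [vform a (s 1)] is the last form in the symbol of
   [a]: [chi_a] is the contraction of the volume form [tau] with [s 1]. *)
Definition vform (a : {linear P3 -> R^o}) (w : P3) (x y : P4) : R :=
  tau x.1 y.1 w + ((a x.1 : R) * y.2 - (x.2 : R) * a y.1).

Section Unimodular.
Variables (a : {linear P3 -> R^o}) (w : P3).
Hypothesis aw : a w = 1.

Lemma functional_coordinates (l : {linear P3 -> R^o}) :
  exists l0, forall x, l x = X x.1 l0 + (x.2 : R) * l e3.
Proof.
have [l0 lE] := ai_repr X (l \o @in1 R P0 R^o); exists l0 => x.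
by rewrite lE {1}(stab_coordinates x) linD lfZ.
Qed.

Lemma vform_is_alternating_iso : is_alternating_iso (vform a w).
Proof.
have [a0 aE] := functional_coordinates a; set a3 : R := a e3 in aE.
have k : X w.1 a0 = 1 - a3 * w.2.
  by rewrite -[1 in RHS]aw aE; rring.
have wxC x : X x w.1 = - X w.1 x by exact: aiC.
have vE p1 p2 p4 q1 q2 q4 : vform a w ((p1, p2), p4) ((q1, q2), q4) =
   p2 * X q1 w.1 + q2 * X w.1 p1 + w.2 * X p1 q1 + (X p1 a0 + p2 * a3) * q4 - p4 * (X q1 a0 + q2 * a3).
  by rewrite /vform tauE !aE /=; rring.
apply: alternating_isoI => [q c x y|x|x y|l|q hq].
- case: x y q => [[x1 x2] x4] [[y1 y2] y4] [[q1 q2] q4].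
  rewrite -[c *: (_ : P4) + _]/(((c *: x1 + y1, c * x2 + y2 : R^o), c * x4 + y4 : R^o) : P4).
  by rewrite !vE !aiPl !aiPr; rring.
- case: x => [[x1 x2] x4]; rewrite vE (wxC x1) !aixx; rring.
- case: x y => [[x1 x2] x4] [[y1 y2] y4]; rewrite !vE (wxC x1) (wxC y1) (aiC _ x1 y1); rring.
- have [L lE] := functional_coordinates (l \o @in1 R P3 R^o).
  pose l3 : R := l (in1 R^o e3); pose l4 : R := l e4.
  have {}lE (x : P3) : l (in1 R^o x) = X x.1 L + (x.2 : R) * l3 := lE x.
  (* The solution of the linear system for the vector representing [l]. Checking it comes down to
     [pl], where [k] has brought in the normalisation [a w = 1]. *)
  exists ((a3 *: L - l4 *: w.1 - l3 *: a0, X a0 L - w.2 * l4), X w.1 L + w.2 * l3) => -[[p1 p2] p4].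
  have -> : l ((p1, p2), p4) = X p1 L + p2 * l3 + p4 * l4.
    by rewrite (@stab_coordinates R P0 1 ((p1, p2), p4)) (linD l) (lfZ l) lE.
  have pl := plucker_form w.1 a0 L p1; rewrite k in pl.
  rewrite vE !(aiDl, aiDr, aiNl, aiNr, aiZl, aiZr) !aixx.
  rewrite (wxC a0) (wxC L) k (aiC _ L a0) (aiC _ w.1 p1).
  rewrite -[RHS]subr0 -[X in _ = _ - X]pl (wxC L); rring.
- case: q hq => [[q1 q2] q4] hq.
  have c1 p : q2 * X w.1 p + w.2 * X p q1 + X p a0 * q4 = 0.
    by rewrite -(hq ((p, 0), 0)) vE; rring.
  have c2 : X q1 w.1 + a3 * q4 = 0.
    by rewrite -(hq ((0, 1), 0)) vE !ai0l !ai0r; rring.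
  have c3 : X q1 a0 + q2 * a3 = 0.
    rewrite -[LHS]opprK -[RHS]oppr0; congr (- _).
    by rewrite -(hq ((0, 0), 1)) vE !ai0l !ai0r; rring.
  (* By [k] the factor [X w.1 a0 + a3 * w.2] is [1]. Multiplying a coordinate of [q] by it gives a
     combination of [c1], [c2], [c3] and, for [q1], a Pluecker relation. *)
  have q10 : q1 = 0.
    apply: (@ai_injr _ _ X) => p; rewrite ai0r.
    have pl := plucker_form w.1 a0 q1 p.
    transitivity ((X w.1 a0 + a3 * w.2) * X p q1); first by rewrite k; rring.
    transitivity (X w.1 a0 * X p q1 + X a0 q1 * X p w.1 + X q1 w.1 * X p a0
      + a3 * (q2 * X w.1 p + w.2 * X p q1 + X p a0 * q4)
      - X p a0 * (X q1 w.1 + a3 * q4) + X p w.1 * (X q1 a0 + q2 * a3)).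
      rewrite (aiC _ a0 q1) (aiC _ w.1 p); rring.
    by rewrite pl c1 c2 c3; rring.
  have q20 : q2 = 0.
    transitivity ((X w.1 a0 + a3 * w.2) * q2); first by rewrite k; rring.
    have := c1 a0; have := c3; rewrite q10 ai0l ai0r aixx add0r => c3' c1'.
    transitivity (q2 * X w.1 a0 + w.2 * 0 + 0 * q4 + w.2 * (q2 * a3)); first rring.
    by rewrite c1' c3'; rring.
  have q40 : q4 = 0.
    transitivity ((X w.1 a0 + a3 * w.2) * q4); first by rewrite k; rring.
    have := c1 w.1; have := c2; rewrite q10 ai0l ai0r aixx add0r => c2' c1'.
    transitivity (q2 * 0 + w.2 * 0 + X w.1 a0 * q4 + w.2 * (a3 * q4)); first rring.
    by rewrite c1' c2'; rring.
  by rewrite q10 q20 q40.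
Qed.
Definition vform_iso : alternating_iso P4 := AlternatingIso vform_is_alternating_iso.
End Unimodular.

(** For [d = w' - w] in the kernel of [a], [tau_expansion] gives [tau x y d = a x * tau w y d - a y
    * tau w x d], which is the effect on the form of the elementary shear adding [tau w x d] times
    [e4]. *)
Lemma cl_vform_section (h4 : fg_projective P4) (g : alternating_iso P4)
  (a : {linear P3 -> R^o}) (w w' : P3)  (aw : a w = 1) (aw' : a w' = 1) :
  cl h4 g (vform_iso aw) = cl h4 g (vform_iso aw').
Proof.
rewrite -(cl_chain h4 g (vform_iso aw) (vform_iso aw')).
pose d := w' - w.
have ad : a d = 0 by rewrite linB aw aw' subrr.
have ht := tau_trilinear htheta0.
have ll : linear (fun y => tau w y d : R^o).
  by move=> c x y; case: ht => _ h _ _ _; exact: h.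
pose l := Lin ll.
rewrite (_ : cl h4 (vform_iso aw) _ = Vzero R) ?Vadd0r //.
apply: (cl_Estab h4 (@Estab_transvection_top R P0 1 l)) => -[x c] [y c'].
rewrite [RHS]/= /vform /= !scale_regular1 !(scaler0, addr0) /vform /=.
have := tau_expansion hrk htheta0 a x y d w; rewrite aw ad mul1r.
have -> : tau x y d = tau x y w' - tau x y w.
  by rewrite (tri_D3 ht) -scaleN1r (tri_Z3 ht); rring.
have -> : tau x w d = - tau w x d by exact: (tri_swap12 ht).
move=> e; rewrite -[tau x y w'](subrK (tau x y w)) e /=.
rring.
Qed.

Lemma Vtriple_ofE (M : lmodType R) (hM : fg_projective M) (g f : alternating_iso M) :
  Vtriple_of g f = cl hM g f.
Proof.
rewrite /Vtriple_of; case: pselect => [h|[]]; last by split=> //; split; exact: formP.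
have e (k : alternating_iso M) (hk : is_alternating_iso k) : AlternatingIso hk = k.
  exact: ai_eq.
rewrite !e /cl; congr (Vtriple (Triple _ _ _)); exact: Prop_irrelevance.
Qed.

Lemma vaserstein_cl (h4 : fg_projective P4) (a : {linear P3 -> R^o}) (ha : Um a) :
  exists (w : P3) (aw : a w = 1), vaserstein theta0 ha = cl h4 (stf X) (vform_iso aw).
Proof.
rewrite /vaserstein; case: cid => s hs /=; exists (s 1), (hs 1).
pose inv (x : P0 * (R^o * R^o)) : P4 := ((x.1, x.2.1), x.2.2).
have invl : linear inv by [].
have invb : bijective (Lin invl).
  by exists (@assoc_sum R P0); [move=> [x [c d]]|move=> [[x c] d]].
pose F := pullback invb (vform_iso (hs 1)).
rewrite /vaserstein_section.
rewrite (_ : (fun x y => _) = F); last first.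
  apply/funext => x; apply/funext => y; rewrite /F /= /perp /= chi_aE //.
  rewrite (tau_proj htheta0 hs (x.1, x.2.1) (y.1, y.2.1)).
  by [].
have hM : fg_projective (P0 * (R^o * R^o))%type.
  by do 2?apply: fg_projective_sum => //; exact: fg_projective_regular.
rewrite (_ : perp (chi0 theta0) (psi2 (R := R)) = perp_iso X (psi2_iso R)) //.
rewrite (Vtriple_ofE hM).
by apply: (cl_isometry _ _ invb).
Qed.

(* [u] is the Pfaffian of [chi] relative to [stf X]. *)
Lemma alternating_normal_form (chi : alternating_iso P4) :
  exists (a : {linear P3 -> R^o}) (w : P3) (c d u : R) (q a0 : P0),
  [/\ a w = 1,
      forall x y, chi x y = u * tau x.1 y.1 w + ((a x.1 : R) * y.2 - (x.2 : R) * a y.1),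
      forall x y : P0, chi (in1 R^o (in1 R^o x)) (in1 R^o (in1 R^o y)) = c * X x y,
      forall x, chi (in1 R^o (in1 R^o x)) (in1 R^o e3) = X x q &
      [/\ forall x, chi (in1 R^o (in1 R^o x)) e4 = X x a0,
       chi (in1 R^o e3) e4 = d & u = c * d - X q a0]].
Proof.
have [w [w0 w1]] := alternating_kernel chi.
pose a : {linear P3 -> R^o} := ai_functional chi e4 \o @in1 R P3 R^o.
pose i1 : {linear P0 -> P3} := @in1 R P0 R^o.
pose i2 : {linear P3 -> P4} := @in1 R P3 R^o.
have aw : a w = 1 by [].
have [a0 aE] := functional_coordinates a; pose d : R := a e3.
have hB : bilinear_alternating (fun x y => chi (i2 (i1 x)) (i2 (i1 y)) : R^o).
  split=> [b x x' y|b x y y'|x].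
  - by rewrite (linD i1) (linZ i1) (linD i2) (linZ i2) aiPl.
  - by rewrite (linD i1) (linZ i1) (linD i2) (linZ i2) aiPr.
  - by rewrite aixx.
have [c0 c0E] := bilinear_chi0 htheta0 hB; pose c : R := c0.
have cE x y : chi (i2 (i1 x)) (i2 (i1 y)) = c * X x y by rewrite mulrC; exact: c0E.
have [q qE] := ai_repr X (ai_functional chi (i2 e3) \o i2 \o i1).
have chi3 x y : chi (i2 x) (i2 y) = c * X x.1 y.1 + (y.2 : R) * X x.1 q - (x.2 : R) * X y.1 q.
  have qE' v : chi (i2 (i1 v)) (i2 e3) = X v q by rewrite qE.
  have i2E (v : P3) : i2 v = i2 (i1 v.1) + (v.2 : R) *: i2 e3.
    by rewrite -(linZ i2) -(linD i2); congr (i2 _); exact: stab_coordinates.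
  rewrite (i2E x) (i2E y) !(aiDl, aiDr, aiZl, aiZr) cE aixx (aiC _ (i2 e3)) !qE'.
  rring.
have k : X w.1 a0 + (w.2 : R) * d = 1 by rewrite -aw aE.
have k1 x : c * X x w.1 + w.2 * X x q = 0.
  by rewrite -(w0 (i1 x)) chi3 /=; rring.
have k2 : X w.1 q = 0.
  have := w0 e3; rewrite chi3 (_ : e3.1 = 0) // (_ : e3.2 = 1) // !ai0l => h.
  by rewrite -[LHS]opprK -[RHS]oppr0 -h; rring.
(* By [k1] and [k2], [w] lies in the radical of [chi] restricted to [P_3]. This restriction is
   therefore a multiple of the contraction of [tau] with [w], and [uw2] and [uw1] identify the
   factor as [u]. *)
pose u := c * d - X q a0.
have uw2 : u * w.2 = c.
  transitivity (c * (X w.1 a0 + w.2 * d)); last by rewrite k; rring.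
  rewrite -[LHS]subr0 -(k1 a0) /u (aiC _ a0 w.1) (aiC _ a0 q); rring.
have uw1 x : - (u * X x w.1) = X x q.
  have pl := plucker_form w.1 a0 q x.
  transitivity ((X w.1 a0 + w.2 * d) * X x q - X w.1 q * X x a0); last by rewrite k k2; rring.
  transitivity (- (u * X x w.1) + d * (c * X x w.1 + w.2 * X x q)
    + (X w.1 a0 * X x q + X a0 q * X x w.1 + X q w.1 * X x a0)).
    by rewrite pl k1; rring.
  rewrite /u (aiC _ a0 q) (aiC _ q w.1); rring.
exists a, w, c, d, u, q, a0; split=> //; last by split=> // x; rewrite -[LHS]/(a (i1 x)) aE /= mul0r addr0.
have aE4 (v : P3) : chi (i2 v) e4 = a v by [].
move=> x y; rewrite {1}(stab_coordinates x) {1}(stab_coordinates y).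
rewrite !(aiDl, aiDr, aiZl, aiZr) aixx (aiC _ e4) !aE4 chi3 tauE.
rewrite -!uw1 -[c in LHS]uw2 (aiC _ w.1 x.1.1); rring.
Qed.

End VasersteinForm.

(** * Pfaffians *)

Section ListPfaffian.
Variable R : comPzRingType.
Add Ring RR : (rring_theory R).
Ltac rring := ring_over R (rring_theory R).
Implicit Types (s r q : seq nat) (F G X : nat -> nat -> R).

(* [phi] takes an entry of [s] and the sequence of the remaining entries; in
   [alt2] it takes two entries, in their order in [s]. *)
Fixpoint alt s (phi : nat -> seq nat -> R) : R :=
  if s is b :: s' then phi b s' - alt s' (fun c r => phi c (b :: r)) else 0.

Fixpoint alt2 s (phi : nat -> nat -> seq nat -> R) : R :=
  if s is b :: s' then
    alt s' (phi b) + alt2 s' (fun c d r => phi c d (b :: r))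
  else 0.

Lemma eq_alt s phi psi :
  (forall c r, perm_eq (c :: r) s -> phi c r = psi c r) -> alt s phi = alt s psi.
Proof.
elim: s phi psi => //= b s IH phi psi h; rewrite h //; congr (_ - _).
apply: IH => c r p; apply: h.
by rewrite (perm_catCA [:: c] [:: b] r) /= perm_cons.
Qed.

Lemma altD s phi psi : alt s (fun c r => phi c r + psi c r) = alt s phi + alt s psi.
Proof.
elim: s phi psi => [|b s IH] phi psi /=; first by rring.
by rewrite (IH (fun c r => phi c (b :: r))); rring.
Qed.

Lemma altZ s a phi : alt s (fun c r => a * phi c r) = a * alt s phi.
Proof.
elim: s phi => [|b s IH] phi /=; first by rring.
by rewrite (IH (fun c r => phi c (b :: r))); rring.
Qed.

Lemma altN s phi : alt s (fun c r => - phi c r) = - alt s phi.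
Proof.
elim: s phi => [|b s IH] phi /=; first by rring.
by rewrite (IH (fun c r => phi c (b :: r))); rring.
Qed.

Lemma alt0 s phi : (forall c r, perm_eq (c :: r) s -> phi c r = 0) -> alt s phi = 0.
Proof.
move=> h; rewrite (eq_alt (psi := fun _ _ => 0 * 0)); first by rewrite altZ; rring.
by move=> c r /h ->; rring.
Qed.

Lemma eq_alt2 s phi psi : (forall c d r, perm_eq (c :: d :: r) s -> phi c d r = psi c d r) ->
  alt2 s phi = alt2 s psi.
Proof.
elim: s phi psi => //= b s IH phi psi h; congr (_ + _).
  by apply: eq_alt => c r p; apply: h; rewrite perm_cons.
apply: IH => c d r p; apply: h.
by rewrite (perm_catCA [:: c; d] [:: b] r) /= perm_cons.
Qed.

Lemma alt2D s phi psi :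
  alt2 s (fun c d r => phi c d r + psi c d r) = alt2 s phi + alt2 s psi.
Proof.
elim: s phi psi => [|b s IH] phi psi /=; first by rring.
rewrite (altD s (phi b) (psi b)).
by rewrite (IH (fun c d r => phi c d (b :: r)) (fun c d r => psi c d (b :: r))); rring.
Qed.

Lemma alt2Z s a phi : alt2 s (fun c d r => a * phi c d r) = a * alt2 s phi.
Proof.
elim: s phi => [|b s IH] phi /=; first by rring.
by rewrite (altZ s a (phi b)) (IH (fun c d r => phi c d (b :: r))); rring.
Qed.

Lemma alt2N s phi : alt2 s (fun c d r => - phi c d r) = - alt2 s phi.
Proof.
elim: s phi => [|b s IH] phi /=; first by rring.
by rewrite (altN s (phi b)) (IH (fun c d r => phi c d (b :: r))); rring.
Qed.

Let sub_sub (a b c : R) : a - (b - c) = a - b + c. Proof. rring. Qed.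

Lemma alt_alt s (phi : nat -> nat -> seq nat -> R) :
  alt s (fun c r => alt r (fun d q => phi c d q))
  = alt2 s (fun c d q => phi c d q - phi d c q).
Proof.
elim: s phi => //= b s IH phi.
rewrite (altD s (phi b) (fun d q => - phi d b q)) altN.
rewrite (altD s (fun c r => phi c b r) (fun c r => - alt r (fun d q => phi c d (b :: q)))) altN.
rewrite (IH (fun c d q => phi c d (b :: q))); exact: sub_sub.
Qed.

Lemma alt_altC s (phi : nat -> nat -> seq nat -> R) :
  alt s (fun c r => alt r (fun d q => phi c d q))
  = - alt s (fun d r => alt r (fun c q => phi c d q)).
Proof.
rewrite alt_alt (alt_alt s (fun d c q => phi c d q)) -alt2N.
by apply: eq_alt2 => c d r _; rring.
Qed.

Lemma alt_alt2 s (phi : nat -> nat -> nat -> seq nat -> R) :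
  alt s (fun c r => alt2 r (fun d e q => phi c d e q))
  = alt2 s (fun d e q => alt q (fun c q' => phi c d e q')).
Proof.
elim: s phi => //= b s IH phi.
rewrite (altD s (fun c r => alt r (fun e q => phi c b e q))
  (fun c r => alt2 r (fun d e q => phi c d e (b :: q)))).
rewrite (IH (fun c d e q => phi c d e (b :: q))).
rewrite (alt2D s (fun d e q => phi b d e q)
  (fun d e q => - alt q (fun c q' => phi c d e (b :: q')))) alt2N.
rewrite (alt_altC s (fun c e q => phi c b e q)) opprD opprK addrC -!addrA.
by congr (_ + _); rewrite addrC.
Qed.

(* [pf F m s] is the Pfaffian of the matrix [F] on the indices [s], for [s] of
   size [2 * m]; [dpf F X m s] is its derivative in the direction [X]. *)
Fixpoint pf F m s : R :=
  if m is m'.+1 then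
    if s is a :: s' then alt s' (fun c r => F a c * pf F m' r) else 1
  else 1.

Fixpoint dpf G X m s : R :=
  if m is m'.+1 then
    if s is a :: s' then alt s' (fun c r => G a c * dpf G X m' r + X a c * pf G m' r)
    else 0
  else 0.

Lemma eq_pf F G m s : {in s &, forall a b, F a b = G a b} -> pf F m s = pf G m s.
Proof.
elim: m s => [|m IH] [|a s] //= h; apply: eq_alt => c r p.
have sub x : x \in c :: r -> x \in s by rewrite (perm_mem p).
rewrite h ?mem_head ?inE ?sub ?mem_head ?orbT //; congr (_ * _).
by apply: IH => x y xr yr; apply: h; rewrite inE sub ?orbT // inE ?xr ?yr orbT.
Qed.

Lemma dpfZ G X t m s : dpf G (fun a b => t * X a b) m s = t * dpf G X m s.
Proof.
elim: m s => [|m IH] [|a s] /=; rewrite ?mulr0 // -altZ; apply: eq_alt => c r _.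
by rewrite IH; rring.
Qed.

(** The recursion singles out the first index; here all pairs enter alike, so that the Pluecker
    relation can be applied under the sum. *)
Lemma dpfE G X m s : size s = (m.+1).*2 ->
  dpf G X m.+1 s = alt2 s (fun c d q => X c d * pf G m q).
Proof.
elim: m s => [|m IH] [|a s] // [sz].
  case: s sz => [|b [|]] //= _; rring.
rewrite -[LHS]/(alt s (fun c r => G a c * dpf G X m.+1 r + X a c * pf G m.+1 r)).
rewrite -[RHS]/(alt s (fun d q => X a d * pf G m.+1 q)
  + alt2 s (fun c d q => X c d * pf G m.+1 (a :: q))) altD addrC; congr (_ + _).
rewrite (eq_alt (psi := fun c r => alt2 r (fun d e q => G a c * (X d e * pf G m q)))).
  rewrite alt_alt2; apply: eq_alt2 => d e q _.
  by rewrite /= -altZ; apply: eq_alt => c r _; rring.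
move=> c r p; rewrite IH ?alt2Z //.
by have := perm_size p; rewrite /= sz => -[].
Qed.

Section Plucker.
Variable X : nat -> nat -> R.
Hypothesis pluckerX : forall a b c d, X a c * X b d - X a d * X b c = X a b * X c d.

(** This is the second-order term along [X]. After expanding in the next row [b], the terms with
    [G b d] vanish by induction; the Pluecker relation turns the rest into [X a b] times the
    derivative, which cancels the leading term. *)
Lemma alt_dpf G m a s : size s = m.*2.+1 -> alt s (fun c r => X a c * dpf G X m r) = 0.
Proof.
elim: m a s => [|m IH] a s sz; first by apply: alt0 => c r _ /=; rring.
case: s sz => [//|b s] [sz].
rewrite [LHS]/= -[alt s _]/(alt s (fun c r => X a c * dpf G X m.+1 (b :: r))).
have -> : alt s (fun c r => X a c * dpf G X m.+1 (b :: r)) =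
    alt s (fun c r => alt r (fun d q => X a c * (G b d * dpf G X m q)))
    + alt s (fun c r => alt r (fun d q => X a c * (X b d * pf G m q))).
  rewrite -altD; apply: eq_alt => c r _; rewrite -altD -altZ.
  by apply: eq_alt => d q _; rring.
rewrite alt_altC (_ : alt s (fun d r => _) = 0); last first.
  apply: alt0 => d r p.
  rewrite (eq_alt (psi := fun c q => G b d * (X a c * dpf G X m q))) => [|c q _].
    rewrite altZ IH; first by rring.
    by have := perm_size p; rewrite /= sz => -[].
  by rring.
rewrite alt_alt (@eq_alt2 _ _ (fun c d q => X a b * (X c d * pf G m q))) => [|c d q _].
  by rewrite alt2Z -dpfE //= ; rring.
rewrite !mulrA -(pluckerX a b c d); rring.
Qed.

Lemma pfD G m s : size s = m.*2 ->
  pf (fun a b => G a b + X a b) m s = pf G m s + dpf G X m s.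
Proof.
elim: m s => [|m IH] s sz; first by rewrite /=; rring.
case: s sz => [//|a s] [sz] /=.
transitivity (alt s (fun c r => G a c * pf G m r) +
  (alt s (fun c r => G a c * dpf G X m r + X a c * pf G m r)
   + alt s (fun c r => X a c * dpf G X m r))).
  rewrite -!altD; apply: eq_alt => c r p; rewrite IH; first by rring.
  by have := perm_size p; rewrite /= sz => -[].
by rewrite alt_dpf //; rring.
Qed.
End Plucker.

Lemma alt_sum s phi : alt s phi =
  \sum_(j < size s) (-1) ^+ j * phi (nth 0%N s j) (take j s ++ drop j.+1 s).
Proof.
elim: s phi => [|b s IH] phi; first by rewrite big_ord0.
rewrite [LHS]/= IH big_ord_recl /= expr0 mul1r drop0; congr (_ + _).
rewrite -sumrN; apply: eq_bigr => j _ /=.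
by rewrite exprS mulN1r mulNr.
Qed.

Lemma pfaffian_pf n F s (A : 'M[R]_n.*2) : size s = n.*2 ->
  (forall i j, A i j = F (nth 0%N s i) (nth 0%N s j)) -> pfaffian A = pf F n s.
Proof.
elim: n s A => [//|n IH] [//|a s] A [sz] AE.
rewrite [RHS]/= alt_sum sz; apply: eq_bigr => j _.
rewrite AE /= /bump /= -mulrA; congr (_ * (_ * _)).
apply: IH => [|i k].
  rewrite size_cat size_take size_drop sz ltn_ord.
  by have := ltn_ord j; rewrite !ltnS => h; rewrite subSS subnKC.
rewrite !mxE AE /= !add0n.
have rE (l : 'I_n.*2) : nth 0%N s (bump j l) = nth 0%N (take j s ++ drop j.+1 s) l.
  rewrite /bump nth_cat size_take sz ltn_ord; case: (ltnP l j) => lj.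
    by rewrite nth_take.
  by rewrite nth_drop add1n addSn subnKC.
by rewrite -!rE.
Qed.

Lemma pfaffian_pf_cast n k F s (A : 'M[R]_k) : k = n.*2 -> size s = k ->
  (forall i j, A i j = F (nth 0%N s i) (nth 0%N s j)) -> pfaffian A = pf F n s.
Proof. by move=> kE; subst k; exact: pfaffian_pf. Qed.

(* The standard form, with [std (2 * k) (2 * k + 1) = 1]. *)
Definition std (i j : nat) : R :=
  if i./2 == j./2 then (odd j)%:R - (odd i)%:R else 0.

Lemma std_iota k m c i : i./2 = k -> c \in iota k.+1.*2 m -> std i c = 0.
Proof.
rewrite mem_iota /std => -> /andP[/half_leq h _]; rewrite doubleK in h.
by rewrite (ltn_eqF h).
Qed.

Lemma std_double k : std k.*2 k.*2.+1 = 1.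
Proof. by rewrite /std -[k.*2.+1./2]/(uphalf k.*2) uphalf_double doubleK eqxx /= odd_double subr0. Qed.

Lemma alt_std k m phi : (forall c r, perm_eq (c :: r) (iota k.+1.*2 m.*2) ->
    phi c (k.*2.+1 :: r) = 0) ->
  alt (k.*2.+1 :: iota k.+1.*2 m.*2) phi = phi k.*2.+1 (iota k.+1.*2 m.*2).
Proof. by move=> h; rewrite /= alt0 ?subr0. Qed.

Lemma iota_std k m : iota k.*2 m.+1.*2 = k.*2 :: k.*2.+1 :: iota k.+1.*2 m.*2.
Proof. by []. Qed.

Lemma pf_std k m : pf std m (iota k.*2 m.*2) = 1.
Proof.
elim: m k => [//|m IH] k; rewrite iota_std.
rewrite [LHS]/= -/(alt (k.*2.+1 :: _) (fun c r => std k.*2 c * pf std m r)) alt_std => [|c r p].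
  by rewrite std_double IH mulr1.
rewrite (@std_iota k m.*2 c) ?mul0r ?doubleK //.
by rewrite -(perm_mem p) mem_head.
Qed.

Lemma dpf_std X k m :
  dpf std X m (iota k.*2 m.*2) = \sum_(i < m) X (k + i).*2 (k + i).*2.+1.
Proof.
elim: m k => [|m IH] k; first by rewrite big_ord0.
rewrite iota_std [LHS]/=.
rewrite -/(alt (k.*2.+1 :: _) (fun c r => std k.*2 c * dpf std X m r + X k.*2 c * pf std m r)).
rewrite alt_std => [|c r p].
  rewrite std_double IH mul1r -[iota _ _]/(iota k.+1.*2 m.*2) pf_std mulr1.
  rewrite big_ord_recl addn0 addrC; congr (_ + _).
  by apply: eq_bigr => i _; rewrite /= /bump add1n addSnnS.
rewrite (@std_iota k m.*2 c) ?mul0r ?doubleK // -?(perm_mem p) ?mem_head //.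
case: m IH p => [|m] IH p; first by have := perm_size p.
rewrite /= alt0 ?mulr0 ?addr0 // => d q p'.
rewrite (@std_iota k m.+1.*2 d) ?mul0r //; first by rewrite -[k.*2.+1./2]/(uphalf k.*2) uphalf_double.
by rewrite -(perm_mem p) inE -(perm_mem p') mem_head orbT.
Qed.

(* By the Pluecker relation the Pfaffian is affine in the direction [Y], of slope
   [\sum_i Y (2 i) (2 i + 1)] at the standard form. *)
Lemma pf_block F Y n (c d e : R) :
  (forall a b c d, Y a c * Y b d - Y a d * Y b c = Y a b * Y c d) ->
  \sum_(i < n) Y (1 + i).*2 (1 + i).*2.+1 = 1 ->
  F 0%N 1%N = d ->
  (forall i j, (2 <= i)%N -> (2 <= j)%N -> F i j = std i j + (c - 1) * Y i j) ->
  (forall i j, (2 <= i)%N -> (2 <= j)%N -> F 0%N i * F 1%N j - F 0%N j * F 1%N i = e * Y i j) ->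
  pf F n.+1 (iota 0 n.+1.*2) = c * d - e.
Proof.
move=> plY sumY F01 FE Fe.
have sub m s : {subset s <= iota 2 m} -> pf F n s = pf (fun i j => std i j + (c - 1) * Y i j) n s.
  move=> h; apply: eq_pf => a b /h; rewrite mem_iota => /andP[ha _] /h.
  by rewrite mem_iota => /andP[hb _]; exact: FE.
have dstd : dpf std Y n (iota 2 n.*2) = 1 by rewrite (dpf_std Y 1).
have plZ t a b c' d' : (t * Y a c') * (t * Y b d') - (t * Y a d') * (t * Y b c')
    = (t * Y a b) * (t * Y c' d').
  by transitivity (t * t * (Y a c' * Y b d' - Y a d' * Y b c')); [rring|rewrite plY; rring].
have pfE t : pf (fun i j => std i j + t * Y i j) n (iota 2 n.*2) = 1 + t.
  rewrite (@pfD (fun i j => t * Y i j) (plZ t) std) ?size_iota // dpfZ dstd.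
  by rewrite (pf_std 1); rring.
rewrite (iota_std 0 n) [LHS]/= F01 (sub n.*2) // pfE.
(* For [n = 0] the hypothesis [sumY] reads [0 = 1], so every equation holds. *)
case: n sub dstd pfE sumY => [|n] sub dstd pfE sumY.
  by rewrite /=; move: sumY; rewrite big_ord0 => z; rewrite -[LHS]mul1r -[RHS]mul1r -z; rring.
pose F' := fun i j => std i j + (c - 1) * Y i j.
(* The slope at [F'] equals that at [std]: compare the affine function [pfE] at [c - 1] and at
   [c]. *)
have dpfF : dpf F' Y n.+1 (iota 2 n.+1.*2) = 1.
  have := @pfD Y plY F' n.+1 (iota 2 n.+1.*2); rewrite size_iota => /(_ erefl).
  rewrite pfE; have -> : pf (fun i j => F' i j + Y i j) n.+1 (iota 2 n.+1.*2) = 1 + c.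
    rewrite -(pfE c); apply: eq_pf => i j _ _; rewrite /F'; rring.
  move=> h; transitivity (1 + c - (1 + (c - 1))); last by rring.
  by rewrite h; rring.
transitivity ((c * d : R) - alt (iota 2 n.+1.*2) (fun i r =>
  alt r (fun j q => F 0%N i * (F 1%N j * pf F n q)))).
  rewrite [in LHS]mulrC; congr (_ - _); first by rring.
  apply: eq_alt => i r p; rewrite -altZ; apply: eq_alt => j q _; rring.
congr (_ - _); rewrite alt_alt -[RHS]mulr1 -dpfF dpfE ?size_iota // -alt2Z.
apply: eq_alt2 => i j q p.
have ge2 l : l \in i :: j :: q -> (2 <= l)%N.
  by rewrite (perm_mem p) mem_iota => /andP[].
have -> : pf F n q = pf F' n q.
  by apply: eq_pf => a b ha hb; apply: FE; apply: ge2; rewrite !inE ?ha ?hb !orbT.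
rewrite !mulrA -Fe ?ge2 ?mem_head ?inE ?eqxx ?orbT //; rring.
Qed.
End ListPfaffian.

(** * The standard alternating form on row vectors *)

Section StandardForm.
Variable R : comPzRingType.
Add Ring RR : (rring_theory R).
Ltac rring := ring_over R (rring_theory R).
Notation std := (@std R).

Lemma fg_projective_rV n : fg_projective 'rV[R]_n.
Proof.
split; first by exists n, (fun i => delta_mx 0 i) => z; exists (z 0); exact: row_sum_delta.
move=> N N' g f sg; have [x xE] := choice (fun i : 'I_n => sg (f (delta_mx 0 i))).
have hl : linear (fun v : 'rV[R]_n => \sum_i v 0 i *: x i).
  move=> c u v; rewrite scaler_sumr -big_split; apply: eq_bigr => i _.
  by rewrite !mxE scalerDl scalerA.
exists (Lin hl) => v; rewrite /= linear_sum {2}[v]row_sum_delta linear_sum.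
by apply: eq_bigr => i _; rewrite !linZ xE.
Qed.

Lemma sum_double n (F : nat -> R) :
  \sum_(m < n.*2) F m = \sum_(i < n) (F i.*2 + F i.*2.+1).
Proof.
elim: n => [|n IH]; first by rewrite !big_ord0.
by rewrite doubleS !big_ord_recr /= IH addrA.
Qed.

Variables (n K : nat) (hK : K = n.*2).

Lemma even_ltS k : (k < K)%N -> odd k = false -> (k.+1 < K)%N.
Proof.
rewrite hK leq_eqVlt => /orP[/eqP e|//].
by rewrite -[odd k]negbK -[~~ odd k]/(odd k.+1) e odd_double.
Qed.

Lemma std_row k (g : nat -> R) : (k < K)%N ->
  \sum_(m < K) std k m * g m = if odd k then - g k.-1 else g k.+1.
Proof.
rewrite hK => hk; rewrite (sum_double n (fun m => std k m * g m)).
have hk2 : (k./2 < n)%N.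
  by rewrite -ltn_double; apply: leq_ltn_trans hk; rewrite -[leqRHS]odd_double_half leq_addl.
rewrite (bigD1 (Ordinal hk2)) //= big1 => [|i ni]; last first.
  rewrite /std -[i.*2.+1./2]/(uphalf i.*2) uphalf_double doubleK.
  have -> : (k./2 == i) = false by apply/negbTE; move: ni; rewrite -val_eqE /= eq_sym.
  by rewrite !mul0r addr0.
rewrite /std -[(k./2).*2.+1./2]/(uphalf (k./2).*2) uphalf_double doubleK eqxx /= odd_double.
have := odd_double_half k; case: (odd k) => /= kE.
  by rewrite -[in RHS]kE /= add0n ?mulr0n ?mulr1n; rring.
by rewrite -[in RHS]kE add0n ?mulr0n ?mulr1n; rring.
Qed.

Lemma std_antisym i j : std i j = - std j i.
Proof. by rewrite /std eq_sym; case: ifP => _; rring. Qed.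

Definition std_form (v w : 'rV[R]_K) : R := \sum_(i < K) \sum_(j < K) v 0 i * (std i j * w 0 j).

Definition entry (v : 'rV[R]_K) (k : nat) : R := if insub k is Some o then v 0 o else 0.
Lemma entryE v (i : 'I_K) : entry v i = v 0 i. Proof. by rewrite /entry valK. Qed.

(** The product of the matrix [std] with the column [g], by [std_row]; with [g] defined on all
    naturals the neighbouring index carries no bound. *)
Definition flip (g : nat -> R) (k : nat) : R := if odd k then - g k.-1 else g k.+1.

Lemma std_formE v w : std_form v w = \sum_(i < K) v 0 i * flip (entry w) i.
Proof.
apply: eq_bigr => i _; rewrite -mulr_sumr /flip -(std_row _ (ltn_ord i)); congr (_ * _).
by apply: eq_bigr => j _; rewrite entryE.
Qed.

Lemma std_form_delta v k : std_form v (delta_mx 0 k) = - flip (entry v) k.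
Proof.
rewrite /std_form /flip -(std_row _ (ltn_ord k)) -sumrN; apply: eq_bigr => i _.
rewrite (bigD1 k) //= big1 => [|j jk]; last by rewrite !mxE eqxx (negbTE jk) /= mulr0n; rring.
by rewrite !mxE !eqxx (std_antisym k) entryE /= mulr1n; rring.
Qed.

Lemma std_form_deltal v k : std_form (delta_mx 0 k) v = flip (entry v) k.
Proof.
rewrite std_formE (bigD1 k) //= big1 => [|j jk]; last by rewrite !mxE eqxx (negbTE jk) /= mulr0n; rring.
by rewrite !mxE !eqxx /= mulr1n; rring.
Qed.

Lemma flip_row (g : nat -> R) k : (k < K)%N ->
  flip (entry (\row_(i < K) g i)) k = flip g k.
Proof.
have eE i : (i < K)%N -> entry (\row_(i < K) g i) i = g i.
  by move=> hi; rewrite -[i]/(val (Ordinal hi)) entryE mxE.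
rewrite /flip => hk; case: ifP => ok; rewrite eE //.
  by rewrite (leq_ltn_trans (leq_pred k)).
exact: even_ltS.
Qed.

Lemma flipK (g : nat -> R) k : flip (flip g) k = - g k.
Proof.
rewrite /flip; case: k => [|k] /=; first by [].
by case: (odd k) => //=; rewrite opprK.
Qed.

Lemma std_form_is_alternating_iso : is_alternating_iso std_form.
Proof.
have linl q : linear (fun p => std_form p q : R^o).
  move=> c x y; rewrite scaler_sumr -big_split; apply: eq_bigr => i _.
  rewrite scaler_sumr -big_split; apply: eq_bigr => j _.
  by rewrite !mxE /=; rring.
apply: alternating_isoI => // [x|x y|l|q hq].
- rewrite /std_form (@sum_alternating R K (fun i j => x 0 i * (std i j * x 0 j))) => [|i].
    by rewrite big1 // => i _; rewrite big1 // => j _; rewrite (std_antisym j); rring.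
  by rewrite /std eqxx; rring.
- rewrite /std_form exchange_big -sumrN; apply: eq_bigr => i _.
  by rewrite -sumrN; apply: eq_bigr => j _; rewrite (std_antisym j); rring.
- pose L k : R := if insub k is Some o then l (delta_mx 0 o) else 0.
  exists (\row_(i < K) - flip L i) => v.
  rewrite std_formE {2}[v]row_sum_delta linear_sum; apply: eq_bigr => i _.
  rewrite (flip_row (fun k => - flip L k) (ltn_ord i)) lfZ; congr (_ * _).
  have -> : flip (fun k => - flip L k) i = - flip (flip L) i.
    by rewrite /flip; case: (odd i).
  by rewrite flipK opprK /L valK.
- apply/rowP => k; rewrite mxE -entryE.
  have flip0 i : (i < K)%N -> flip (entry q) i = 0.
    by move=> hi; rewrite -(hq (delta_mx 0 (Ordinal hi))) std_form_deltal.
  case ok: (odd k).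
    have := flip0 k.-1 (leq_ltn_trans (leq_pred k) (ltn_ord k)).
    rewrite /flip; case: (val k) ok => [//|m] /= /negbTE ->; exact.
  have := flip0 _ (even_ltS (ltn_ord k) ok); rewrite /flip /= ok /= => /eqP; rewrite oppr_eq0 => /eqP.
  exact.
Qed.
Definition std_iso : alternating_iso 'rV[R]_K := AlternatingIso std_form_is_alternating_iso.

Lemma gram_std i j : gram std_form i j = std i j.
Proof.
rewrite mxE std_form_deltal /flip -(std_row _ (ltn_ord i)) (bigD1 j) //= big1 => [|k kj].
  by rewrite entryE !mxE !eqxx /= mulr1n; rring.
by rewrite entryE !mxE eqxx (negbTE kj) /= mulr0n; rring.
Qed.

End StandardForm.

(** * The Pfaffian homomorphism on forms on [P_4] *)

Section RelativePfaffian.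
Variables (R : comPzRingType) (P0 : lmodType R).
Add Ring RR : (rring_theory R).
Ltac rring := ring_over R (rring_theory R).
Variable X : alternating_iso P0.
Hypothesis pluckerX : forall x y z w, X x y * X w z + X y z * X w x + X z x * X w y = 0.
Hypothesis unitX : exists l : seq (P0 * P0), \sum_(p <- l) X p.1 p.2 = 1.
Local Notation P4 := (stab P0 2).
Local Notation i0 := (fun x : P0 => in1 R^o (in1 R^o x) : P4).
Local Notation e3 := (in1 R^o (e_top P0 0)).
Local Notation e4 := (e_top P0 1).

(** [is_Pfbar] prescribes values on free modules, so [cl_replace] moves the class along an isometry
    [j] into a standard form. The adjoint of [j] sends the basis vectors to [e3], [e4] and the
    members of the pairs in [l]; the new Gram matrix is [std] plus the values of [chi - stf X]
    there, and [pf_block] applies. *)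
Lemma Pfbar_value (h : V R -> R) (h4 : fg_projective P4) (chi : alternating_iso P4)
  (c d : R) (q a0 : P0) : is_Pfbar h ->
  (forall x y : P0, chi (i0 x) (i0 y) = c * X x y) ->
  (forall x, chi (i0 x) e3 = X x q) -> (forall x, chi (i0 x) e4 = X x a0) ->
  chi e3 e4 = d -> h (cl h4 (stf X) chi) = c * d - X q a0.
Proof.
move=> [_ _ hPf] chi00 chi03 chi04 chi34.
have [l lE] := unitX.
pose n := size l; pose K := (2 * n.+1)%N.
have hK : K = n.+1.*2 by rewrite /K mul2n.
pose Psi := std_iso R hK.
(* The dummy pair shifts [l] by one, leaving the indices [0] and [1] to [e3] and [e4]. *)
pose xs k : P0 := let p := nth (0, 0) ((0, 0) :: l) k./2 in if odd k then p.2 else p.1.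
have xsE i : (xs (i.+1).*2 = (nth (0, 0) l i).1) * (xs (i.+1).*2.+1 = (nth (0, 0) l i).2).
  by rewrite /xs -[(i.+1).*2.+1./2]/(uphalf (i.+1).*2) uphalf_double doubleK /= odd_double.
pose b k : P4 := if k is k'.+1 then if k' is k''.+1 then i0 (xs k) else e4 else e3.
have SE z w : stf X z w = X z.1.1 w.1.1 + ((z.1.2 : R) * w.2 - (z.2 : R) * w.1.2) by [].
have S0 z : stf X z e3 = - (z.2 : R) by rewrite SE /= ai0r; rring.
have S1 z : stf X z e4 = z.1.2 by rewrite SE /= ai0r; rring.
have S2 z x : stf X z (i0 x) = X z.1.1 x by rewrite SE /=; rring.
have pl z w x y : X z x * X w y - X z y * X w x = X z w * X x y.
  have := pluckerX z w x y => hp.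
  transitivity (X z w * X x y + (X z w * X y x + X w x * X y z + X x z * X y w)).
    rewrite (aiC _ y x) (aiC _ y z) (aiC _ y w) (aiC _ x z); rring.
  by rewrite hp addr0.
pose B z k : R := stf X z (b k).
(* These coordinates are forced by adjointness: the adjoint is to send the [i]-th basis vector to
   [b i]. *)
have jl : linear (fun z => \row_(i < K) flip (B z) i).
  move=> a z w; apply/rowP => i; rewrite !mxE /flip /B !aiPl.
  by case: ifP => _ //; rring.
pose j := Lin jl.
have jflip z k : (k < K)%N -> flip (entry (j z)) k = - B z k.
  by move=> hk; rewrite (flip_row hK (flip (B z)) hk) flipK.
(* By [pl] each pair of [l] contributes a multiple of [X z.1.1 w.1.1], and the coefficients add up
   to [1]. *)
have Bsum z w : \sum_(i < n.+1) (B z i.*2 * B w i.*2.+1 - B z i.*2.+1 * B w i.*2) = stf X z w.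
  rewrite big_ord_recl (eq_bigr (fun i : 'I_n => X z.1.1 w.1.1 *
      X (nth (0, 0) l i).1 (nth (0, 0) l i).2)) => [|i _].
    rewrite -mulr_sumr.
    have -> : \sum_(i < n) X (nth (0, 0) l i).1 (nth (0, 0) l i).2 = 1.
      by rewrite -[RHS]lE (big_nth (0, 0)) big_mkord.
    by rewrite mulr1 SE /B !S0 !S1; rring.
  rewrite -[val (lift _ _)]/(i.+1) /B -[b i.+1.*2]/(i0 (xs i.+1.*2)) -[b i.+1.*2.+1]/(i0 (xs i.+1.*2.+1)).
  by rewrite !S2 !xsE pl.
have hj z w : Psi (j z) (j w) = stf X z w.
  transitivity (std_form (K := K) (j z) (j w)); first by [].
  rewrite -(Bsum z w) [LHS](std_formE hK).
  rewrite (eq_bigr (fun i : 'I_K => - (flip (B z) i * B w i))) => [|i _]; last first.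
    by rewrite mxE jflip //; rring.
  rewrite hK (sum_double n.+1 (fun i => - (flip (B z) i * B w i))).
  apply: eq_bigr => i _; rewrite /flip /= odd_double /=; rring.
have [r hr] := ai_adjoint Psi (stf X) j.
have rb (i : 'I_K) : r (delta_mx 0 i) = b i.
  apply: (@ai_injr _ _ (stf X)) => z; rewrite hr /= (std_form_delta hK) jflip //.
  exact: opprK.
pose F i k : R := std R i k - stf X (b i) (b k) + chi (b i) (b k).
have gramE i k : gram (replace chi hj hr) i k = F i k.
  rewrite mxE /= /replace_form !rb; congr (_ - _ + _).
  by rewrite -(gram_std R hK i k) mxE.
have iotaE (i : 'I_K) : nth 0%N (iota 0 K) i = i by rewrite nth_iota.
have pfg : pfaffian (gram Psi) = 1.
  rewrite (@pfaffian_pf_cast R n.+1 K (std R) (iota 0 K)) ?size_iota // => [|i k].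
    by rewrite hK (pf_std R 0).
  by rewrite !iotaE (gram_std R hK).
have pff : pfaffian (gram (replace chi hj hr)) = pf F n.+1 (iota 0 n.+1.*2).
  transitivity (pf F n.+1 (iota 0 K)); last by rewrite hK.
  by apply: pfaffian_pf_cast; rewrite ?size_iota // => i k; rewrite !iotaE gramE.
rewrite (cl_replace h4 (fg_projective_rV R K) chi hj hr).
have := hPf n.+1 (fg_projective_rV R K) Psi (replace chi hj hr).
rewrite pfg mulr1 pff => ->.
pose Y i k : R := X (xs i) (xs k).
have b2 i : (2 <= i)%N -> b i = i0 (xs i) by case: i => [|[|i]].
apply: (@pf_block R F Y).
- by move=> a1 a2 a3 a4; rewrite /Y pl.
- rewrite -[RHS]lE (big_nth (0, 0)) big_mkord; apply: eq_bigr => i _.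
  by rewrite /Y !xsE.
- rewrite /F -[b 0]/e3 -[b 1]/e4 S1 chi34 -[e3.1.2]/1.
  by rewrite [std R 0 1]subr0 -[(odd 1)%:R]/(1 : R) subrr add0r.
- move=> i k hi hk; rewrite /F !b2 // S2 chi00 /Y /=; rring.
- have stdl i k : (i < 2)%N -> (2 <= k)%N -> std R i k = 0.
    by case: k => [|[|k]] //; case: i => [|[|i]].
  move=> i k hi hk; rewrite /F -[b 0]/e3 -[b 1]/e4 !b2 // !S2 !stdl // !ai0l.
  rewrite (aiC chi e3) (aiC chi e4) (aiC chi e3) (aiC chi e4) !chi03 !chi04 -pl /Y.
  rewrite (aiC _ q) (aiC _ a0) (aiC _ q) (aiC _ a0); rring.
Qed.

End RelativePfaffian.

(** * Injectivity and surjectivity *)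

Section Injectivity.
Variables (R : comPzRingType) (P0 : lmodType R).
Add Ring RR : (rring_theory R).
Ltac rring := ring_over R (rring_theory R).
Hypotheses (hP0 : fg_projective P0) (hrk : constant_rank 2 P0).
Variables (theta0 : {linear R^o -> exterior P0 2}).
Hypothesis htheta0 : bijective theta0.
Local Notation X := (chi0_iso hrk htheta0).
Local Notation vform_iso := (vform_iso hrk htheta0).

Lemma vform_e4 (a : {linear stab P0 1 -> R^o}) w (aw : a w = 1) x :
  vform_iso aw (in1 R^o x) (e_top P0 1) = a x.
Proof.
have t0 : tau theta0 x 0 w = 0 by exact: (tri_02 (tau_trilinear htheta0)).
rewrite /= /vform /= lin0 t0; rring.
Qed.

Lemma seq_equiv_isometry k (chi chi' : alternating_iso (stab P0 k)) :
  seq_equiv (mk chi) (mk chi') ->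
  exists n (phi : {linear stab P0 (n.*2 + k) -> stab P0 (n.*2 + k)}),
    Estab phi /\ forall x y, sform n chi' x y = sform n chi (phi x) (phi y).
Proof.
case=> n [m]; rewrite !iter_st => -[phi [c [hphi cE e]]].
(* Each stabilisation raises the rank by two, so equal ranks force equally many stabilisations. *)
have nm : m = n.
  by have := congr1 (@projT1 _ _) e => /= /addIn /double_inj.
subst m; exists n, phi; split=> // x y.
have -> : sform n chi' = c by apply: (inj_pair2_eq_dec _ PeanoNat.Nat.eq_dec _ _ _ _ e).
exact: cE.
Qed.

Lemma vaserstein_injective
  (row : forall k (f : {linear stab P0 k.+2 -> stab P0 k.+2}), (exists m, k = m.*2 + 2)%N ->
     bijective f -> stably_elementary f ->
     exists2 eps : {linear stab P0 k.+2 -> stab P0 k.+2}, Estab eps & forall x, (f x).2 = (eps x).2)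
  (stable : forall f : {linear stab P0 2 -> stab P0 2},
     bijective f -> stably_elementary f -> Estab f)
  (a b : {linear P_ P0 3 -> R^o}) (ha : Um a) (hb : Um b) :
  vaserstein theta0 ha = vaserstein theta0 hb ->
  exists2 delta : {linear stab P0 1 -> stab P0 1}, Estab delta & forall x, b x = a (delta x).
Proof.
have h4 := fg_projective_stab hP0 2.
have [w [aw ->]] := vaserstein_cl hP0 hrk htheta0 h4 ha.
have [v [bv ->]] := vaserstein_cl hP0 hrk htheta0 h4 hb.
move=> /cl_eq_equiv /seq_equiv_isometry [n [phi [hphi phiE]]].
have [alpha [ha1 ba aE]] := descent row (Estab_stably_elementary hphi) (Egen_bijective hphi) phiE.
have [_ /(_ (vform_iso aw)) [d hd dE]] := Estab_orbit_invariant (stable _ ba ha1).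
exists d => // x; rewrite -(vform_e4 aw) -(vform_e4 bv) -dE.
exact: aE.
Qed.

End Injectivity.

Section Surjectivity.
Variables (R : comPzRingType) (P0 : lmodType R).
Add Ring RR : (rring_theory R).
Ltac rring := ring_over R (rring_theory R).
Hypothesis hP0 : fg_projective P0.
Notation stab := (stab P0).

Lemma Um_top k (chi : alternating_iso (stab k.+1)) :
  Um (ai_functional chi (e_top P0 k) \o @in1 R (stab k) R^o).
Proof.
have [w [_ w1]] := alternating_kernel chi => r; exists (r *: w).
by rewrite linZ /= w1 scale_regular1.
Qed.

(** The last two basis vectors span a copy of [psi_2] orthogonal to [stab k], so the restriction to
    [stab k] is again non-degenerate. *)
Lemma stf_split k (chi : alternating_iso (stab k.+2)) :
  (forall x, chi (in1 R^o x) (e_top P0 k.+1) = x.2) ->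
  (forall x : stab k, chi (in1 R^o (in1 R^o x)) (in1 R^o (e_top P0 k)) = 0) ->
  exists chi' : alternating_iso (stab k), chi = stf chi'.
Proof.
move=> h4 h3.
pose i (x : stab k) : stab k.+2 := in1 R^o (in1 R^o x).
have iE (x : stab k.+2) : x = i x.1.1 + (x.1.2 : R) *: (in1 R^o (e_top P0 k) : stab k.+2)
    + (x.2 : R) *: (e_top P0 k.+1 : stab k.+2).
  rewrite {1}(stab_coordinates x); congr (_ + _).
  rewrite {1}(stab_coordinates x.1) (linD (@in1 R (stab k.+1) R^o)).
  by rewrite (linZ (@in1 R (stab k.+1) R^o)).
have ifE c x y : i (c *: x + y) = c *: i x + i y.
  rewrite /i (linD (@in1 R (stab k) R^o)) (linZ (@in1 R (stab k) R^o)).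
  by rewrite (linD (@in1 R (stab k.+1) R^o)) (linZ (@in1 R (stab k.+1) R^o)).
have chiE x y : chi x y = chi (i x.1.1) (i y.1.1) + ((x.1.2 : R) * y.2 - (x.2 : R) * y.1.2).
  rewrite {1}(iE x) {1}(iE y) !(aiDl, aiDr, aiZl, aiZr) !aixx (aiC _ (e_top P0 k.+1)) (aiC _ (e_top P0 k.+1)).
  rewrite !h4 (aiC _ (in1 R^o (e_top P0 k)) (i _)) !h3 /=.
  rring.
have ai : is_alternating_iso (fun x y => chi (i x) (i y)).
  apply: alternating_isoI => [q c x y|x|x y|l|q hq].
  - by rewrite ifE aiPl.
  - exact: aixx.
  - exact: aiC.
  - have [q qE] := ai_repr chi (l \o fst \o fst); exists q.1.1 => p.
    have := qE (i p); rewrite chiE /= => <-; rring.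
  - have h : i q = 0.
      by apply: (@ai_injr _ _ chi) => z; rewrite ai0r chiE hq /=; rring.
    exact: (congr1 (fun z : stab k.+2 => z.1.1) h).
by exists (AlternatingIso ai); apply: ai_eq => x y; rewrite chiE.
Qed.

(** The inverse of [eps] turns the last row into the last coordinate, and a shear then clears the
    row before it. Both changes are elementary, hence invisible in V(R), and [stf_split] removes the
    plane. *)
Lemma cl_desuspend k (hk : fg_projective (stab k)) (hk2 : fg_projective (stab k.+2))
  (psi : alternating_iso (stab k)) (chi : alternating_iso (stab k.+2))
  (eps : {linear stab k.+1 -> stab k.+1}) : Estab eps ->
  (forall x, chi (in1 R^o x) (e_top P0 k.+1) = (eps x).2) ->
  exists chi' : alternating_iso (stab k), cl hk2 (stf psi) chi = cl hk psi chi'.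
Proof.
move=> /Estab_inverse [e [he K K']] chiE.
have hF := Estab_sum_id he; set F := sum_id _ in hF.
pose chi1 := pullback (Egen_bijective hF) chi.
have h1 x : chi1 (in1 R^o x) (e_top P0 k.+1) = x.2.
  rewrite -{2}(K' x) -chiE -[LHS]/(chi (F (in1 R^o x)) (F (e_top P0 k.+1))).
  by congr (chi (in1 R^o _) _); rewrite /F /sum_id /e_top /in2 /= lin0.
(* [chi1] takes the value [-1] on the top basis vector and the one below it, so adding [l] times the
   top vector makes [stab k] orthogonal to the lower one. *)
pose l : {linear stab k -> R^o} :=
  ai_functional chi1 (in1 R^o (e_top P0 k)) \o @in1 R (stab k.+1) R^o \o @in1 R (stab k) R^o.
have hG := @Estab_transvection_top R P0 k.+1 (l \o fst).
set G := transvection _ _ in hG.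
pose chi2 := pullback (Egen_bijective hG) chi1.
have GE x : G x = x + (l x.1.1 : R) *: e_top P0 k.+1 by [].
have G1 : G (e_top P0 k.+1) = e_top P0 k.+1 by rewrite GE lin0 scale0r addr0.
have G3 : G (in1 R^o (e_top P0 k)) = in1 R^o (e_top P0 k).
  by rewrite GE lin0 scale0r addr0.
have [||chi' chi2E] := @stf_split k chi2.
- move=> x; rewrite -[LHS]/(chi1 (G (in1 R^o x)) (G (e_top P0 k.+1))) G1 GE.
  by rewrite aiDl aiZl aixx mulr0 addr0 h1.
- move=> x; rewrite -[LHS]/(chi1 (G (in1 R^o (in1 R^o x))) (G (in1 R^o (e_top P0 k)))) G3 GE.
  rewrite aiDl aiZl (aiC _ (e_top P0 k.+1)) h1 /=; rring.
exists chi'; rewrite (cl_stf hk hk2) -chi2E -(cl_chain hk2 (stf psi) chi chi2).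
rewrite -(cl_chain hk2 chi chi1 chi2) (@cl_Estab _ _ _ hk2 F chi chi1) //.
by rewrite (@cl_Estab _ _ _ hk2 G chi1 chi2) // Vadd0 Vadd0r.
Qed.

Hypothesis orbit : forall k (a : {linear stab k.+1 -> R^o}), (exists m, k = m.*2 + 2)%N ->
  Um a -> exists2 eps : {linear stab k.+1 -> stab k.+1}, Estab eps & forall x, a x = (eps x).2.

Lemma cl_sform n (hn : fg_projective (stab (n.*2 + 2))) (h4 : fg_projective (stab 2))
  (psi : alternating_iso (stab 2)) (chi : alternating_iso (stab (n.*2 + 2))) :
  exists chi' : alternating_iso (stab 2), cl hn (sform n psi) chi = cl h4 psi chi'.
Proof.
elim: n hn chi => [|n IH] hn chi.
  by exists chi; rewrite (Prop_irrelevance hn h4).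
have hk := fg_projective_stab hP0 (n.*2 + 2).
have [|eps heps epsE] := orbit _ (@Um_top (n.*2 + 2).+1 chi); first by exists n.
have [chi1 e1] := cl_desuspend hk hn (sform n psi) heps epsE.
have [chi' e'] := IH hk chi1.
by exists chi'; rewrite -e' -e1.
Qed.

Hypothesis hrk : constant_rank 2 P0.
Variables (theta0 : {linear R^o -> exterior P0 2}).
Hypothesis htheta0 : bijective theta0.

Lemma vaserstein_surjective (v : V R) : Vtilde v ->
  exists (a : {linear P_ P0 3 -> R^o}) (ha : Um a), vaserstein theta0 ha = v.
Proof.
case=> h hPf hv; have h4 := fg_projective_stab hP0 2.
pose X := chi0_iso hrk htheta0.
have [t vt] := Vtriple_cl (Vrepr v); rewrite Vrepr_class in vt.
(* Acting on the base form of the symbol represents [v] by a triple whose first form is a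
   stabilisation of [stf X]. *)
have [n [y]] := strict_total t (mk (stf X : alternating_iso (stab 2))).
rewrite iter_st => -[j [r [hj [hr _]]]].
have [chi vE] := cl_sform (fg_projective_stab hP0 (n.*2 + 2)) h4 (stf X) (replace (tf t) hj hr).
rewrite -(cl_replace (tmodP t)) in vE.
have {}vE : v = cl h4 (stf X) chi by rewrite vt -vE; case: (t).
have [a [w [c [d [u [q [a0 [aw chiE c00 c03 [c04 c34 uE]]]]]]]]] := alternating_normal_form hrk htheta0 chi.
have u1 : u = 1.
  rewrite uE -hv vE; apply/esym; apply: Pfbar_value => //.
  - exact: plucker_form.
  - exact: chi0_unit.
have ha : Um a by move=> s; exists (s *: w); rewrite linZ aw scale_regular1.
exists a, ha; have [w' [aw' ->]] := vaserstein_cl hP0 hrk htheta0 h4 ha.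
rewrite (cl_vform_section hrk htheta0 h4 (stf X) aw' aw) vE; congr cl.
by apply: ai_eq => x z; rewrite chiE u1 mul1r.
Qed.
End Surjectivity.

Lemma stab_prj_top (R : comPzRingType) (P0 : lmodType R) k (x : stab P0 k.+1) :
  stab_prj P0 k.+1 k x = x.2.
Proof. by rewrite /= eqxx. Qed.

Lemma Um_orbit_E (R : comPzRingType) (P0 : lmodType R) n
  (a b : {linear P_ P0 n -> R^o}) (delta : {linear P_ P0 n -> P_ P0 n}) :
  E P0 n delta -> (forall x, b x = a (delta x)) ->
  Um_orbit a (E P0 n) = Um_orbit b (E P0 n).
Proof.
move=> hd bE; have [e [he K K']] := Estab_inverse hd.
apply/seteqP; split=> [l [phi hphi lE]|l [phi hphi lE]].
  exists (e \o phi); first exact: Estab_comp.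
  by rewrite lE; apply/funext => x /=; rewrite bE K'.
exists (delta \o phi); first exact: Estab_comp.
by rewrite lE; apply/funext => x /=; rewrite bE.
Qed.

Theorem theorem2 (R : comPzRingType) (P0 : lmodType R)
  (hP0 : fg_projective P0) (hrk : constant_rank 2 P0)
  (theta0 : {linear R^o -> exterior P0 2}) (htheta0 : bijective theta0) :
  ((forall n : nat, (2 <= n)%N ->
      @Um R (P_ P0 (2 * n + 1)%N)
      = Um_orbit (pi_ P0 (2 * n + 1)%N (2 * n + 1)%N) (E P0 (2 * n + 1)%N)) ->
   forall v : V R, Vtilde v ->
     exists (a : {linear P_ P0 3 -> R^o}) (ha : Um a), vaserstein theta0 ha = v)
  /\
  ((forall n : nat, (3 <= n)%N ->
      Um_orbit (pi_ P0 (2 * n)%N (2 * n)%N) (E P0 (2 * n)%N)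
      = Um_orbit (pi_ P0 (2 * n)%N (2 * n)%N) (Einfty_cap_Aut P0 (2 * n)%N)) ->
   Einfty_cap_Aut P0 4 = E P0 4 ->
   forall (a b : {linear P_ P0 3 -> R^o}) (ha : Um a) (hb : Um b),
     vaserstein theta0 ha = vaserstein theta0 hb ->
     Um_orbit a (E P0 3) = Um_orbit b (E P0 3)).
Proof.
split=> [orbit|orbit stable a b ha hb].
  apply: vaserstein_surjective => // k a [m kE] ha.
  (* [P_ P0 n] is [stab] at [n - 2], and for [n = 2 (m + 2) + 1] this equals [k.+1] only up to a
     proof; an arbitrary [K] with an equation lets [subst] bridge the gap. *)
  have row K (l : {linear stab P0 K -> R^o}) : K = (2 * m.+2 + 1 - 2)%N -> Um l ->
      exists2 eps : {linear stab P0 K -> stab P0 K}, Estab eps &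
        forall x, l x = stab_prj P0 K K.-1 (eps x).
    move=> KE; subst K.
    rewrite orbit // => -[eps heps lE]; exists eps => // x.
    by rewrite lE /= /pi_ -subn1 -subnDA.
  have [|eps heps epsE] := row k.+1 a _ ha.
    by rewrite kE mulnC muln2 addn1 subn2 /= !doubleS addn2.
  by exists eps => // x; rewrite epsE stab_prj_top.
move=> /(vaserstein_injective hP0 hrk htheta0) [|f bf hf|delta hd dE].
- move=> k f [m kE] bf hf.
  (* The hypothesis starts at [P_6], which is [stab 4]: for [k = 2 m + 2] it is applied at
     [m + 3]. *)
  have row K (g : {linear stab P0 K -> stab P0 K}) : K = (2 * m.+3 - 2)%N -> bijective g ->
      stably_elementary g -> exists2 eps : {linear stab P0 K -> stab P0 K}, Estab eps &
        forall x, stab_prj P0 K K.-1 (g x) = stab_prj P0 K K.-1 (eps x).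
    move=> KE; subst K => bg hg.
    have : Um_orbit (pi_ P0 (2 * m.+3) (2 * m.+3)) (Einfty_cap_Aut P0 (2 * m.+3))
        (pi_ P0 (2 * m.+3) (2 * m.+3) \o g) by exists g.
    rewrite -orbit // => -[eps heps epsE].
    exists eps => // x; rewrite -subn1 -subnDA.
    exact: (congr1 (fun l : stab P0 _ -> R^o => l x) epsE).
  have [|eps heps epsE] := row k.+2 f _ bf hf.
    by rewrite kE mulnC muln2 subn2 /= !doubleS addn2.
  by exists eps => // x; have := epsE x; rewrite !stab_prj_top.
- suff : E P0 4 f by [].
  by rewrite -stable.
exact: (@Um_orbit_E R P0 3 a b delta hd dE).
Qed.
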